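(* Let $k$ be an algebraically closed field. Let $A$ be a $\mathbb{Z}$-graded finitely generated $k$-algebra with $A_n \neq 0$ for all $n \in \mathbb{Z}$. Assume that $A$ is a birationally commutative Ore domain with $Q = Q_{\rm gr}(A) = K[t, t^{-1}; \sigma]$, and that $\operatorname{GKdim}(A) = \operatorname{tr.deg}(K/k) + 1$. (1) Suppose that $Q$ is centerless. Then $K = k(x_1, \dots, x_m)$ is a rational function field such that either (A) $\sigma(x_1)=x_1+1$, $\sigma(x_i)=p_ix_i$ with $p_i\in k$ for $i\ge2$, and $T=k[x_1,x_2^{\pm1},\dots,x_m^{\pm1}]$; or (B) $\sigma(x_i)=p_ix_i$ with $p_i\in k$ for $i\ge1$, and $T=k[x_1^{\pm1},x_2^{\pm1},\dots,x_m^{\pm1}]$, where in each case the $p_i$ generate a free abelian subgroup of $k^\times$, and $\operatorname{char}k=0$ if case (A) occurs; and $A_0\subseteq T$ for the corresponding ring $T$. (2) If $Q$ is centerless and $A$ is simple, then $A_0 = T$. (3) If $A$ is primitive and noetherian and the base field $k$ is uncountable, then $Q$ is automatically centerless.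
   Context: For a $\mathbb{Z}$-graded Ore domain $A$, $Q_{\rm gr}(A)$ is the localization of $A$ at the nonzero homogeneous elements; $A$ is birationally commutative if $Q_{\rm gr}(A)\cong K[t,t^{-1};\sigma]$ for a field $K$ with $k$-automorphism $\sigma$, where $ta=\sigma(a)t$ for $a\in K$, $K$ is in degree $0$ and $\deg t=1$. A $k$-algebra is centerless if its center equals $k$. $\operatorname{GKdim}$ is Gelfand-Kirillov dimension over $k$. The ring $T$ in (1) is the sum of all generalized eigenspaces of $\sigma$ acting $k$-linearly on $K$. *)

(* Defs.v *)
From mathcomp Require Import all_boot all_order all_algebra.
From mathcomp Require Import all_classical all_reals all_analysis.
(* Its notations clash with those of all_analysis. *)
From mathcomp Require Import(canonicals) mpoly.

Set Implicit Arguments.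
Unset Strict Implicit.
Unset Printing Implicit Defensive.

Import GRing.Theory.
Local Open Scope classical_set_scope.
Local Open Scope ring_scope.

Section Modules.
Variables (R : nzRingType) (M : lmodType R).

Definition is_submodule (N : set M) : Prop :=
  [/\ N 0, (forall x y, N x -> N y -> N (x + y))
    & (forall r x, N x -> N (r *: x))].

Definition lspan (S : set M) : set M := smallest is_submodule S.

Definition lin_indep (d : nat) (e : 'I_d -> M) : Prop :=
  forall c : 'I_d -> R, \sum_(i < d) c i *: e i = 0 -> forall i, c i = 0.

(* The number of elements of a finite basis; 0 by convention if there is
   none. It is only used on spans of finite sets. *)
Definition dimension (N : set M) : nat :=
  xget 0%N [set d | exists e : 'I_d -> M, lin_indep e /\ lspan (range e) = N].

Definition simple_module : Prop :=
  (exists x : M, x != 0) /\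
  (forall N : set M, is_submodule N -> N = [set 0] \/ N = setT).

Definition faithful_module : Prop :=
  forall r : R, (forall x : M, r *: x = 0) -> r = 0.

End Modules.

Section Rings.
Variable R : nzRingType.

Definition is_left_ideal (I : set R) : Prop :=
  [/\ I 0, (forall x y, I x -> I y -> I (x + y))
    & (forall a x, I x -> I (a * x))].

Definition is_ideal (I : set R) : Prop :=
  is_left_ideal I /\ (forall x a, I x -> I (x * a)).

Definition simple_ring : Prop :=
  forall I : set R, is_ideal I -> I = [set 0] \/ I = setT.

Definition left_noetherian : Prop :=
  forall I : nat -> set R,
    (forall n, is_left_ideal (I n)) -> (forall n, I n `<=` I n.+1) ->
    exists n, forall m, (n <= m)%N -> I m = I n.

Definition left_primitive : Prop :=
  exists M : lmodType R, simple_module M /\ faithful_module M.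

Definition domain : Prop := forall a b : R, a * b = 0 -> a = 0 \/ b = 0.

Definition ore_domain : Prop :=
  [/\ domain,
      (forall a b : R, a != 0 -> b != 0 ->
         exists c d : R, a * c = b * d /\ a * c != 0)
    & (forall a b : R, a != 0 -> b != 0 ->
         exists c d : R, c * a = d * b /\ c * a != 0)].

End Rings.

(* Right-handed notions are the left-handed ones of the opposite ring [R^c]. *)
Definition noetherian (R : nzRingType) : Prop :=
  left_noetherian R /\ left_noetherian R^c.

Definition primitive (R : nzRingType) : Prop :=
  left_primitive R \/ left_primitive R^c.

(* A k-algebra is presented here by its structure map [iota : k -> B]. *)
Section Generation.
Variables (k B : nzRingType) (iota : k -> B).

Definition is_subalgebra (M : set B) : Prop :=
  [/\ (forall c, M (iota c)), (forall x y, M x -> M y -> M (x + y))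
    & (forall x y, M x -> M y -> M (x * y))].

Definition generated_algebra (S : set B) : set B := smallest is_subalgebra S.

End Generation.

Section FieldExtensions.
Variables (k K : fieldType) (iota : k -> K).

Definition is_intermediate_field (M : set K) : Prop :=
  is_subalgebra iota M /\ (forall x, M x -> M x^-1).

Definition generated_field (S : set K) : set K :=
  smallest is_intermediate_field S.

Definition alg_indep (m : nat) (x : 'I_m -> K) : Prop :=
  forall p : mpoly.mpoly m k, mpoly.mmap iota x p = 0 -> p = 0.

Definition algebraic_over (F : set K) (a : K) : Prop :=
  exists p : {poly K}, [/\ p != 0, (forall n, F p`_n) & root p a].

Definition has_trdeg (d : nat) : Prop :=
  exists x : 'I_d -> K, alg_indep x /\
    (forall a, algebraic_over (generated_field (range x)) a).

Definition is_rational_function_field (m : nat) (x : 'I_m -> K) : Prop :=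
  alg_indep x /\ generated_field (range x) = setT.

End FieldExtensions.

Section GeneralizedEigenspaces.
Variables (k K : fieldType) (iota : k -> K) (sigma : K -> K).

Definition generalized_eigenspace (lam : k) : set K :=
  [set a | exists n, iter n (fun b => sigma b - iota lam * b) a = 0].

Definition sum_generalized_eigenspaces : set K :=
  [set a | exists s : seq K, a = \sum_(b <- s) b /\
     (forall b, b \in s -> exists lam, generalized_eigenspace lam b)].

End GeneralizedEigenspaces.

(* The subgroup of k^* generated by the [p i] is free abelian on the [p i]. *)
Definition freely_generate (k : fieldType) (m : nat) (p : 'I_m -> k) : Prop :=
  (forall i, p i != 0) /\
  (forall n : 'I_m -> int, \prod_(i < m) p i ^ n i = 1 -> forall i, n i = 0).

Section Algebras.
Variables (k : fieldType) (A : algType k).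

Definition fin_gen_algebra : Prop :=
  exists X : seq A, generated_algebra (GRing.in_alg A) [set` X] = setT.

Definition centerless : Prop :=
  [set z : A | forall y, z * y = y * z] = range (GRing.in_alg A).

(* If V is the span of X, this is the dimension of V^0 + V^1 + ... + V^n. *)
Definition growth (X : seq A) (n : nat) : nat :=
  dimension (lspan [set \prod_(a <- w) a |
    w in [set w : seq A | (size w <= n)%N /\ {subset w <= X}]]).

Definition GKdim (R : realType) : \bar R :=
  ereal_sup [set limn_esup
    (fun n => (ln ((growth X n)%:R : R) / ln (n%:R : R))%:E) | X in [set: seq A]].

Definition is_grading (gr : int -> set A) : Prop :=
  [/\ (forall n, is_submodule (gr n)) /\ gr 0 1,
      (forall m n a b, gr m a -> gr n b -> gr (m + n) (a * b)),
      (forall a, exists (s : seq int) (f : int -> A),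
         [/\ uniq s, (forall n, gr n (f n)) & a = \sum_(n <- s) f n])
    & (forall (s : seq int) (f : int -> A),
         uniq s -> (forall n, gr n (f n)) -> \sum_(n <- s) f n = 0 ->
         forall n, n \in s -> f n = 0)].

Definition nonzero_homogeneous (gr : int -> set A) : set A :=
  [set a | a != 0 /\ exists n, gr n a].

Variables (Q : unitAlgType k).

(* Two-sided Ore localization at a set S of regular elements. *)
Definition is_localization (S : set A) (i : A -> Q) : Prop :=
  [/\ injective i,
      (forall s, S s -> i s \is a GRing.unit),
      (forall q, exists a s, S s /\ q = i a * (i s)^-1)
    & (forall q, exists a s, S s /\ q = (i s)^-1 * i a)].

Definition localization_degree (gr : int -> set A) (i : A -> Q) (n : int) :
    set Q :=
  [set q | exists m a s,
     [/\ gr (n + m) a, gr m s, s != 0 & q = i a * (i s)^-1]].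

End Algebras.

(* Q is the skew Laurent ring K[t, t^-1; sigma], with j the inclusion of K:
   a free left K-module on the powers of t, with t a = sigma(a) t. *)
Definition is_skew_laurent (K : fieldType) (sigma : K -> K) (Q : unitRingType)
    (j : K -> Q) (t : Q) : Prop :=
  [/\ t \is a GRing.unit,
      (forall a, t * j a = j (sigma a) * t),
      (forall q, exists (s : seq int) (f : int -> K),
         uniq s /\ q = \sum_(n <- s) j (f n) * t ^ n)
    & (forall (s : seq int) (f : int -> K),
         uniq s -> \sum_(n <- s) j (f n) * t ^ n = 0 ->
         forall n, n \in s -> f n = 0)].

(* Q is Q_gr(A), and it is graded-isomorphic (over k) to K[t, t^-1; sigma]
   with K in degree 0 and t in degree 1. *)
Definition is_birationally_commutative (k : fieldType) (A : algType k)
    (gr : int -> set A) (K : fieldType) (iota : k -> K) (sigma : K -> K)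
    (Q : unitAlgType k) (i : A -> Q) (j : K -> Q) (t : Q) : Prop :=
  [/\ is_localization (nonzero_homogeneous gr) i,
      is_skew_laurent sigma j t,
      (forall c, j (iota c) = c%:A)
    & (forall n, localization_degree gr i n = range (fun b => j b * t ^ n))].

(* Main.v *)
Require Import Defs.
From mathcomp Require Import all_boot all_order all_algebra.
From HB Require Import structures.
From mathcomp Require Import all_classical all_reals all_analysis.
From mathcomp Require Import(canonicals) mpoly.
From mathcomp Require Import ring lra.

(** Write K for the degree 0 part of Q and A_0 for the degree 0 part of A.

    Growth. If the conjugates of some a in A_0 under sigma were linearly
    independent over k, one could pick a finite B in A_0 (up to a common
    denominator) containing 1, a transcendence basis and n conjugates of a,
    with n as large as desired. An isoperimetric inequality for products of
    subspaces of a field, extended to transcendence degree d by passing to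
    purely transcendental subfields, shows that the products of O(n) elements
    of B span a space of dimension at least n^(d+e) for a fixed e > 0.
    Multiplying by powers of t, the growth of A would exceed n^(d+1+e),
    against GKdim A = d + 1. So sigma acts locally finitely on A_0, that is
    A_0 is contained in T.

    Structure. When Q is centerless, the fixed field of sigma is k, so each
    eigenspace of sigma is a line and the generalized eigenspace for 1 is k or
    k[x] with sigma x = x + 1. Since A is finitely generated and K is the field
    of fractions of A_0, finitely many eigenvectors generate K over that
    space; a minimal such family has multiplicatively independent eigenvalues.
    Independence of generalized eigenspaces gives algebraic independence, and
    every eigenvector is a unit of k[x, z^(+-1)], which is therefore T.

    Simplicity. For a generator y of T, the a in A with a y in A form a
    nonzero ideal, so y is in A_0.

    Primitivity. A central z of Q acts on a faithful simple module M, which has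
    countable dimension; as k is uncountable, z - c is not invertible on M for
    some c in k, whence z = c. *)

Set Implicit Arguments.
Unset Strict Implicit.
Unset Printing Implicit Defensive.
Import Order.TTheory GRing.Theory Num.Theory.
Local Open Scope classical_set_scope.
Local Open Scope ring_scope.

(** * Linear algebra *)

(** The gain in the growth estimate is a matter of exponents. Passing from F to F(y) can make the
    rank of B collapse, for instance when B consists of powers of y. It cannot collapse over both
    F(y_0) and F(y_1) for independent y_0, y_1: over one of them at least the square root of the
    rank survives. Adjoining transcendentals thus costs square roots, so B is taken with n = m^(2^d)
    independent conjugates, and products of (d+1)n elements have rank at least n^d m. Powers of a
    degree one element contribute another factor n, and m = n^(1/2^d) is the excess that contradicts
    GKdim A = d + 1. Word length stays linear in n because K is commutative: factors sigma^r(v) with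
    r < n can be sorted by r, and then one pass through n - 1 letters of degree one realises all the
    conjugations. *)

Section LinearAlgebra.
Variables (F : fieldType) (V : lmodType F).

Definition in_span n (e : 'I_n -> V) (v : V) : Prop :=
  exists c : 'I_n -> F, v = \sum_(i < n) c i *: e i.

(** A lower bound for the dimension of the span that presupposes no finiteness and can be tested on
    a generating set, see [rank_ge_lspan]. Its negation expresses finite dimension. *)
Definition rank_ge (S : set V) (q : nat) : Prop :=
  exists e : 'I_q -> V, lin_indep e /\ forall i, S (e i).

Definition has_dim (X : set V) (n : nat) : Prop :=
  exists e : 'I_n -> V, lin_indep e /\ X = [set v | in_span e v].

Lemma in_spanP n m (s : 'I_m -> V) (e : 'I_n -> V) :
  (forall i, in_span s (e i)) ->
  exists C : 'M[F]_(n, m), forall i, e i = \sum_j C i j *: s j.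
Proof.
move=> /(_ _)/cid-/all_sig[C CE]; exists (\matrix_(i, j) C i j) => i.
by rewrite CE; apply: eq_bigr => j _; rewrite mxE.
Qed.

Lemma sum_scale_mulmx n m p (C : 'M[F]_(n, m)) (s : 'I_m -> V)
    (N : 'M[F]_(p, n)) i :
  \sum_j N i j *: (\sum_l C j l *: s l) = \sum_l (N *m C) i l *: s l.
Proof.
under eq_bigr do rewrite scaler_sumr.
rewrite exchange_big /=; apply: eq_bigr => l _.
by rewrite mxE scaler_suml; apply: eq_bigr => j _; rewrite scalerA.
Qed.

(** A coordinate matrix with more rows than columns has a nonzero left kernel vector, which is a
    relation among the [e i]. *)
Lemma steinitz n m (e : 'I_n -> V) (s : 'I_m -> V) :
  lin_indep e -> (forall i, in_span s (e i)) -> (n <= m)%N.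
Proof.
move=> e_free /in_spanP[C CE]; rewrite leqNgt; apply/negP => lt_mn.
have /rowV0Pn[v /sub_kermxP vC0 /eqP] : kermx C != 0.
  rewrite -mxrank_eq0 mxrank_ker subn_eq0 -ltnNge.
  exact: leq_ltn_trans (rank_leq_col _) lt_mn.
case; apply/rowP => i; rewrite mxE; move: i; apply: e_free.
under eq_bigr do rewrite CE.
by rewrite sum_scale_mulmx vC0 big1 // => l _; rewrite mxE scale0r.
Qed.

Lemma in_span_submodule n (e : 'I_n -> V) : is_submodule [set v | in_span e v].
Proof.
split.
- by exists (fun=> 0); rewrite big1 // => i _; rewrite scale0r.
- move=> _ _ [c ->] [c' ->]; exists (fun i => c i + c' i).
  by rewrite -big_split; apply: eq_bigr => i _; rewrite scalerDl.
- move=> r _ [c ->]; exists (fun i => r * c i).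
  by rewrite scaler_sumr; apply: eq_bigr => i _; rewrite scalerA.
Qed.

Lemma in_span_gen n (e : 'I_n -> V) i : in_span e (e i).
Proof.
exists (fun j => (j == i)%:R); rewrite (bigD1 i) //= eqxx scale1r big1 ?addr0 //.
by move=> j /negPf ->; rewrite scale0r.
Qed.

Lemma submodule_sum (X : set V) (I : Type) (r : seq I) (P : pred I)
    (c : I -> F) (e : I -> V) :
  is_submodule X -> (forall i, P i -> X (e i)) ->
  X (\sum_(i <- r | P i) c i *: e i).
Proof.
move=> [X0 XD XZ] Xe; elim/big_rec: _ => // i x Pi Xx.
by apply: XD => //; apply/XZ/Xe.
Qed.

Lemma lspan_submodule (S : set V) : is_submodule (lspan S).
Proof.
split.
- by move=> N [[N0 ? ?] ?]; exact: N0.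
- by move=> x y Sx Sy N [NN SN]; case: (NN) => _ ND _; apply: ND;
    [apply: Sx|apply: Sy].
- by move=> r x Sx N [NN SN]; case: (NN) => _ _ NZ; apply: NZ; apply: Sx.
Qed.

Lemma sub_lspan (S : set V) : S `<=` lspan S.
Proof. by move=> x Sx N [_]; exact. Qed.

Lemma lspan_min (S X : set V) : is_submodule X -> S `<=` X -> lspan S `<=` X.
Proof. by move=> XX SX x; apply; split. Qed.

Lemma lspan_range n (e : 'I_n -> V) : lspan (range e) = [set v | in_span e v].
Proof.
apply/seteqP; split.
  apply: lspan_min; first exact: in_span_submodule.
  by move=> _ [i _ <-]; exact: in_span_gen.
move=> _ [c ->]; apply: submodule_sum; first exact: lspan_submodule.
by move=> i _; apply: sub_lspan; exists i.
Qed.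

Lemma lin_indep_extend n (e : 'I_n -> V) v :
  lin_indep e -> ~ in_span e v ->
  lin_indep (fun i : 'I_n.+1 => oapp e v (unlift ord0 i)).
Proof.
move=> e_free nv c; rewrite big_ord_recl unlift_none /=.
under eq_bigr do rewrite liftK /=.
move=> c0; have c00 : c ord0 = 0.
  apply/eqP/negP => /negP c0n0; apply: nv.
  exists (fun i => - (c ord0)^-1 * c (lift ord0 i)).
  under eq_bigr do rewrite -scalerA; rewrite -scaler_sumr.
  move/eqP: c0; rewrite addrC addr_eq0 => /eqP ->.
  by rewrite scalerN scaleNr opprK scalerA mulVf // scale1r.
move: c0; rewrite c00 scale0r add0r => /e_free cl i.
by case: (unliftP ord0 i) => [j ->|->].
Qed.

Lemma lin_indep_neq0 n (e : 'I_n -> V) i : lin_indep e -> e i != 0.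
Proof.
move=> e_free; apply/negP => /eqP e0; have /eqP := oner_neq0 F; apply.
have := e_free (fun j => (j == i)%:R) _ i; rewrite eqxx; apply.
rewrite (bigD1 i) //= e0 scaler0 add0r big1 // => j /negPf ->.
by rewrite scale0r.
Qed.

Lemma lin_indep_inj (I : finType) n (e : I -> V) (f : 'I_n -> I) :
  (forall c : I -> F, \sum_i c i *: e i = 0 -> forall i, c i = 0) ->
  injective f -> lin_indep (e \o f).
Proof.
move=> e_free f_inj c c0 i.
rewrite -[RHS](e_free (fun j => \sum_(i | f i == j) c i) _ (f i)).
  rewrite (big_pred1 i) // => j; apply/eqP/eqP => [/f_inj //|-> //].
rewrite -[RHS]c0 [RHS](partition_big f xpredT) //=; apply: eq_bigr => j _.
by rewrite scaler_suml; apply: eq_bigr => l /eqP <-.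
Qed.

Lemma rank_ge_fin (S : set V) (I : finType) (e : I -> V) :
  (forall c : I -> F, \sum_i c i *: e i = 0 -> forall i, c i = 0) ->
  (forall i, S (e i)) -> rank_ge S #|I|.
Proof.
move=> e_free Se; exists (e \o enum_val); split=> [|i]; last exact: Se.
exact: (lin_indep_inj e_free enum_val_inj).
Qed.

Lemma rank_ge_le (S : set V) q q' : (q' <= q)%N -> rank_ge S q -> rank_ge S q'.
Proof.
move=> le_q [e [e_free Se]]; exists (e \o widen_ord le_q); split=> [|i] //=.
by apply: (lin_indep_inj e_free) => i j /(congr1 val) /= /val_inj.
Qed.

Lemma rank_ge_sub (S S' : set V) q : S `<=` S' -> rank_ge S q -> rank_ge S' q.
Proof. by move=> sub [e [e_free Se]]; exists e; split=> // i; apply: sub. Qed.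

Lemma rank_ge0 (S : set V) : rank_ge S 0.
Proof. by exists (fun=> 0); split=> [c _ i|i]; case: i. Qed.

Lemma rank_max (S : set V) q : ~ rank_ge S q ->
  exists r, [/\ (r < q)%N, rank_ge S r & forall r', rank_ge S r' -> (r' <= r)%N].
Proof.
move=> nq; pose P r := `[<rank_ge S r>].
have exP : exists r, P r by exists 0%N; apply/asboolP; exact: rank_ge0.
have bP r : P r -> (r <= q)%N.
  move/asboolP => Sr; rewrite leqNgt; apply/negP => /ltnW lt_qr.
  by apply: nq; exact: rank_ge_le Sr.
case: (ex_maxnP exP bP) => r /asboolP Sr rmax; exists r; split=> //.
  rewrite ltnNge; apply/negP => le_qr; apply: nq; exact: rank_ge_le Sr.
by move=> r' Sr'; apply: rmax; apply/asboolP.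
Qed.

Lemma max_rank_span (S : set V) r (e : 'I_r -> V) :
  lin_indep e -> (forall r', rank_ge S r' -> (r' <= r)%N) ->
  (forall i, S (e i)) -> forall v, S v -> in_span e v.
Proof.
move=> e_free rmax Se v Sv; apply: contrapT => nv.
have : rank_ge S r.+1.
  exists (fun i : 'I_r.+1 => oapp e v (unlift ord0 i)); split.
    exact: lin_indep_extend.
  by move=> i /=; case: unliftP => [j|] /=.
by move/rmax; rewrite ltnn.
Qed.

Lemma rank_basis (S : set V) q : ~ rank_ge S q ->
  exists r (e : 'I_r -> V), [/\ (r < q)%N, lin_indep e, (forall i, S (e i))
    & lspan S = [set v | in_span e v]].
Proof.
move=> /rank_max[r [lt_rq [e [e_free Se]] rmax]]; exists r, e; split=> //.
apply/seteqP; split.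
  apply: lspan_min; first exact: in_span_submodule.
  exact: max_rank_span.
rewrite -lspan_range; apply: lspan_min; first exact: lspan_submodule.
by move=> _ [i _ <-]; exact: sub_lspan.
Qed.

(** A maximal independent family chosen inside [S] already spans, so no independent family of the
    span is longer. *)
Lemma rank_ge_lspan (S : set V) q : rank_ge (lspan S) q -> rank_ge S q.
Proof.
move=> [e [e_free Se]]; apply: contrapT => /rank_basis[r [f [lt_rq _ _ SE]]].
have : (q <= r)%N by apply: (@steinitz _ _ e f) => // i; have := Se i; rewrite SE.
by rewrite leqNgt lt_rq.
Qed.

Lemma rank_seq (s : seq V) : ~ rank_ge [set` s] (size s).+1.
Proof.
move=> [e [e_free se]].
suff : ((size s).+1 <= size s)%N by rewrite ltnn.
apply: (@steinitz _ _ e (fun i : 'I_(size s) => s`_i)) => // i.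
have /(nthP 0)[j lt_j <-] := se i.
exact: (in_span_gen (fun i : 'I_(size s) => s`_i) (Ordinal lt_j)).
Qed.

(** [dimension] defaults to 0 when there is no finite basis; [~ rank_ge S N] supplies the
    finiteness. *)
Lemma dimension_ge (S : set V) N q : ~ rank_ge S N -> rank_ge (lspan S) q ->
  (q <= dimension (lspan S))%N.
Proof.
move=> /rank_basis[r [f [_ f_free Sf SE]]] [e [e_free Se]].
rewrite /dimension; case: xgetP => [d _ [g [g_free gE]]|no].
  by apply: (@steinitz _ _ e g) => // i; have := Se i; rewrite -gE lspan_range.
by case: (no r); exists f; rewrite lspan_range SE.
Qed.

Lemma has_dim_lspan (S : set V) N : ~ rank_ge S N -> exists r, has_dim (lspan S) r.
Proof. by move=> /rank_basis[r [e [_ e_free _ SE]]]; exists r, e. Qed.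

Lemma has_dim_rank (X : set V) n q : has_dim X n -> rank_ge X q <-> (q <= n)%N.
Proof.
move=> [e [e_free ->]]; split=> [[f [f_free Xf]]|le_qn].
  exact: (steinitz f_free Xf).
by apply: (rank_ge_le le_qn); exists e; split=> // i; exact: in_span_gen.
Qed.

Lemma has_dim_submodule (X : set V) n : has_dim X n -> is_submodule X.
Proof. by move=> [e [_ ->]]; exact: in_span_submodule. Qed.

Lemma submodule_lspan (X : set V) : is_submodule X -> lspan X = X.
Proof.
move=> XX; apply/seteqP; split; first exact: lspan_min.
exact: sub_lspan.
Qed.

Lemma has_dim_sub (X Y : set V) m : is_submodule X -> X `<=` Y -> has_dim Y m ->
  exists2 n, has_dim X n & (n <= m)%N.
Proof.
move=> XX XY Ym; have : ~ rank_ge X m.+1.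
  by move/(rank_ge_sub XY)/(has_dim_rank _ Ym); rewrite ltnn.
move/rank_basis; rewrite submodule_lspan // => -[r [e [lt_r e_free Xe XE]]].
by exists r => //; exists e.
Qed.

Lemma has_dim_sub_eq (X Y : set V) n : X `<=` Y -> has_dim X n -> has_dim Y n ->
  X = Y.
Proof.
move=> XY Xn Yn; apply/seteqP; split=> //.
case: Xn XY => e [e_free ->] XY v Yv; apply: (@max_rank_span Y) => //.
  by move=> r /(has_dim_rank _ Yn).
by move=> i; apply: XY; exact: in_span_gen.
Qed.

Lemma has_dim_uniq (X : set V) n m : has_dim X n -> has_dim X m -> n = m.
Proof.
move=> Xn Xm; apply/eqP; rewrite eqn_leq; apply/andP; split.
  by apply/(has_dim_rank _ Xm)/(has_dim_rank _ Xn).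
by apply/(has_dim_rank _ Xn)/(has_dim_rank _ Xm).
Qed.

(** Together with [has_dim_coord], this identifies finite-dimensional subspaces of the span of [b]
    with row spaces, so that matrix rank theory applies. *)
Lemma has_dim_mx N (b : 'I_N -> V) p (M : 'M[F]_(p, N)) : lin_indep b ->
  has_dim [set v | exists2 w : 'rV_N, (w <= M)%MS & v = \sum_j w 0 j *: b j]
    (\rank M).
Proof.
move=> b_free; exists (fun i => \sum_j row_base M i j *: b j); split.
  move=> c c0 i; pose w := \row_j c j.
  have : w *m row_base M = 0.
    apply/rowP => j; rewrite [RHS]mxE; move: j; apply: b_free.
    rewrite -[RHS]c0 -sum_scale_mulmx; apply: eq_bigr => j _.
    by rewrite mxE.
  rewrite -(mul0mx _ (row_base M)) => /(row_free_inj (row_base_free M)).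
  by move/rowP/(_ i); rewrite !mxE.
apply/seteqP; split=> [v [w]|v [c ->]].
  rewrite -(eq_row_base M) => /submxP[D ->] ->; exists (fun i => D 0 i).
  by rewrite -sum_scale_mulmx.
exists ((\row_i c i) *m row_base M).
  by rewrite -(eq_row_base M) submxMl.
by rewrite -sum_scale_mulmx; apply: eq_bigr => i _; rewrite mxE.
Qed.

Lemma has_dim_coord N (b : 'I_N -> V) (X : set V) n :
  lin_indep b -> X `<=` [set v | in_span b v] -> has_dim X n ->
  exists M : 'M[F]_(n, N),
    X = [set v | exists2 w : 'rV_N, (w <= M)%MS & v = \sum_j w 0 j *: b j].
Proof.
move=> b_free Xb [e [e_free XE]].
have /in_spanP[M ME] : forall i, in_span b (e i).
  by move=> i; apply: Xb; rewrite XE; exact: in_span_gen.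
exists M; rewrite XE; apply/seteqP; split=> [v [c ->]|v [w /submxP[D ->] ->]].
  exists ((\row_i c i) *m M); first exact: submxMl.
  rewrite -sum_scale_mulmx; apply: eq_bigr => i _.
  by rewrite mxE -ME.
exists (fun i => D 0 i); rewrite -sum_scale_mulmx.
by apply: eq_bigr => i _; rewrite -ME.
Qed.

Definition set_sum (X Y : set V) : set V :=
  [set v | exists x y, [/\ X x, Y y & v = x + y]].

Lemma has_dim_sum_cap (X Y : set V) a b : has_dim X a -> has_dim Y b ->
  exists c s, [/\ has_dim (X `&` Y) c, has_dim (set_sum X Y) s
    & (c + s = a + b)%N].
Proof.
move=> Xa Yb; case: (Xa) (Yb) => e [e_free XE] [f [f_free YE]].
pose L := [seq e i | i <- enum 'I_a] ++ [seq f i | i <- enum 'I_b].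
have [N [g [_ g_free _ LE]]] := rank_basis (@rank_seq L).
have sub n (h : 'I_n -> V) : (forall i, h i \in L) ->
    [set v | in_span h v] `<=` [set v | in_span g v].
  move=> hL; rewrite -lspan_range -LE; apply: lspan_min.
    exact: lspan_submodule.
  by move=> _ [i _ <-]; apply: sub_lspan; exact: hL.
have Xg : X `<=` [set v | in_span g v].
  rewrite XE; apply: sub => i; rewrite mem_cat; apply/orP; left.
  by apply/mapP; exists i; rewrite ?mem_enum.
have Yg : Y `<=` [set v | in_span g v].
  rewrite YE; apply: sub => i; rewrite mem_cat; apply/orP; right.
  by apply/mapP; exists i; rewrite ?mem_enum.
have [M ME] := has_dim_coord g_free Xg Xa.
have [M' ME'] := has_dim_coord g_free Yg Yb.
have rkM : \rank M = a.
  by apply: (has_dim_uniq _ Xa); rewrite ME; exact: has_dim_mx.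
have rkM' : \rank M' = b.
  by apply: (has_dim_uniq _ Yb); rewrite ME'; exact: has_dim_mx.
exists (\rank (M :&: M')), (\rank (M + M')%MS); split.
- have := has_dim_mx (M :&: M')%MS g_free; congr has_dim.
  rewrite ME ME'; apply/seteqP; split=> [v [w]|v [[w wM ->] [w' w'M ww']]].
    by rewrite sub_capmx => /andP[wM wM'] ->; split; exists w.
  exists w => //; rewrite sub_capmx wM /=.
  suff -> : w = w' by [].
  apply/eqP; rewrite -subr_eq0; apply/eqP/rowP => i; rewrite [RHS]mxE.
  move: i; apply: g_free.
  transitivity (\sum_j w 0 j *: g j - \sum_j w' 0 j *: g j).
    rewrite -sumrB; apply: eq_bigr => j _.
    by rewrite !mxE scalerBl.
  by rewrite ww' subrr.
- have := has_dim_mx (M + M')%MS g_free; congr has_dim.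
  rewrite ME ME'; apply/seteqP; split=> [v [w]|].
    move=> /sub_addsmxP[[u u'] -> ->] /=.
    exists (\sum_j (u *m M) 0 j *: g j), (\sum_j (u' *m M') 0 j *: g j).
    split; [by exists (u *m M); rewrite ?submxMl|
      by exists (u' *m M'); rewrite ?submxMl|].
    by rewrite -big_split; apply: eq_bigr => j _; rewrite mxE scalerDl.
  move=> _ [_ [_ [[w wM ->] [w' wM' ->] ->]]]; exists (w + w').
    by apply: addmx_sub_adds.
  by rewrite -big_split; apply: eq_bigr => j _; rewrite mxE scalerDl.
- by rewrite addnC mxrank_sum_cap rkM rkM'.
Qed.

(** The rows of [N] are independent relations among the [c i]. Rank-nullity gives more than [n - M]
    of them, as the [c i] span fewer than [M] dimensions. *)
Lemma kernel_family n (c : 'I_n -> V) M : ~ rank_ge [set w | in_span c w] M ->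
  exists p (N : 'M[F]_(p, n)), [/\ (n < p + M)%N, row_free N
    & forall r, \sum_m N r m *: c m = 0].
Proof.
move=> /rank_basis[r [e [lt_rM e_free Se SE]]].
have /in_spanP[C CE] : forall i, in_span e (c i).
  move=> i; have : lspan [set w | in_span c w] (c i).
    by apply: sub_lspan; exact: in_span_gen.
  by rewrite SE.
exists (\rank (kermx C)), (row_base (kermx C)); split.
- rewrite mxrank_ker; have := rank_leq_col C; have := rank_leq_row C.
  move: (\rank C) => s le1 le2; rewrite -(subnK le1) in lt_rM *.
  rewrite addnK -addnS leq_add2l; exact: leq_ltn_trans lt_rM.
- exact: row_base_free.
- move=> q; under eq_bigr do rewrite CE.
  rewrite sum_scale_mulmx.
  have /sub_kermxP -> : (row_base (kermx C) <= kermx C)%MS.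
    by rewrite eq_row_base.
  by rewrite big1 // => l _; rewrite mxE scale0r.
Qed.

End LinearAlgebra.

(** The alias lets one additive group carry several vector space structures: ranks over F, F(y) and
    F(y_0, y_1) are compared below, and [fmod g] is K as a vector space over the source of [g]. *)
Definition restr (F R : nzRingType) (g : {rmorphism F -> R}) (M : lmodType R) :
  Type := M.

Section Restriction.
Variables (F R : nzRingType) (g : {rmorphism F -> R}) (M : lmodType R).

HB.instance Definition _ := GRing.Zmodule.on (restr g M).

Fact restr_scaleA a b (v : restr g M) :
  g a *: (g b *: (v : M)) = g (a * b) *: (v : M).
Proof. by rewrite scalerA rmorphM. Qed.
Fact restr_scale1 (v : restr g M) : g 1 *: (v : M) = v.
Proof. by rewrite rmorph1 scale1r. Qed.
Fact restr_scaleDr a (u v : restr g M) :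
  g a *: ((u + v : restr g M) : M) = g a *: (u : M) + g a *: (v : M).
Proof. exact: scalerDr. Qed.
Fact restr_scaleDl (v : restr g M) a b :
  g (a + b) *: (v : M) = g a *: (v : M) + g b *: (v : M).
Proof. by rewrite rmorphD scalerDl. Qed.

HB.instance Definition _ := GRing.Zmodule_isLmodule.Build F (restr g M)
  restr_scaleA restr_scale1 restr_scaleDr (fun v => restr_scaleDl v).

End Restriction.

Notation fmod g := (restr g (_^o)).

(** * Products of subspaces of a field *)

Section FieldRank.
Variables (F K : fieldType) (g : {rmorphism F -> K}).

Definition rk (S : set K) (q : nat) : Prop := @rank_ge F (fmod g) S q.

Lemma rk_fin (S : set K) (I : finType) (e : I -> K) :
  (forall c : I -> F, \sum_i g (c i) * e i = 0 -> forall i, c i = 0) ->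
  (forall i, S (e i)) -> rk S #|I|.
Proof. exact: (@rank_ge_fin F (fmod g)). Qed.

Fixpoint prods (B : set K) (n : nat) : set K :=
  if n is n'.+1 then [set x * b | x in prods B n' & b in B] else [set 1].

Lemma prodsD (B : set K) m n x y :
  prods B m x -> prods B n y -> prods B (m + n) (x * y).
Proof.
move=> Bx; elim: n y => [|n IHn] y /=; first by move=> ->; rewrite addn0 mulr1.
move=> [z Bz [b Bb <-]]; rewrite addnS /= mulrA; exists (x * z); last by exists b.
exact: IHn.
Qed.

Lemma prodsX (B : set K) x n : B x -> prods B n (x ^+ n).
Proof.
move=> Bx; elim: n => [|n IHn] //=; rewrite exprSr; exists (x ^+ n) => //.
by exists x.
Qed.

(** A common denominator [s] for [B] becomes [s ^+ n] for products of [n] elements; this brings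
    fractions back into A_0. *)
Lemma prods_scale (B B' : set K) s n x : (forall b, B b -> B' (s * b)) ->
  prods B n x -> prods B' n (s ^+ n * x).
Proof.
move=> BB'; elim: n x => [|n IHn] x /=; first by move=> ->; rewrite mul1r.
move=> [y By [b Bb <-]]; exists (s ^+ n * y); first exact: IHn.
by exists (s * b); [exact: BB'|rewrite exprSr mulrACA].
Qed.

Lemma prods_le (B : set K) m n x : B 1 -> (m <= n)%N ->
  prods B m x -> prods B n x.
Proof.
move=> B1 le_mn Bx; rewrite -(subnKC le_mn) -[x]mulr1; apply: prodsD => //.
by rewrite -(expr1n _ (n - m)); apply: prodsX.
Qed.

Definition mul_span (X U : set K) : set K :=
  @lspan F (fmod g) [set x * u | x in X & u in U].

Local Notation hd X n := (@has_dim F (fmod g) X n).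
Local Notation submod X := (@is_submodule F (fmod g) X).

Lemma mul_span_lspan (X U : set K) :
  mul_span (@lspan F (fmod g) X) (@lspan F (fmod g) U) = mul_span X U.
Proof.
have XU := @lspan_submodule F (fmod g) [set x * u | x in X & u in U].
apply/seteqP; split.
  apply: (@lspan_min F (fmod g)) => // _ [x Xx [u Uu <-]].
  move: (XU) => [N0 ND NZ].
  apply: (Xx [set x | mul_span X U (x * u)]); split.
    split; first by rewrite /= mul0r.
      by move=> a b /= ? ?; rewrite mulrDl; apply: ND.
    by move=> r a /= ?; rewrite -[r *: a]/(g r * a) -mulrA; apply: (NZ r).
  move=> a Xa /=; apply: (Uu [set u | mul_span X U (a * u)]); split.
    split; first by rewrite /= mulr0.
      by move=> b c /= ? ?; rewrite mulrDr; apply: ND.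
    by move=> r b /= ?; rewrite -[r *: b]/(g r * b) mulrCA; apply: (NZ r).
  by move=> b Ub; apply: (@sub_lspan F (fmod g)); exists a => //; exists b.
apply: (@lspan_min F (fmod g)); first exact: (@lspan_submodule F (fmod g)).
move=> _ [x Xx [u Uu <-]]; apply: (@sub_lspan F (fmod g)).
exists x; first exact: sub_lspan.
by exists u => //; exact: sub_lspan.
Qed.

Lemma hd_mul_span (X U : set K) a u : hd X a -> hd U u ->
  exists b, hd (mul_span X U) b.
Proof.
move=> [e [e_free XE]] [f [f_free UE]].
rewrite XE UE -!(@lspan_range F (fmod g)) mul_span_lspan.
pose s := [seq e i * f j | i <- enum 'I_a, j <- enum 'I_u].
apply: (@has_dim_lspan F (fmod g) _ (size s).+1) => rk_s.
apply: (@rank_seq F (fmod g) s); apply: rank_ge_sub rk_s.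
move=> _ [_ [i _ <-] [_ [j _ <-] <-]] /=.
by apply/allpairsP; exists (i, j); rewrite !mem_enum.
Qed.

Lemma mul_span_sub (X X' U : set K) : X `<=` X' ->
  mul_span X U `<=` mul_span X' U.
Proof.
move=> XX'; apply: (@lspan_min F (fmod g)); first exact: (@lspan_submodule F (fmod g)).
by move=> _ [x Xx [u Uu <-]]; apply: (@sub_lspan F (fmod g)); exists x; [apply: XX'|exists u].
Qed.

Lemma hd_scale (X : set K) a x : x != 0 -> hd X a -> hd [set x * z | z in X] a.
Proof.
move=> x0 [e [e_free XE]]; exists (fun i => x * e i); split.
  move=> c c0; apply: e_free; apply: (mulfI x0); rewrite mulr0 -[RHS]c0.
  rewrite mulr_sumr; apply: eq_bigr => i _.
  by rewrite -![_ *: _]/(g (c i) * _) mulrCA.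
rewrite XE; apply/seteqP; split=> [_ [_ [c ->] <-]|_ [c ->]].
  exists c; rewrite mulr_sumr; apply: eq_bigr => i _.
  by rewrite -![_ *: _]/(g (c i) * _) mulrCA.
exists (\sum_i g (c i) * e i); first by exists c.
rewrite mulr_sumr; apply: eq_bigr => i _.
by rewrite -![_ *: _]/(g (c i) * _) mulrCA.
Qed.

Lemma mul_span_scale (X U : set K) x :
  mul_span [set x * z | z in X] U = [set x * z | z in mul_span X U].
Proof.
have XU := @lspan_submodule F (fmod g) [set x * u | x in X & u in U].
move: (XU) => [N0 ND NZ].
apply/seteqP; split.
  apply: (@lspan_min F (fmod g)).
    split.
    - by exists 0; rewrite ?mulr0.
    - move=> _ _ [a Xa <-] [b Xb <-]; exists (a + b); first exact: ND.
      by rewrite mulrDr.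
    - move=> r _ [a Xa <-]; exists (g r * a); first exact: (NZ r).
      by rewrite mulrCA.
  move=> _ [_ [z Xz <-] [u Uu <-]]; exists (z * u); last by rewrite mulrA.
  by apply: (@sub_lspan F (fmod g)); exists z => //; exists u.
move=> _ [z Xz <-].
have [M0 MD MZ] := @lspan_submodule F (fmod g)
  [set a * u | a in [set x * z | z in X] & u in U].
apply: (Xz [set z | mul_span [set x * z | z in X] U (x * z)]); split.
  split.
  - by rewrite /= mulr0.
  - by move=> a b /= ? ?; rewrite mulrDr; apply: MD.
  - by move=> r a /= ?; rewrite -[r *: a]/(g r * a) mulrCA; apply: (MZ r).
move=> _ [a Xa [u Uu <-]] /=; rewrite mulrA; apply: (@sub_lspan F (fmod g)).
by exists (x * a); [exists a|exists u].
Qed.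

Definition transc (y : K) : Prop :=
  forall p : {poly F}, (map_poly g p).[y] = 0 -> p = 0.

(** The powers of [y] with exponents 0 to [a] would be [a + 1] independent elements of [X]. *)
Lemma transc_not_fin (X : set K) a y : hd X a -> X 1 ->
  (forall z, X z -> X (z * y)) -> ~ transc y.
Proof.
move=> Xa X1 Xy ty; suff : (a.+1 <= a)%N by rewrite ltnn.
apply/(has_dim_rank _ Xa); exists (fun i : 'I_a.+1 => y ^+ i); split.
  move=> c c0 i.
  have : \poly_(i < a.+1) c (inord i) = 0.
    apply: ty; rewrite -[RHS]c0 poly_def raddf_sum /= horner_sum.
    apply: eq_bigr => j _; rewrite inord_val map_polyZ map_polyXn.
    by rewrite hornerZ hornerXn.
  by move/polyP/(_ i); rewrite coef_poly ltn_ord coef0 inord_val.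
move=> i; elim: (i : nat) => [|n IHn]; first by rewrite expr0.
by rewrite exprSr; apply: Xy.
Qed.

End FieldRank.

(** * Growth of products in a field *)

Section Isoperimetry.
Variables (F K : fieldType) (g : {rmorphism F -> K}).
Local Notation hd X n := (@has_dim F (fmod g) X n).
Local Notation mul_span := (mul_span g).
Local Notation set_sum := (@set_sum F (fmod g)).

Lemma has_dim_gt0P (X : set K) n : hd X n ->
  (0 < n)%N <-> exists2 x, X x & x != 0.
Proof.
move=> [e [e_free ->]]; split=> [n0|[x [c ->]]].
  exists (e (Ordinal n0)); first exact: (@in_span_gen F (fmod g)).
  exact: (@lin_indep_neq0 F (fmod g)).
by case: n e e_free c => // e _ c; rewrite big_ord0 eqxx.
Qed.

Variables (U : set K) (u : nat).
Hypotheses (Uu : hd U u) (U1 : U 1).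

Lemma sub_mul_span (X : set K) : X `<=` mul_span X U.
Proof.
move=> x Xx; apply: (@sub_lspan F (fmod g)).
by exists x => //; exists 1; rewrite ?mulr1.
Qed.

Lemma mul_span_dim (X : set K) a : hd X a ->
  exists d, hd (mul_span X U) (a + d).
Proof.
move=> Xa; have [b Xb] := hd_mul_span Xa Uu.
have [a' Xa' le_ab] := has_dim_sub (has_dim_submodule Xa) (@sub_mul_span X) Xb.
by exists (b - a)%N; rewrite subnKC // (has_dim_uniq Xa Xa').
Qed.

(** The dimension formula is applied to X, Y and to XU, YU; moreover the span of (X cap Y)U lies in
    XU cap YU, and that of (X + Y)U in XU + YU. *)
Lemma boundary_submodular (X Y : set K) a b k l :
  hd X a -> hd Y b -> hd (mul_span X U) (a + k) -> hd (mul_span Y U) (b + l) ->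
  exists c s k' l', [/\ hd (X `&` Y) c, hd (set_sum X Y) s, (c + s = a + b)%N,
    hd (mul_span (X `&` Y) U) (c + k') & hd (mul_span (set_sum X Y) U) (s + l')
    ] /\ (k' + l' <= k + l)%N.
Proof.
move=> Xa Yb Xk Yl; have [c [s [XYc XYs cs]]] := has_dim_sum_cap Xa Yb.
have [k' XYk] := mul_span_dim XYc; have [l' XYl] := mul_span_dim XYs.
exists c, s, k', l'; split=> //.
have [c' [s' [Cc Ss cs']]] := has_dim_sum_cap Xk Yl.
have [c1 XYk1 le1] : exists2 n, hd (mul_span (X `&` Y) U) n & (n <= c')%N.
  apply: has_dim_sub Cc; first exact: has_dim_submodule XYk.
  move=> z Xz; split; move: z Xz; apply: mul_span_sub => z [] //.
have [s1 XYl1 le2] : exists2 n, hd (mul_span (set_sum X Y) U) n & (n <= s')%N.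
  apply: (has_dim_sub _ _ Ss); first exact: has_dim_submodule XYl.
  apply: (@lspan_min F (fmod g)).
    exact: has_dim_submodule Ss.
  move=> _ [_ [x [y [Xx Yy ->]]] [v Uv <-]].
  exists (x * v), (y * v); split; last exact: mulrDl.
    by apply: (@sub_lspan F (fmod g)); exists x => //; exists v.
  by apply: (@sub_lspan F (fmod g)); exists y => //; exists v.
rewrite (has_dim_uniq XYk1 XYk) in le1; rewrite (has_dim_uniq XYl1 XYl) in le2.
have := leq_add le1 le2; rewrite cs' addnACA cs [X in (_ <= X)%N]addnACA.
by rewrite leq_add2l.
Qed.

(* The linear analogue of Hamidoune's isoperimetric method: a subspace of
   least dimension among those minimising the boundary
   [dim XU - dim X], normalised to contain 1, is a field. *)
Lemma isoperimetric (y : K) (X : set K) a b : U y -> transc g y ->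
  hd X a -> (0 < a)%N -> hd (mul_span X U) b -> (u + a.*2 <= b.*2)%N.
Proof.
move=> Uy ty Xa a_gt0 Xb.
pose P k := `[<exists (X : set K) a,
  [/\ hd X a, (0 < a)%N & hd (mul_span X U) (a + k)]>].
have [d Xd] := mul_span_dim Xa.
have exP : exists k, P k by exists d; apply/asboolP; exists X, a.
case: (ex_minnP exP) => k /asboolP Pk kmin.
have {}kmin Z e l : hd Z e -> (0 < e)%N -> hd (mul_span Z U) (e + l) ->
    (k <= l)%N.
  by move=> *; apply: kmin; apply/asboolP; exists Z, e.
rewrite (has_dim_uniq Xb Xd) doubleD addnC leq_add2l.
(* Here [b = a + d] with [d] at least the minimal boundary [k], so only [u <= 2 k] remains. *)
suff uk : (u <= k.*2)%N.
  by apply: leq_trans uk _; rewrite leq_double; exact: kmin Xa a_gt0 Xd.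
pose P2 a := `[<exists X : set K,
  [/\ hd X a, (0 < a)%N & hd (mul_span X U) (a + k)]>].
have exP2 : exists a, P2 a.
  by case: Pk => Z [e ?]; exists e; apply/asboolP; exists Z.
case: (ex_minnP exP2) => h /asboolP[H0 [H0h h_gt0 H0k]] hmin.
have {}hmin Z e : hd Z e -> (0 < e)%N -> hd (mul_span Z U) (e + k) -> (h <= e)%N.
  by move=> *; apply: hmin; apply/asboolP; exists Z.
have [x0 H0x0 x0_neq0] := (has_dim_gt0P H0h).1 h_gt0.
pose H := [set x0^-1 * z | z in H0].
have Hh : hd H h by apply: hd_scale; rewrite ?invr_eq0.
have Hk : hd (mul_span H U) (h + k).
  by rewrite mul_span_scale; apply: hd_scale; rewrite ?invr_eq0.
have H1 : H 1 by exists x0 => //; rewrite mulVf.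
(* [x^-1 H] has the same dimension and boundary as [H] and shares 1 with it. Submodularity makes the
   intersection another minimiser of the boundary, and minimality of [h] makes it all of [H]. Hence
   [H] is closed under division. *)
have HV x : H x -> x != 0 -> [set x^-1 * z | z in H] = H.
  move=> Hx x_neq0; set Y := [set _ | _ in _].
  have Yh : hd Y h by apply: hd_scale; rewrite ?invr_eq0.
  have Yk : hd (mul_span Y U) (h + k).
    by rewrite mul_span_scale; apply: hd_scale; rewrite ?invr_eq0.
  have Y1 : Y 1 by exists x => //; rewrite mulVf.
  have [c [s [k' [l' [[HYc HYs cs HYk HYl] le_kl]]]]] :=
    boundary_submodular Hh Yh Hk Yk.
  have c_gt0 : (0 < c)%N.
    by apply/(has_dim_gt0P HYc); exists 1; rewrite ?oner_neq0.
  have s_gt0 : (0 < s)%N.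
    apply/(has_dim_gt0P HYs); exists 1; rewrite ?oner_neq0 //.
    exists 1, 0; split=> //; last by rewrite addr0.
    by case: (has_dim_submodule Yh).
  have le1 := kmin _ _ _ HYc c_gt0 HYk; have le2 := kmin _ _ _ HYs s_gt0 HYl.
  have k'E : k' = k.
    apply/eqP; rewrite eqn_leq le1 andbT -(leq_add2r l').
    by apply: leq_trans le_kl _; rewrite leq_add2l.
  rewrite k'E in HYk; have le_hc := hmin _ _ HYc c_gt0 HYk.
  have [c' HYc' le_ch] := has_dim_sub (has_dim_submodule HYc)
    (@subIsetl _ H Y) Hh.
  have {le_ch} ch : c = h.
    by apply/eqP; rewrite eqn_leq le_hc andbT (has_dim_uniq HYc HYc').
  rewrite ch in HYc.
  have eqH := @has_dim_sub_eq F (fmod g) _ _ _ (@subIsetl _ H Y) HYc Hh.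
  by rewrite -[RHS]eqH (@has_dim_sub_eq F (fmod g) _ _ _ (@subIsetr _ H Y) HYc Yh).
have HVM x z : H x -> x != 0 -> H z -> H (x^-1 * z).
  by move=> Hx x0n Hz; rewrite -(HV x) //; exists z.
have HM x z : H x -> H z -> H (x * z).
  move=> Hx Hz; have [->|x0n] := eqVneq x 0.
    by rewrite mul0r; case: (has_dim_submodule Hh).
  rewrite -[x]invrK; apply: (HVM); rewrite ?invr_eq0 //.
  by rewrite -[x^-1]mulr1; apply: HVM.
have nHy : ~ H y.
  by move=> Hy; apply: (@transc_not_fin _ _ g H h y) => // z Hz; apply: HM.
have y0 : y != 0.
  by apply/eqP => y0; apply: nHy; rewrite y0; case: (has_dim_submodule Hh).
have Yh := hd_scale y0 Hh.
(* If [H] and [y H] met outside 0, [y] would be a quotient of elements of [H]. So their sum,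
   contained in [H U], has dimension [2 h], whence [h <= k]; and [U] inside [H U] gives
   [u <= h + k <= 2 k]. *)
have [c [s [HYc HYs cs]]] := has_dim_sum_cap Hh Yh.
have c0 : c = 0%N.
  apply/eqP; rewrite -leqn0 leqNgt; apply/negP => /(has_dim_gt0P HYc)[x].
  move=> [Hx [z Hz zx]] x0n; apply: nHy.
  have z0 : z != 0 by apply: contraNneq x0n => z0; rewrite -zx z0 mulr0.
  have -> : y = z^-1 * x by rewrite -zx mulrCA mulVf ?mulr1.
  exact: HVM.
have le_hk : (h <= k)%N.
  rewrite -(leq_add2l h) -cs c0 add0n.
  have [s' HYs' ] : exists2 n, hd (set_sum H [set y * z | z in H]) n
      & (n <= h + k)%N.
    apply: has_dim_sub Hk; first exact: has_dim_submodule HYs.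
    move=> _ [x [_ [Hx [z Hz <-] ->]]].
    have [_ HUD _] := @lspan_submodule F (fmod g) [set x * u | x in H & u in U].
    apply: HUD; first exact: sub_mul_span.
    apply: (@sub_lspan F (fmod g)); exists z => //; exists y => //.
    by rewrite mulrC.
  by rewrite (has_dim_uniq HYs HYs').
have [u' Uu' le_u] : exists2 n, hd U n & (n <= h + k)%N.
  apply: has_dim_sub Hk; first exact: has_dim_submodule Uu.
  move=> v Uv; apply: (@sub_lspan F (fmod g)); exists 1 => //.
  by exists v; rewrite ?mul1r.
rewrite (has_dim_uniq Uu Uu'); apply: leq_trans le_u _.
by rewrite -addnn leq_add2r.
Qed.

End Isoperimetry.

Section PowersTrdegOne.
Variables (F K : fieldType) (g : {rmorphism F -> K}).

(** By [isoperimetric], each further factor from the span of [B] raises the dimension by at least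
    half of that of the span; hence [2 n] factors to reach [n * m]. *)
Lemma rk_prods_transc (B : seq K) (y : K) m n :
  1 \in B -> y \in B -> transc g y -> rk g [set` B] m ->
  rk g (prods [set` B] n.*2) (n * m).
Proof.
move=> B1 By ty Bm.
have [u Uu] := @has_dim_lspan F (fmod g) _ _ (@rank_seq F (fmod g) B).
have le_mu : (m <= u)%N.
  by apply/(has_dim_rank _ Uu); apply: rank_ge_sub Bm; exact: sub_lspan.
set U := lspan _ in Uu.
have U1 : U 1 by exact: (@sub_lspan F (fmod g)).
have Uy : U y by exact: (@sub_lspan F (fmod g)).
have key l : exists2 a, @has_dim F (fmod g)
    (@lspan F (fmod g) (prods [set` B] l)) a & (0 < a)%N && (l * u <= a.*2)%N.
  elim: l => [|l [a Pa /andP[a_gt0 le_a]]].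
    exists 1%N => //; exists (fun=> 1); split.
      by move=> c; rewrite big_ord1 => /eqP; rewrite -[_ *: _]/(g _ * 1) mulr1
        fmorph_eq0 => /eqP c0 i; rewrite ord1.
    rewrite -(@lspan_range F (fmod g)); congr lspan.
    by apply/seteqP; split=> [_ -> |_ [_ _ <-]] //=; exists ord0.
  have [b Pb] := hd_mul_span Pa Uu.
  have := isoperimetric Uu U1 Uy ty Pa a_gt0 Pb.
  have -> : @lspan F (fmod g) (prods [set` B] l.+1) =
      mul_span g (@lspan F (fmod g) (prods [set` B] l)) U.
    by rewrite mul_span_lspan.
  move=> le_b; exists b => //; apply/andP; split.
    by rewrite -double_gt0; apply: leq_trans le_b; rewrite addn_gt0 double_gt0
      a_gt0 orbT.
  by apply: leq_trans le_b; rewrite mulSn leq_add2l.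
apply: (@rank_ge_lspan F (fmod g)).
have [a Pa /andP[_ le_a]] := key n.*2.
apply/(has_dim_rank _ Pa); rewrite -leq_double; apply: leq_trans le_a.
by rewrite -doubleMl leq_double leq_mul2l le_mu orbT.
Qed.

End PowersTrdegOne.

(** * Subfields of K and fields of fractions *)

Section Subfield.
Variables (K : fieldType) (S : set K).
Hypotheses (S1 : S 1) (SB : forall x y, S x -> S y -> S (x - y))
  (SV : forall x y, S x -> S y -> S (x / y)).

Definition subfield_pred : {pred K} := fun x => `[<S x>].

Fact subfield_divring : divring_closed subfield_pred.
Proof.
split; first exact/asboolP.
  by move=> x y /asboolP Sx /asboolP Sy; apply/asboolP; apply: SB.
by move=> x y /asboolP Sx /asboolP Sy; apply/asboolP; apply: SV.
Qed.

HB.instance Definition _ := GRing.isDivringClosed.Build K subfield_pred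
  subfield_divring.

Record subfield := Subfield {subfield_val : K; _ : subfield_val \in subfield_pred}.
HB.instance Definition _ := [isSub for subfield_val].
HB.instance Definition _ := [Choice of subfield by <:].
HB.instance Definition _ := [SubChoice_isSubComUnitRing of subfield by <:].
HB.instance Definition _ := [SubComUnitRing_isSubIntegralDomain of subfield by <:].
HB.instance Definition _ := [SubIntegralDomain_isSubField of subfield by <:].

Lemma subfield_exists :
  exists (F1 : fieldType) (g1 : {rmorphism F1 -> K}), range g1 = S.
Proof.
exists subfield, (val : {rmorphism subfield -> K}).
apply/seteqP; split=> [_ [[x Sx] _ <-]|x Sx]; first exact/asboolP.
by exists (Subfield (introT (asboolP _) Sx)).
Qed.

End Subfield.

Section FractionImage.
Variables (D : comNzRingType) (K : fieldType) (ev : {rmorphism D -> K}).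

(** The range of [g1] is the field of fractions of the range of [ev]. With [ev] the evaluation of
    polynomials at [y], [g1] is the inclusion of F(y) in K. *)
Definition is_frac (F1 : fieldType) (g1 : {rmorphism F1 -> K}) : Prop :=
  (forall p, exists a, g1 a = ev p) /\
  (forall a, exists p q, ev q != 0 /\ g1 a = ev p / ev q).

Lemma frac_exists :
  exists (F1 : fieldType) (g1 : {rmorphism F1 -> K}), is_frac g1.
Proof.
pose S : set K := [set x | exists p q, ev q != 0 /\ x = ev p / ev q].
have [|||F1 [g1 g1S]] := @subfield_exists K S.
- by exists 1, 1; rewrite rmorph1 divr1 oner_neq0.
- move=> _ _ [p [q [q0 ->]]] [p' [q' [q'0 ->]]].
  exists (p * q' - p' * q), (q * q'); rewrite rmorphM mulf_neq0 //; split=> //.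
  by rewrite rmorphB !(rmorphM ev) -[in LHS]mulNr addf_div // mulNr.
- move=> _ _ [p [q [q0 ->]]] [p' [q' [q'0 ->]]].
  have [p'0|p'0] := eqVneq (ev p') 0.
    exists 0, 1; rewrite rmorph1 oner_neq0; split=> //.
    by rewrite p'0 mul0r invr0 mulr0 rmorph0 mul0r.
  exists (p * q'), (q * p'); rewrite !rmorphM mulf_neq0 //; split=> //.
  by rewrite invf_div mulf_div.
exists F1, g1; split=> [p|a].
  have : S (ev p) by exists p, 1; rewrite rmorph1 oner_neq0 divr1.
  by rewrite -g1S => -[a _ E]; exists a.
have : S (g1 a) by rewrite -g1S; exists a.
by move=> [p [q [q0 ->]]]; exists p, q.
Qed.

Lemma common_denominator (F1 : fieldType) (g1 : {rmorphism F1 -> K})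
    (I : finType) (c : I -> F1) : is_frac g1 ->
  exists (q : D) (p : I -> D), ev q != 0 /\
    forall i, g1 (c i) * ev q = ev (p i).
Proof.
move=> [_ /(_ (c _))/cid-/all_sig[p /(_ _)/cid-/all_sig[q pq]]].
exists (\prod_i q i), (fun i => p i * \prod_(j | j != i) q j); split.
  by rewrite rmorph_prod; apply/prodf_neq0 => i _; case: (pq i).
move=> i; rewrite (bigD1 i) //= !rmorphM mulrA.
by case: (pq i) => q0 ->; rewrite divfK.
Qed.

End FractionImage.

Section PolyEval.
Variables (F K : fieldType) (g : {rmorphism F -> K}) (y : K).
Definition pev : {poly F} -> K := horner_eval y \o map_poly g.
HB.instance Definition _ := GRing.RMorphism.on pev.

Lemma pevC a : pev a%:P = g a.
Proof. by rewrite /pev /= map_polyC /horner_eval hornerC. Qed.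

Lemma pev_wide n (p : {poly F}) : (size p <= n)%N ->
  pev p = \sum_(i < n) g p`_i * y ^+ i.
Proof.
move=> le_n; rewrite /pev /= /horner_eval (@horner_coef_wide _ n) ?size_map_poly //.
by apply: eq_bigr => i _; rewrite coef_map.
Qed.

End PolyEval.

(** * Algebraic independence through monomials *)

Section Monomials.
Variables (F K : fieldType) (g : {rmorphism F -> K}).

Definition mon d (y : 'I_d -> K) (m : {ffun 'I_d -> nat}) : K :=
  \prod_i y i ^+ m i.

(** Algebraic independence stated for finite families of distinct exponents, which makes it easy to
    split off one variable; [alg_indep_mono_free] and its converse link it to multivariate
    polynomials. *)
Definition mono_free d (y : 'I_d -> K) : Prop :=
  forall (I : finType) (m : I -> {ffun 'I_d -> nat}), injective m ->
  forall c : I -> F, \sum_i g (c i) * mon y (m i) = 0 -> forall i, c i = 0.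

Lemma mono_free_transc d (y : 'I_d -> K) i : mono_free y -> transc g (y i).
Proof.
move=> yf p p0.
pose m (a : 'I_(size p)) : {ffun 'I_d -> nat} := [ffun j => if j == i then a : nat else 0%N].
have m_inj : injective m.
  by move=> a b /ffunP/(_ i); rewrite !ffunE eqxx => /val_inj.
have := yf _ _ m_inj (fun a => p`_a) _.
move=> pa; apply/polyP => a; rewrite coef0.
have [lt_a|le_a] := ltnP a (size p); last by rewrite nth_default.
apply: (pa _ (Ordinal lt_a)); rewrite -[RHS]p0 horner_coef.
rewrite size_map_poly; apply: eq_bigr => b _; rewrite coef_map; congr (_ * _).
rewrite /mon (bigD1 i) //= ffunE eqxx big1 ?mulr1 // => j /negPf ji.
by rewrite ffunE ji expr0.
Qed.

Definition minsert d (h : 'I_d.+1) (a : nat) (m : {ffun 'I_d -> nat}) :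
    {ffun 'I_d.+1 -> nat} :=
  [ffun i => oapp m a (unlift h i)].

Lemma mon_insert d (y : 'I_d.+1 -> K) h a m :
  mon y (minsert h a m) = y h ^+ a * mon (y \o lift h) m.
Proof.
rewrite /mon (bigD1_ord h) //= ffunE unlift_none; congr (_ * _).
by apply: eq_bigr => i _; rewrite ffunE liftK.
Qed.

Lemma minsert_inj d (h : 'I_d.+1) a m a' m' :
  minsert h a m = minsert h a' m' -> a = a' /\ m = m'.
Proof.
move=> E; split.
  by move/ffunP/(_ h): E; rewrite !ffunE unlift_none.
by apply/ffunP => i; move/ffunP/(_ (lift h i)): E; rewrite !ffunE liftK.
Qed.

(** The other variables stay free over F(y h): once denominators are cleared and the coefficients
    expanded in powers of [y h], a relation involves distinct monomials over F. *)
Lemma mono_free_lift d (y : 'I_d.+1 -> K) h : mono_free y ->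
  forall (F1 : fieldType) (g1 : {rmorphism F1 -> K}),
  is_frac (pev g (y h)) g1 ->
  forall (I : finType) (m : I -> {ffun 'I_d -> nat}), injective m ->
  forall c : I -> F1, \sum_i g1 (c i) * mon (y \o lift h) (m i) = 0 ->
  forall i, c i = 0.
Proof.
move=> yf F1 g1 g1P I m m_inj c c0.
have [q [p [q0 pq]]] := common_denominator c g1P.
pose N := \max_i size (p i).
have sp i : (size (p i) <= N)%N by rewrite /N (bigD1 i) //= leq_maxl.
pose m' (ia : I * 'I_N) := minsert h ia.2 (m ia.1).
have m'_inj : injective m'.
  move=> [i a] [j b] /minsert_inj /= [/val_inj -> /m_inj ->] //.
have p0 := yf _ _ m'_inj (fun ia => (p ia.1)`_ia.2) _.
move=> i; apply: (fmorph_inj g1); apply: (mulIf q0); rewrite rmorph0 mul0r pq.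
suff -> : p i = 0 by rewrite rmorph0.
apply/polyP => a; rewrite coef0.
have [lt_a|le_a] := ltnP a N; last by rewrite nth_default // (leq_trans (sp i)).
apply: (p0 _ (i, Ordinal lt_a)) => {i a lt_a}.
rewrite -(pair_bigA _ (fun i (a : 'I_N) => g (p i)`_a * mon y (m' (i, a)))) /=.
transitivity (pev g (y h) q *
  \sum_i g1 (c i) * mon (y \o lift h) (m i)); last by rewrite c0 mulr0.
rewrite mulr_sumr; apply: eq_bigr => i _.
rewrite mulrA [_ * g1 _]mulrC pq /= (pev_wide _ _ (sp i)).
rewrite mulr_suml; apply: eq_bigr => a _.
by rewrite mon_insert mulrA.
Qed.

End Monomials.

(** * Comparing ranks over F(y_0) and over F(y_1) *)

Section TwoVariables.
Variables (F K : fieldType) (g : {rmorphism F -> K}).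
Local Notation submod X := (@is_submodule F (fmod g) X).

(** Independence over F[y], which by clearing denominators is independence over F(y); see
    [rk_frac]. *)
Definition poly_free (y : K) n (u : 'I_n -> K) : Prop :=
  forall h : 'I_n -> {poly F}, \sum_r pev g y (h r) * u r = 0 ->
  forall r, h r = 0.

Lemma coefM_top (R : nzRingType) (p q : {poly R}) n a :
  (size p <= n.+1)%N -> (size q <= a.+1)%N -> (p * q)`_(n + a) = p`_n * q`_a.
Proof.
move=> sp sq; rewrite coefM.
have lt_n : (n < (n + a).+1)%N by rewrite ltnS leq_addr.
rewrite (bigD1 (Ordinal lt_n)) //= addKn big1 ?addr0 // => i ni.
have [lt_in|] := ltnP i n.
  rewrite [q`_ _]nth_default ?mulr0 //; apply: leq_trans sq _.
  by rewrite -addnBAC ?(ltnW lt_in) // -{1}[a]add0n ltn_add2r subn_gt0.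
rewrite leq_eqVlt => /predU1P[E|lt_ni].
  by case/eqP: ni; apply: val_inj.
by rewrite nth_default ?mul0r //; apply: leq_trans sp _.
Qed.

(** In degree [n + a] of the outer variable only the degree [n] coefficients of the [h r] meet the
    degree [a] coefficients of the [P r i]. A relation thus yields one over F between the top
    coefficients, and the degree of the [h r] goes down. *)
Lemma poly_free_top M t a (P : 'I_M -> 'I_t -> {poly {poly F}}) :
  (forall r i, size (P r i) <= a.+1)%N ->
  lin_indep (fun r => [ffun i => (P r i)`_a] : {ffun 'I_t -> {poly F}}) ->
  forall h : 'I_M -> {poly F},
  (forall i, \sum_r map_poly polyC (h r) * P r i = 0) -> forall r, h r = 0.
Proof.
move=> sP w_free h hP.
suff key n : (forall r, size (h r) <= n)%N -> forall r, h r = 0.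
  by apply: (key (\max_r size (h r))) => r; rewrite (bigD1 r) //= leq_maxl.
elim: n => [|n IHn] sh r; first by apply/eqP; rewrite -size_poly_leq0.
apply: IHn => {}r; apply/leq_sizeP => j; rewrite leq_eqVlt => /predU1P[<-|lt_nj].
  move: r; apply: w_free; apply/ffunP => i; rewrite sum_ffunE ffunE.
  transitivity ((\sum_r map_poly polyC (h r) * P r i)`_(n + a)); last first.
    by rewrite hP coef0.
  rewrite coef_sum; apply: eq_bigr => r _.
  by rewrite coefM_top ?size_map_polyC // coef_map !ffunE mul_polyC.
by rewrite nth_default // (leq_trans (sh r)).
Qed.

Variables (y0 y1 : K).
(** The inner variable goes to [y0] and the outer one to [y1]; degrees below are in the outer
    variable. *)
Definition ev2 : {poly {poly F}} -> K := horner_eval y1 \o map_poly (pev g y0).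
HB.instance Definition _ := GRing.RMorphism.on ev2.

Lemma ev2C p : ev2 p%:P = pev g y0 p.
Proof. by rewrite /ev2 /= map_polyC /horner_eval hornerC. Qed.

Lemma ev2_map p : ev2 (map_poly polyC p) = pev g y1 p.
Proof.
rewrite /ev2 /= -map_poly_comp [RHS]/pev /=; congr (_ .[_]).
by apply: eq_map_poly => a; rewrite /= pevC.
Qed.

Hypothesis ev2_inj : forall P, ev2 P = 0 -> P = 0.

Variables (F01 : fieldType) (g01 : {rmorphism F01 -> K}).
Hypothesis g01P : is_frac ev2 g01.
Variables (t : nat) (E : 'I_t -> K) (Q : {poly {poly F}}).
Hypotheses (E_free : @lin_indep F01 (fmod g01) _ E) (Q0 : ev2 Q != 0).
Variables (S : set K) (M : nat).
Hypotheses (SS : submod S)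
  (no1 : forall u : 'I_M -> K, (forall r, S (u r)) -> ~ poly_free y1 u).

Lemma ev2_free (W : 'I_t -> {poly {poly F}}) :
  \sum_i ev2 (W i) * E i = 0 -> forall i, W i = 0.
Proof.
move=> W0 i; apply: ev2_inj.
have [c cW] : exists c : 'I_t -> F01, forall i, g01 (c i) = ev2 (W i).
  by have /(_ (W _))/cid-/all_sig[c cW] := g01P.1; exists c.
rewrite -cW; suff -> : c i = 0 by rewrite rmorph0.
by move: i; apply: E_free; rewrite -[RHS]W0; apply: eq_bigr => i _; rewrite -cW.
Qed.

Definition coords (v : K) (W : 'I_t -> {poly {poly F}}) : Prop :=
  ev2 Q * v = \sum_i ev2 (W i) * E i.

Lemma coords_sum n (v : 'I_n -> K) (W : 'I_n -> 'I_t -> {poly {poly F}})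
    (c : 'I_n -> {poly {poly F}}) :
  (forall r, coords (v r) (W r)) ->
  coords (\sum_r ev2 (c r) * v r) (fun i => \sum_r c r * W r i).
Proof.
move=> vW; rewrite /coords mulr_sumr.
under [RHS]eq_bigr do rewrite rmorph_sum mulr_suml.
rewrite exchange_big /=; apply: eq_bigr => r _.
rewrite mulrCA vW mulr_sumr; apply: eq_bigr => i _.
by rewrite rmorphM mulrA.
Qed.

Lemma coords_scale_sum n (v : 'I_n -> K) (W : 'I_n -> 'I_t -> {poly {poly F}})
    (c : 'I_n -> F) :
  (forall r, coords (v r) (W r)) ->
  coords (\sum_r g (c r) * v r) (fun i => \sum_r (c r)%:P%:P * W r i).
Proof.
move=> /(coords_sum (fun r => (c r)%:P%:P)); congr coords.
by apply: eq_bigr => r _; rewrite ev2C pevC.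
Qed.

Lemma coords0 v (W : 'I_t -> {poly {poly F}}) :
  coords v W -> (forall i, W i = 0) -> v = 0.
Proof.
move=> vW W0; apply: (mulfI Q0); rewrite vW mulr0 big1 // => i _.
by rewrite W0 rmorph0 mul0r.
Qed.

Lemma coords_eq0 v (W : 'I_t -> {poly {poly F}}) :
  coords v W -> v = 0 -> forall i, W i = 0.
Proof. by move=> vW v0; apply: ev2_free; rewrite -vW v0 mulr0. Qed.

(** The span of the [e m] is filtered by degree in [y1]. The top coefficients in one degree span
    fewer than [M] dimensions over F, since [M] independent ones would make [M] elements of [S] free
    over F[y_1], against [no1]. So each degree accounts for at most [M - 1] dimensions; [L] lists
    the degrees that occur. *)
Lemma degree_count a D (e : 'I_D -> K) (P : 'I_D -> 'I_t -> {poly {poly F}}) :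
  @lin_indep F (fmod g) _ e -> (forall m, S (e m)) ->
  (forall m, coords (e m) (P m)) -> (forall m i, size (P m i) <= a)%N ->
  exists L : seq nat, [/\ uniq L, all (fun s => s < a)%N L,
    (D <= M.-1 * size L)%N & forall s, s \in L -> exists v W,
      [/\ S v, coords v W, (forall i, size (W i) <= s.+1)%N
        & exists i, (W i)`_s != 0]].
Proof.
elim: a D e P => [|a IHa] D e P e_free Se eP sP.
  exists [::]; split=> //; rewrite muln0 leqn0; case: D => // D in e P e_free Se eP sP *.
  have /eqP[] := @lin_indep_neq0 F (fmod g) _ e ord0 e_free.
  apply: (coords0 (eP ord0)) => i; apply/eqP; rewrite -size_poly_leq0.
  exact: sP.
pose c m : {ffun 'I_t -> {poly F}} := [ffun i => (P m i)`_a].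
have [c0|] := pselect (forall m, c m = 0).
  have [|L [uL La DL LP]] := IHa D e P e_free Se eP.
    move=> m i; apply/leq_sizeP => j; rewrite leq_eqVlt => /predU1P[<-|lt_aj].
      by have /ffunP/(_ i) := c0 m; rewrite !ffunE.
    by rewrite nth_default // (leq_trans (sP m i)).
  exists L; split=> //; apply: sub_all La => s; exact: leqW.
move=> /existsNP[m0 cm0].
have : ~ rank_ge [set w | in_span c w] M.
  move=> [w [w_free /in_spanP[N Nw]]].
  pose u r := \sum_m g (N r m) * e m.
  pose P' r i := \sum_m (N r m)%:P%:P * P m i.
  have Su r : S (u r) by apply: (@submodule_sum F (fmod g)).
  apply: (no1 Su) => h hu.
  have P'E r i : (P' r i)`_a = w r i.
    rewrite coef_sum Nw sum_ffunE; apply: eq_bigr => m _.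
    by rewrite coefCM !ffunE mul_polyC.
  apply: (@poly_free_top M t a P').
  - move=> r i; apply: (leq_trans (size_sum _ _ _)); apply/bigmax_leqP => m _.
    rewrite mul_polyC; exact: leq_trans (size_scale_leq _ _) (sP m i).
  - move=> d d0; apply: w_free; rewrite -[RHS]d0; apply: eq_bigr => r _.
    by congr (_ *: _); apply/ffunP => i; rewrite ffunE P'E.
  - have uP' r : coords (u r) (P' r) by apply: coords_scale_sum.
    apply: (coords_eq0 (coords_sum (fun r => map_poly polyC (h r)) uP')).
    by rewrite -[RHS]hu; apply: eq_bigr => r _; rewrite ev2_map.
(* The induction continues with combinations whose coefficients of degree [a] cancel; at most
   [M - 1] dimensions are lost. *)
move=> /kernel_family[p [N [lt_D N_free N0]]].
pose e' r := \sum_m g (N r m) * e m.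
pose P' r i := \sum_m (N r m)%:P%:P * P m i.
have [||||L [uL La DL LP]] := IHa p e' P'.
- move=> d d0 r.
  have dN0 : (\row_r d r) *m N = 0.
    apply/rowP => m; rewrite [RHS]mxE; move: m; apply: e_free.
    rewrite -(@sum_scale_mulmx F (fmod g)) -[RHS]d0; apply: eq_bigr => q _.
    by rewrite mxE.
  have := row_free_inj N_free; move/(_ _ (\row_r d r) 0); rewrite mul0mx.
  by move=> /(_ dN0)/rowP/(_ r); rewrite !mxE.
- by move=> r; apply: (@submodule_sum F (fmod g)).
- by move=> r; apply: coords_scale_sum.
- move=> r i; apply/leq_sizeP => j; rewrite leq_eqVlt => /predU1P[<-|lt_aj].
    have /ffunP/(_ i) := N0 r; rewrite sum_ffunE !ffunE => N0i.
    rewrite coef_sum -[RHS]N0i; apply: eq_bigr => m _.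
    by rewrite coefCM !ffunE mul_polyC.
  rewrite coef_sum big1 // => m _.
  by rewrite coefCM [_`_j]nth_default ?mulr0 // (leq_trans (sP m i)).
exists (a :: L); split.
- by rewrite /= uL andbT; apply/negP => /(allP La); rewrite ltnn.
- by rewrite /= ltnSn /=; apply: sub_all La => s; exact: leqW.
- rewrite /= mulnS; case: M lt_D DL => [|M'] lt_D DL.
    by rewrite addn0 in lt_D; rewrite mul0n in DL *; apply: leq_trans DL; exact: ltnW.
  rewrite addnS ltnS addnC in lt_D; apply: leq_trans lt_D _.
  by rewrite leq_add2l.
- move=> s; rewrite inE => /predU1P[->|]; last exact: LP.
  exists (e m0), (P m0); split=> //; apply: contrapT => no.
  apply: cm0; apply/ffunP => i; rewrite !ffunE; apply/eqP; apply: contrapT.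
  by move=> /negP ni; apply: no; exists i.
Qed.

(** Among the [v r] with [h r] nonzero, the one of highest degree in [y1] has a top coefficient that
    nothing cancels, because the [h r] are polynomials in [y0] alone. *)
Lemma distinct_degrees_free n (v : 'I_n -> K) (s : 'I_n -> nat)
    (W : 'I_n -> 'I_t -> {poly {poly F}}) :
  injective s -> (forall r, coords (v r) (W r)) ->
  (forall r i, size (W r i) <= (s r).+1)%N ->
  (forall r, exists i, (W r i)`_(s r) != 0) -> poly_free y0 v.
Proof.
move=> s_inj vW sW W0 h hv r; apply/eqP; apply: contrapT => /negP hr.
case: (@Order.TotalTheory.arg_maxP _ _ _ r (fun r => h r != 0) s hr) => q hq qmax.
have [i Wqi] := W0 q.
have : (\sum_r (h r)%:P * W r i)`_(s q) = 0.
  rewrite (coords_eq0 (coords_sum (fun r => (h r)%:P) vW)) ?coef0 //.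
  by rewrite -[RHS]hv; apply: eq_bigr => l _; rewrite ev2C.
rewrite coef_sum (bigD1 q) //= coefCM big1 => [|l nlq].
  by rewrite addr0 => /eqP; rewrite mulf_eq0 (negPf hq) (negPf Wqi).
rewrite coefCM; have [->|hl] := eqVneq (h l) 0; first by rewrite mul0r.
rewrite [_`_(s q)]nth_default ?mulr0 //; apply: leq_trans (sW l i) _.
rewrite ltn_neqAle (inj_eq s_inj) nlq /=; exact: qmax.
Qed.

End TwoVariables.

Section RankExtension.
Variables (F K : fieldType) (g : {rmorphism F -> K}).

Lemma rk_frac (y : K) (F1 : fieldType) (g1 : {rmorphism F1 -> K}) (B : set K)
    M (u : 'I_M -> K) :
  is_frac (pev g y) g1 -> (forall r, @lspan F (fmod g) B (u r)) ->
  poly_free g y u -> rk g1 B M.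
Proof.
move=> g1P Bu u_free; apply: (@rank_ge_lspan F1 (fmod g1)); exists u; split.
  move=> c c0; have [q [p [q0 pq]]] := common_denominator c g1P.
  have p0 := u_free p _; move=> i.
  apply: (fmorph_inj g1); apply: (mulIf q0); rewrite rmorph0 mul0r pq.
  rewrite p0 ?rmorph0 //.
  transitivity (\sum_r (g1 (c r) * u r) * pev g y q).
    by apply: eq_bigr => r _; rewrite /= mulrAC pq.
  by rewrite -mulr_suml [X in X * _]c0 mul0r.
move=> r; apply: (Bu r); split; last exact: (@sub_lspan F1 (fmod g1)).
have [N0 ND NZ] := @lspan_submodule F1 (fmod g1) B.
split=> // a v Bv; have [b ba] := g1P.1 a%:P.
by rewrite -[a *: v]/(g a * v) -(pevC g y) -ba; apply: (NZ b).
Qed.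

(* Expand elements of the span of B in a basis over F(y0, y1), with
   denominators cleared. Those of equal degree in y1 with independent leading
   coefficients are free over F(y1); those of distinct degrees are free over
   F(y0). *)
Lemma rk_two_var (y0 y1 : K) (B : seq K) M
    (F0 F1 : fieldType) (g0 : {rmorphism F0 -> K}) (g1 : {rmorphism F1 -> K}) :
  (forall P, ev2 g y0 y1 P = 0 -> P = 0) ->
  is_frac (pev g y0) g0 -> is_frac (pev g y1) g1 ->
  (0 < M)%N -> rk g [set` B] (M ^ 2) ->
  rk g0 [set` B] M \/ rk g1 [set` B] M.
Proof.
move=> ev2_inj g0P g1P M0 [e [e_free Be]].
apply: contrapT => /not_orP[no0 no1].
have [F01 [g01 g01P]] :=
  @frac_exists {poly {poly F}} K (ev2 g y0 y1).
have [t [E [_ E_free BE EE]]] := rank_basis (@rank_seq F01 (fmod g01) B).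
have /(_ _)/cid-/all_sig[c ce] : forall m, exists c : 'I_t -> F01,
    e m = \sum_i g01 (c i) * E i.
  move=> m; have : @lspan F01 (fmod g01) [set` B] (e m).
    exact: (@sub_lspan F01 (fmod g01)).
  by rewrite EE => -[c ->]; exists c.
have [Q [P [Q0 QP]]] := common_denominator (fun mi => c mi.1 mi.2) g01P.
pose S := @lspan F (fmod g) [set` B].
have no1' (u : 'I_M -> K) : (forall r, S (u r)) -> ~ poly_free g y1 u.
  by move=> Su u_free; apply: no1; exact: rk_frac g1P Su u_free.
have [|m||L [uL La DL LP]] := degree_count ev2_inj g01P E_free Q0
  (lspan_submodule _) no1' e_free _ _
  (a := \max_mi size (P mi)) (P := fun m i => P (m, i)).
- by move=> m; apply: (@sub_lspan F (fmod g)); exact: Be.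
- rewrite /coords ce mulr_sumr; apply: eq_bigr => i _.
  by rewrite mulrCA mulrA [_ * ev2 _ _ _ _](QP (m, i)).
- by move=> m i; rewrite (bigD1 (m, i)) //= leq_maxl.
(* [M] different degrees would give rank [M] over F(y_0); with fewer, [degree_count] leaves room for
   at most [(M - 1) ^ 2] independent elements instead of [M ^ 2]. *)
have lt_LM : (size L < M)%N.
  rewrite ltnNge; apply/negP => le_ML; apply: no0.
  have sL (i : 'I_M) : L`_i \in L by apply: mem_nth; apply: leq_trans le_ML.
  have /all_sig[v /(_ _)/cid-/all_sig[W vW]] :=
    fun i : 'I_M => cid (LP _ (sL i)).
  apply: (rk_frac g0P (u := v)); first by move=> r; case: (vW r).
  apply: (distinct_degrees_free ev2_inj g01P (Q := Q) E_free (s := fun i => L`_i)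
    (W := W)).
  - move=> i j /eqP; rewrite nth_uniq ?(leq_trans _ le_ML) //.
    by move/eqP => ij; apply: ord_inj.
  - by move=> r; case: (vW r).
  - by move=> r; case: (vW r).
  - by move=> r; case: (vW r).
have : (M ^ 2 <= M.-1 * M.-1)%N.
  by apply: leq_trans DL _; rewrite leq_mul2l -ltnS prednK // lt_LM orbT.
rewrite leqNgt -mulnn; case/negP.
by have ltM : (M.-1 < M)%N by [rewrite prednK]; rewrite ltn_mul.
Qed.

(** A relation over F between the products [e l * y ^+ a], collected by [l], is a relation over F(y)
    between the [e l] with coefficients in F[y]; transcendence of [y] finishes. *)
Lemma rk_mul_powers (y : K) (F1 : fieldType) (g1 : {rmorphism F1 -> K})
    (S : set K) q n :
  transc g y -> is_frac (pev g y) g1 -> rk g1 S q ->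
  rk g [set x * y ^+ a | x in S & a in [set a | (a < n)%N]] (n * q).
Proof.
move=> ty g1P [e [e_free Se]].
have := @rk_fin F K g
  [set x * y ^+ a | x in S & a in [set a | (a < n)%N]] ('I_n * 'I_q)%type
  (fun al => e al.2 * y ^+ al.1).
rewrite card_prod !card_ord; apply; last first.
  by move=> [a l] /=; exists (e l) => //; exists a.
move=> c c0.
pose p l := \poly_(a < n) oapp (fun a => c (a, l)) 0 (insub a).
have [b bp] : exists b : 'I_q -> F1, forall l, g1 (b l) = pev g y (p l).
  by have /(_ (p _))/cid-/all_sig[b bp] := g1P.1; exists b.
have b0 : forall l, b l = 0.
  apply: e_free; rewrite -[RHS]c0.
  rewrite [RHS](eq_bigr (fun al => (fun a l => g (c (a, l)) * (e l * y ^+ a))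
    al.1 al.2)); last by case.
  rewrite -(pair_bigA _ (fun a l => g (c (a, l)) * (e l * y ^+ a))) /=.
  rewrite exchange_big /=; apply: eq_bigr => l _.
  rewrite -[_ *: _]/(g1 (b l) * e l) bp (@pev_wide _ _ _ _ n) ?size_poly //.
  rewrite mulr_suml; apply: eq_bigr => a _.
  by rewrite coef_poly ltn_ord valK /= mulrAC mulrA.
move=> [a l]; have : p l = 0 by apply: ty; rewrite -[LHS]/(pev g y (p l)) -bp b0 rmorph0.
by move/polyP/(_ a); rewrite coef_poly ltn_ord valK coef0.
Qed.

End RankExtension.

Lemma ev2_mono_free (F K : fieldType) (g : {rmorphism F -> K}) d
    (y : 'I_d.+2 -> K) :
  mono_free g y ->
  forall P, ev2 g (y ord0) (y (lift ord0 ord0)) P = 0 -> P = 0.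
Proof.
move=> yf P P0; have [F0 [g0 g0P]] := frac_exists (pev g (y ord0)).
have ty1 := mono_free_transc (i := ord0) (mono_free_lift yf g0P).
have ty0 := mono_free_transc (i := ord0) yf.
have /(_ _)/cid-/all_sig[b bP] := g0P.1.
have : \poly_(i < size P) b P`_i = 0.
  apply: ty1; rewrite -[RHS]P0 /ev2 /= /horner_eval; congr (_ .[_]).
  apply/polyP => i; rewrite !coef_map /= coef_poly.
  have [lt_i|le_i] := ltnP i (size P); first exact: bP.
  by rewrite rmorph0 nth_default // rmorph0.
move=> b0; apply/polyP => i; rewrite coef0.
have [lt_i|le_i] := ltnP i (size P); last by rewrite nth_default.
move/polyP/(_ i): b0; rewrite coef_poly lt_i coef0 => b0; apply: ty0.
by rewrite -[LHS]/(pev g (y ord0) P`_i) -[RHS](rmorph0 g0) -b0; exact/esym/bP.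
Qed.

(** [rk_two_var] keeps the square root of the rank over F(y h) for one of two variables. The
    induction hypothesis is applied over F(y h) to the other variables, and powers of [y h] below
    [n] multiply the rank by [n] at the price of [n] more factors. *)
Theorem rk_prods d (F K : fieldType) (g : {rmorphism F -> K}) (y : 'I_d -> K)
    (B : seq K) m n :
  mono_free g y -> 1 \in B -> (forall i, y i \in B) -> (0 < m)%N -> (0 < n)%N ->
  rk g [set` B] (m ^ (2 ^ d)) ->
  rk g (prods [set` B] (d.+1 * n)) (n ^ d * m).
Proof.
elim: d F g y => [|d IHd] F g y yf B1 By m0 n0 Bm.
  rewrite !mul1n; move: Bm; rewrite expn0 expn1; apply: rank_ge_sub => x Bx.
  by apply: (@prods_le _ _ 1) => //; exists 1 => //; exists x; rewrite ?mul1r.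
(* The inductive step chooses between two variables, so one variable is a base case; it takes [2 n]
   factors, whence [d + 1] rather than [d] in the statement. *)
case: d => [|d] in IHd y yf By Bm *.
  rewrite mul2n expn1; apply: (@rk_prods_transc _ _ _ _ (y ord0)) => //.
    exact: mono_free_transc.
  by apply: rank_ge_le Bm; rewrite -{1}(expn1 m) leq_pexp2l.
have step h (F1 : fieldType) (g1 : {rmorphism F1 -> K}) :
    is_frac (pev g (y h)) g1 -> rk g1 [set` B] (m ^ 2 ^ d.+1) ->
    rk g (prods [set` B] (d.+3 * n)) (n ^ d.+2 * m).
  move=> g1P B1m; have /(_ F1 g1 (y \o lift h)) IH := IHd.
  have {}IH : rk g1 (prods [set` B] (d.+2 * n)) (n ^ d.+1 * m).
    by apply: IH => //; [exact: mono_free_lift g1P|move=> i; exact: By].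
  have := rk_mul_powers n (mono_free_transc (i := h) yf) g1P IH.
  rewrite [(n ^ d.+2)%N]expnS -mulnA; apply: (@rank_ge_sub F (fmod g)) => _ [x Bx [a lt_an <-]].
  rewrite mulSn addnC; apply: prodsD => //.
  by apply: (prods_le (m := a)) => //; [exact: ltnW|exact/prodsX/By].
have [F0 [g0 g0P]] := frac_exists (pev g (y ord0)).
have [F1 [g1 g1P]] := frac_exists (pev g (y (lift ord0 ord0))).
have M0 : (0 < m ^ 2 ^ d.+1)%N by rewrite expn_gt0 m0.
rewrite [(2 ^ d.+2)%N]expnS [(2 * _)%N]mulnC expnM in Bm.
have [] := rk_two_var (ev2_mono_free yf) g0P g1P M0 Bm; first exact: step g0P.
exact: step g1P.
Qed.

Section AlgIndep.
Variables (k K : fieldType) (g : {rmorphism k -> K}).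

Lemma alg_indep_mono_free d (y : 'I_d -> K) : alg_indep g y -> mono_free g y.
Proof.
move=> yi I m m_inj c c0.
pose mk (f : {ffun 'I_d -> nat}) : mpoly.multinom d :=
  mpoly.Multinom [tuple f i | i < d].
have mkE f i : mpoly.fun_of_multinom (mk f) i = f i by exact: mpoly.mnmE.
have mk_inj : injective mk.
  by move=> f f' ff'; apply/ffunP => i; rewrite -!mkE ff'.
pose p : mpoly.mpoly d k := \sum_i c i *: mpoly.mpolyX k (mk (m i)).
have p0 : p = 0.
  apply: yi; rewrite -[RHS]c0 raddf_sum /=; apply: eq_bigr => i _.
  rewrite mpoly.mmapZ mpoly.mmapX; congr (_ * _); apply: eq_bigr => l _.
  by rewrite mkE.
move=> i; have : mpoly.mcoeff (mk (m i)) p = 0 by rewrite p0 mpoly.mcoeff0.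
rewrite raddf_sum /= (bigD1 i) //= mpoly.mcoeffZ mpoly.mcoeffX eqxx mulr1.
rewrite big1 ?addr0 // => l li; rewrite mpoly.mcoeffZ mpoly.mcoeffX.
by rewrite (inj_eq mk_inj) (inj_eq m_inj) (negPf li) mulr0.
Qed.

Lemma mono_free_alg_indep d (y : 'I_d -> K) : mono_free g y -> alg_indep g y.
Proof.
move=> yf p p0; pose s := mpoly.msupp p; pose m0 : mpoly.multinom d := mpoly.mnm0.
pose m (i : 'I_(size s)) := [ffun l => mpoly.fun_of_multinom (nth m0 s i) l].
have m_inj : injective m.
  move=> i j /ffunP ij; apply/val_inj/eqP.
  rewrite -(nth_uniq m0 (ltn_ord i) (ltn_ord j) (mpoly.msupp_uniq p)); apply/eqP.
  apply: (mpoly.mnmP _ _).2 => l.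
  by have := ij l; rewrite !ffunE.
have c0 := yf _ _ m_inj (fun i => mpoly.mcoeff (nth m0 s i) p) _.
apply/mpoly.mpolyP => n; rewrite mpoly.mcoeff0.
have [ns|ns] := boolP (n \in s); last exact: mpoly.memN_msupp_eq0.
have lt_n : (index n s < size s)%N by rewrite index_mem.
rewrite -[n](nth_index m0 ns); apply: (c0 _ (Ordinal lt_n)).
rewrite -[RHS]p0 /mpoly.mmap (big_nth m0) big_mkord; apply: eq_bigr => i _.
by congr (_ * _); apply: eq_bigr => l _; rewrite ffunE.
Qed.

End AlgIndep.

(* The bound gives the growth exponent at least d + 1 + 1/E along the sequence
   (d+3) m^E. *)
Lemma growth_exponent (R : realType) (f : nat -> nat) d E : (0 < E)%N ->
  (forall m, (0 < m)%N -> (m ^ E * ((m ^ E) ^ d * m) <= f (d.+3 * m ^ E))%N) ->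
  ~ (limn_esup (fun n => (ln ((f n)%:R : R) / ln n%:R)%:E) <=
     (d%:R + 1)%:E)%E.
Proof.
move=> E0 fE le_d.
(* Halfway between the allowed exponent [d + 1] and the exponent [d + 1 + 1/E] reached along the
   sequence. *)
pose y : R := d%:R + 1 + 2^-1 / E%:R.
have E0' : 0 < (E%:R : R) by rewrite ltr0n.
have lt_y : (limn_esup (fun n => (ln ((f n)%:R : R) / ln n%:R)%:E) < y%:E)%E.
  apply: le_lt_trans le_d _; rewrite lte_fin ltrDl divr_gt0 //.
move: lt_y; rewrite /limn_esup /limf_esup => /ereal_inf_lt[_ [V [N _ NV] <-]].
move=> /ltW sup_le.
have fy n : (N <= n)%N -> (ln ((f n)%:R : R) / ln n%:R) <= y.
  move=> Nn; rewrite -lee_fin; apply: le_trans sup_le; apply: ereal_sup_ubound.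
  by exists n => //; apply: NV.
pose C : R := ln d.+3%:R.
(* With L = ln m, the two bounds compare [((d + 1) E + 1) L] with [y C + ((d + 1) E + 1/2) L], so
   they force [L <= 2 y C]; [m] is taken too large for that. *)
pose B := 2 * y * C.
pose m := maxn N (Num.bound (expR B)).+2.
have m1 : (1 < m)%N by rewrite leq_max orbT.
have m0 : (0 < m)%N by exact: ltnW.
have lt_Bm : B < ln (m%:R : R).
  rewrite -[B]expRK ltr_ln ?posrE ?expR_gt0 ?ltr0n //.
  apply: lt_le_trans (archi_boundP (expR_ge0 _)) _.
  by rewrite ler_nat leq_max; apply/orP; right; apply/ltnW/ltnW.
have mE0 : (0 < m ^ E)%N by rewrite expn_gt0 m0.
pose n := (d.+3 * m ^ E)%N.
have le_Nn : (N <= n)%N.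
  apply: (@leq_trans m); first exact: leq_maxl.
  apply: (@leq_trans (m ^ E)); last exact: leq_pmull.
  by rewrite -{1}(expn1 m) leq_pexp2l.
have lnn : ln (n%:R : R) = C + E%:R * ln m%:R.
  rewrite natrM lnM ?posrE ?ltr0n // natrX lnXn ?ltr0n //.
  by rewrite mulr_natl.
have lnn0 : 0 < ln (n%:R : R).
  rewrite ln_gt0 // ltr1n; apply: leq_trans (leq_pmulr _ mE0); exact: isT.
have := fy n le_Nn; rewrite ler_pdivrMr // => le1.
have le2 : ln ((m ^ E * ((m ^ E) ^ d * m))%:R : R) <= ln (f n)%:R.
  rewrite ler_ln ?posrE ?ltr0n ?ler_nat; first exact: fE.
    by rewrite !muln_gt0 !expn_gt0 m0.
  by apply: leq_trans (fE _ m0); rewrite !muln_gt0 !expn_gt0 m0.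
have := le_trans le2 le1; rewrite lnn.
have -> : (m ^ E * ((m ^ E) ^ d * m) = m ^ (E * d.+1 + 1))%N.
  by rewrite expnD expn1 expnM expnS mulnA.
rewrite natrX lnXn ?ltr0n // -[ln _ *+ _]mulr_natl natrD natrM -[d.+1]addn1 natrD.
set L := ln m%:R in lt_Bm *; move=> le3.
suff : L <= B by rewrite leNgt lt_Bm.
have yE : y * E%:R = (d%:R + 1) * E%:R + 2^-1.
  by rewrite /y mulrDl divfK ?gt_eqF.
have le4 : y * (C + E%:R * L) = y * C + ((d%:R + 1) * E%:R + 2^-1) * L.
  by rewrite -yE mulrDr mulrA.
rewrite le4 in le3; rewrite /B; lra.
Qed.

(** * Polynomials in a linear endomorphism *)

Section PolynomialAction.
Variables (F : fieldType) (V : lmodType F) (f : {linear V -> V}).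
Implicit Types (p q : {poly F}) (v w : V).

Definition pact p v : V := \sum_(i < size p) p`_i *: iter i f v.

Lemma pact_wide n p v : (size p <= n)%N ->
  pact p v = \sum_(i < n) p`_i *: iter i f v.
Proof.
move=> le_n; rewrite /pact (big_ord_widen_cond _ xpredT (fun i => p`_i *: iter i f v) le_n).
rewrite [RHS](bigID (fun i : 'I_n => (i < size p)%N)) /= [X in _ = _ + X]big1 ?addr0 //.
by move=> i; rewrite -leqNgt => le_i; rewrite nth_default // scale0r.
Qed.

Lemma pactD p q v : pact (p + q) v = pact p v + pact q v.
Proof.
pose n := maxn (size p) (size q).
rewrite !(@pact_wide n) ?leq_maxl ?leq_maxr ?size_polyD //.
by rewrite -big_split; apply: eq_bigr => i _; rewrite coefD scalerDl.
Qed.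

Lemma pactZ c p v : pact (c *: p) v = c *: pact p v.
Proof.
rewrite (@pact_wide (size p)) ?size_scale_leq // scaler_sumr.
by apply: eq_bigr => i _; rewrite coefZ scalerA.
Qed.

Lemma pact0 v : pact 0 v = 0.
Proof. by rewrite /pact size_poly0 big_ord0. Qed.

Lemma pactC c v : pact c%:P v = c *: v.
Proof. by rewrite (@pact_wide 1) ?size_polyC_leq1 // big_ord1 coefC. Qed.

Lemma pactMX p v : pact (p * 'X) v = pact p (f v).
Proof.
rewrite (@pact_wide (size p).+1); last first.
  by apply: leq_trans (size_polyMleq _ _) _; rewrite size_polyX addn2.
rewrite big_ord_recl coefMX scale0r add0r; apply: eq_bigr => i _.
by rewrite coefMX /= -iterSr.
Qed.

Lemma pact_is_linear p : linear (pact p).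
Proof.
have iterP n : linear (iter n f) by elim: n => // n IHn a u v /=; rewrite IHn linearP.
move=> a u v; rewrite /pact scaler_sumr -big_split; apply: eq_bigr => i _ /=.
by rewrite iterP scalerDr !scalerA mulrC.
Qed.
HB.instance Definition _ p :=
  GRing.isLinear.Build F V V *:%R (pact p) (pact_is_linear p).

Lemma pact_comm p v : pact p (f v) = f (pact p v).
Proof.
by rewrite /pact linear_sum; apply: eq_bigr => i _; rewrite -iterSr linearZ.
Qed.

Lemma pactM p q v : pact (p * q) v = pact p (pact q v).
Proof.
elim/poly_ind: p v => [|p c IHp] v; first by rewrite mul0r !pact0.
rewrite mulrDl mulrAC mul_polyC !pactD pactZ !pactMX IHp pactC.
by rewrite pact_comm.
Qed.

Lemma pactXsubC c v : pact ('X - c%:P) v = f v - c *: v.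
Proof.
by rewrite -['X]mul1r -polyCN pactD pactMX !pactC scale1r scaleNr.
Qed.

Lemma pactXsubC_exp n c v : pact (('X - c%:P) ^+ n) v =
  iter n (fun w => f w - c *: w) v.
Proof.
elim: n v => [|n IHn] v; first by rewrite expr0 pactC scale1r.
by rewrite exprS pactM IHn pactXsubC.
Qed.

Definition gen_eigen c v : Prop := exists n, pact (('X - c%:P) ^+ n) v = 0.

Lemma gen_eigen_le m n c v : (m <= n)%N ->
  pact (('X - c%:P) ^+ m) v = 0 -> pact (('X - c%:P) ^+ n) v = 0.
Proof. by move=> le_mn v0; rewrite -(subnK le_mn) exprD pactM v0 linear0. Qed.

Lemma pact_coprime p q v : coprimep p q -> pact p v = 0 -> pact q v = 0 -> v = 0.
Proof.
move=> /Bezout_coprimepP[[u w] /= /eqp_size]; rewrite size_poly1.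
move=> /eqP/size_poly1P[c c0 uw] p0 q0; apply: (scalerI c0).
by rewrite -pactC -uw pactD !pactM p0 q0 !linear0 addr0.
Qed.

(** The part of the sum with eigenvalue [mu] is killed by a power of [X - mu] and, being minus the
    rest, by a product of powers of the other [X - lam i]; these are coprime. *)
Lemma gen_eigen_independent (I : finType) (v : I -> V) (lam : I -> F) :
  (forall i, gen_eigen (lam i) (v i)) -> \sum_i v i = 0 ->
  forall mu, \sum_(i | lam i == mu) v i = 0.
Proof.
move=> /(_ _)/cid-/all_sig[n nP] v0 mu.
pose N := \max_i n i.
have NP i : pact (('X - (lam i)%:P) ^+ N) (v i) = 0.
  by apply: gen_eigen_le (nP i); rewrite /N (bigD1 i) //= leq_maxl.
apply: (@pact_coprime (('X - mu%:P) ^+ N)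
  (\prod_(i | lam i != mu) ('X - (lam i)%:P) ^+ N)).
- apply: (big_ind (fun q => coprimep _ q)) => [|p q ? ?|i ne].
  + exact: coprimep1.
  + by rewrite coprimepMr; apply/andP.
  + by apply/coprimep_expl/coprimep_expr; rewrite coprimep_XsubC root_XsubC.
- by rewrite linear_sum big1 // => i /eqP <-; exact: NP.
- set P := \prod_(_ | _) _.
  have : pact P (\sum_i v i) = 0 by rewrite v0 linear0.
  rewrite (bigID (fun i => lam i == mu)) /= linearD /= [X in _ + X]linear_sum.
  rewrite [X in _ + X]big1 ?addr0 // => i ne.
  by rewrite /P (bigD1 i) //= mulrC pactM NP linear0.
Qed.

End PolynomialAction.

Section PolynomialActionClosed.
Variables (F : closedFieldType) (V : lmodType F) (f : {linear V -> V}).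

(** Linear factors are stripped from [p] until the quotient no longer kills [v]. The eigenvector is
    a polynomial in [f] applied to [v], so it stays in every [f]-stable subspace containing [v]. *)
Lemma pact_eigenvector (p : {poly F}) (v : V) :
  p != 0 -> pact f p v = 0 -> v != 0 ->
  exists q c, pact f q v != 0 /\ f (pact f q v) = c *: pact f q v.
Proof.
have [n] := ubnP (size p); elim: n p => // n IHn p lt_n p0 pv v0.
have [/eqP sp|sp] := boolP (size p == 1%N).
  have /size_poly1P[c c0 pE] : size p == 1%N by rewrite sp.
  by move/eqP: pv; rewrite pE pactC scaler_eq0 (negPf c0) (negPf v0).
have /closed_rootP[c /factor_theorem[q pE]] := sp.
have q0 : q != 0 by apply: contraNneq p0 => q0; rewrite pE q0 mul0r.
have [qv|qv] := eqVneq (pact f q v) 0.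
  apply: (IHn q) => //; move: lt_n; rewrite pE size_Mmonic ?monicXsubC //.
  by rewrite size_XsubC addn2 ltnS.
exists q, c; split=> //; apply/eqP; rewrite -subr_eq0 -pactXsubC -pactM mulrC.
by rewrite -pE pv.
Qed.

(** Primary decomposition: for a root [c] of multiplicity [m], Bezout splits [v] into a part killed
    by [(X - c)^m] and one killed by the cofactor [q]. *)
Lemma pact_split (p : {poly F}) (v : V) : p != 0 -> pact f p v = 0 ->
  exists s : seq V, v = \sum_(w <- s) w /\
    forall w, w \in s -> exists c, gen_eigen f c w.
Proof.
have [n] := ubnP (size p); elim: n p v => // n IHn p v lt_n p0 pv.
have [/eqP sp|sp] := boolP (size p == 1%N).
  have /size_poly1P[c c0 pE] : size p == 1%N by rewrite sp.
  exists [::]; split=> //; rewrite big_nil; apply/eqP.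
  by move/eqP: pv; rewrite pE pactC scaler_eq0 (negPf c0).
have /closed_rootP[c rc] := sp.
have [m [q qc pE]] := multiplicity_XsubC p c.
rewrite p0 /= in qc.
have m0 : (0 < m)%N.
  by case: m pE => // pE; rewrite pE mulr1 (negPf qc) in rc.
have q0 : q != 0 by apply: contraNneq p0 => q0; rewrite pE q0 mul0r.
have /Bezout_coprimepP[[u w] /= /eqp_size] : coprimep (('X - c%:P) ^+ m) q.
  by apply: coprimep_expl; rewrite coprimep_sym coprimep_XsubC.
rewrite size_poly1 => /eqP/size_poly1P[b b0 uw].
have vE : v = b^-1 *: pact f (u * ('X - c%:P) ^+ m) v + b^-1 *: pact f (w * q) v.
  by rewrite -scalerDr -pactD uw pactC scalerA mulVf // scale1r.
have [|||s [sE sP]] := IHn q (b^-1 *: pact f (u * ('X - c%:P) ^+ m) v) => //.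
- move: lt_n; rewrite pE size_Mmonic ?monic_exp ?monicXsubC // size_exp_XsubC.
  rewrite addnS /= -(prednK m0) addnS ltnS; apply: leq_trans.
  by rewrite ltnS leq_addr.
- by rewrite linearZ /= -pactM mulrC -mulrA [_ ^+ m * q]mulrC -pE pactM pv linear0 scaler0.
exists (b^-1 *: pact f (w * q) v :: s); split.
  by rewrite big_cons -sE addrC.
move=> x; rewrite inE => /predU1P[->|/sP //]; exists c, m.
by rewrite linearZ /= -pactM mulrCA [_ ^+ m * q]mulrC -pE pactM pv linear0 scaler0.
Qed.

End PolynomialActionClosed.

(** * The extended centroid of a primitive ring *)

Section PrimitiveCentroid.
Variables (k : closedFieldType) (A : nzRingType) (g : {rmorphism k -> A}).
Variable (M : lmodType A).
Hypotheses (g_central : forall c a, g c * a = a * g c)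
  (M_simple : simple_module M) (M_faithful : faithful_module M).
Variables (I : set A) (phi : A -> A) (b0 : A).
Hypotheses (I_ideal : is_ideal I) (Ib0 : I b0) (b0_neq0 : b0 != 0)
  (phiMl : forall a b, I b -> phi (a * b) = a * phi b)
  (phiMr : forall a b, I b -> phi (b * a) = phi b * a).

Lemma ideal_annihilator (m : M) : (forall b, I b -> b *: m = 0) -> m = 0.
Proof.
move=> Im; have [_ IMr] := I_ideal.
have NN : is_submodule [set m : M | forall b, I b -> b *: m = 0].
  split=> [b _|x y Ix Iy b Ib|r x Ix b Ib] /=; first by rewrite scaler0.
    by rewrite scalerDr Ix // Iy // addr0.
  by rewrite scalerA Ix //; exact: IMr.
have [N0|NT] := M_simple.2 _ NN.
  by have : [set m : M | forall b, I b -> b *: m = 0] m by []; rewrite N0.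
have /eqP[] := b0_neq0; apply: M_faithful => x.
by have : [set: M] x by []; rewrite -NT; apply.
Qed.

(* As [M = I M], multiplication by the extended centroid element [phi]
   makes sense on M: it sends [b m] to [phi b m]. *)
Lemma centroid_action : exists f : M -> M,
  (forall a u v, f (a *: u + v) = a *: f u + f v) /\
  forall b m, I b -> b *: f m = phi b *: m.
Proof.
have [[_ _ IMl] IMr] := I_ideal.
pose N : set M := [set m | exists m', forall b, I b -> b *: m' = phi b *: m].
have NN : is_submodule N.
  split=> [|x y [x' xP] [y' yP]|r x [x' xP]].
  - by exists 0 => b _; rewrite !scaler0.
  - by exists (x' + y') => b Ib; rewrite !scalerDr xP // yP.
  - exists (r *: x') => b Ib; rewrite !scalerA -phiMr // xP //; exact: IMr.
have NT : N = setT.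
  have [N0|//] := M_simple.2 _ NN.
  (* [b0 M] is nonzero and lies in [N]: [phi b0 *: x] serves as image of [b0 *: x], since
     [b * phi b0 = phi (b * b0) = phi b * b0]. *)
  have /eqP[] := b0_neq0; apply: M_faithful => x.
  suff : N (b0 *: x) by rewrite N0.
  by exists (phi b0 *: x) => b Ib; rewrite !scalerA -phiMl // phiMr.
have /(_ _)/cid-/all_sig[f fP] : forall m, N m by rewrite NT.
exists f; split=> [a u v|b m Ib]; last exact: fP.
apply/eqP; rewrite -subr_eq0; apply/eqP/ideal_annihilator => b Ib.
rewrite scalerBr (fP _ b) // !scalerDr !scalerA -phiMr // -(fP u); last exact: IMr.
by rewrite -(fP v) // subrr.
Qed.

Variable (W : nat -> A).
Hypotheses (A_span : forall a, exists N (c : 'I_N -> k), a = \sum_l g (c l) * W l)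
  (k_uncountable : ~ countable [set: k]).

(* Otherwise all [f - c] are invertible on M, and the uncountably many
   vectors [(f - c)^-1 m0] are linearly dependent. *)
Lemma primitive_centroid_scalar : exists c, forall b, I b -> phi b = g c * b.
Proof.
have [f [f_lin fP]] := centroid_action.
pose fc c m := f m - g c *: m.
have fc_lin c a u v : fc c (a *: u + v) = a *: fc c u + fc c v.
  rewrite /fc f_lin scalerDr scalerA g_central -scalerA scalerBr.
  by rewrite opprD addrACA.
apply: contrapT => no.
have fc0 c : fc c 0 = 0.
  have := fc_lin c 1 0 0; rewrite !scale1r addr0 => E.
  by apply: (addrI (fc c 0)); rewrite -E addr0.
(* Schur's argument: the kernel of [f - c] is a submodule, and it is not M, for then [phi] would be
   multiplication by [c] on [I]. *)
have fc_inj c m : fc c m = 0 -> m = 0.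
  move=> cm; apply: contrapT => m0.
  have NN : is_submodule [set x | fc c x = 0].
    split=> [|x y /= cx cy|r x /= cx]; first exact: fc0.
      by rewrite -[x]scale1r fc_lin cx cy scaler0 addr0.
    by rewrite -[r *: x]addr0 fc_lin cx fc0 scaler0 addr0.
  have [N0|NT] := M_simple.2 _ NN.
    by have : [set x | fc c x = 0] m by []; rewrite N0.
  apply: no; exists c => b Ib; apply/eqP; rewrite -subr_eq0; apply/eqP/M_faithful => x.
  have : [set: M] x by []; rewrite -NT /= => /eqP; rewrite subr_eq0 => /eqP cx.
  by rewrite scalerBl -fP // cx scalerA g_central subrr.
have [[m0 m0_neq0] _] := M_simple.
have fc_sur c x : exists y, fc c y = x.
  have NN : is_submodule (range (fc c)).
    split=> [|_ _ [u _ <-] [v _ <-]|r _ [u _ <-]]; first by exists 0.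
      by exists (u + v); rewrite // -[u]scale1r fc_lin !scale1r.
    by exists (r *: u); rewrite // -[r *: u]addr0 fc_lin fc0 addr0.
  have [N0|NT] := M_simple.2 _ NN; last first.
    by have : [set: M] x by []; rewrite -NT => -[y _ <-]; exists y.
  have : range (fc c) (fc c m0) by exists m0.
  by rewrite N0 => /fc_inj /eqP; rewrite (negPf m0_neq0).
have /(_ _)/cid-/all_sig[u uP] := fun c => fc_sur c m0.
have m0_gen m : exists a, m = a *: m0.
  have NN : is_submodule [set a *: m0 | a in setT].
    split=> [|_ _ [a _ <-] [b _ <-]|r _ [a _ <-]].
    - by exists 0; rewrite ?scale0r.
    - by exists (a + b); rewrite ?scalerDl.
    - by exists (r * a); rewrite ?scalerA.
  have [N0|NT] := M_simple.2 _ NN; last first.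
    by have : [set: M] m by []; rewrite -NT => -[a _ <-]; exists a.
  have : [set a *: m0 | a in setT] m0 by exists 1; rewrite ?scale1r.
  by rewrite N0 => /eqP; rewrite (negPf m0_neq0).
pose Mk := restr g M.
have f_klin : linear (f : Mk -> Mk).
  by move=> a x y; rewrite -[a *: x]/(g a *: (x : M)) f_lin.
pose F : {linear Mk -> Mk} :=
  HB.pack (f : Mk -> Mk) (GRing.isLinear.Build k Mk Mk *:%R f f_klin).
have M_span m : exists N, @in_span k Mk N (fun l => W l *: m0) m.
  have [a ->] := m0_gen m; have [N [c ->]] := A_span a; exists N, c.
  by rewrite scaler_suml; apply: eq_bigr => l _; rewrite -scalerA.
have /(_ _)/cid-/all_sig[n nP] := fun c => M_span (u c).
(* Pigeonhole: [u c] lies in the span of the first [n c] vectors [W l *: m0]. As k is uncountable,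
   some [N] occurs for infinitely many [c], and [N + 1] of these vectors are dependent. *)
have [N Ninf] : exists N, infinite_set [set c | n c = N].
  apply: contrapT => /forallNP fin; apply: k_uncountable.
  have -> : [set: k] = \bigcup_(N in setT) [set c | n c = N].
    by apply/seteqP; split=> // c _; exists (n c).
  apply: bigcup_countable => // N _; apply: finite_set_countable.
  exact: contrapT (fin N).
have [B BN cardB] := infinite_set_fset N.+1 Ninf.
pose cs (l : 'I_N.+1) := nth 0 (finmap.enum_fset B) l.
have csB l : cs l \in finmap.enum_fset B by apply: mem_nth; exact: leq_trans cardB.
have cs_inj : injective cs.
  move=> l l' /eqP; rewrite nth_uniq ?finmap.fset_uniq ?(leq_trans _ cardB) //.
  by move/eqP/val_inj.
have : ~ @lin_indep k Mk _ (u \o cs).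
  move=> u_free; suff : (N.+1 <= N)%N by rewrite ltnn.
  apply: (@steinitz k Mk _ N _ (fun l => W l *: m0) u_free) => l.
  by have := nP (cs l); rewrite (BN (cs l) (csB l)).
move=> /existsNP[a /not_implyP[a0 /existsNP[l0 /eqP al0]]].
(* Clearing denominators in [sum_l a l (f - cs l)^-1 m0 = 0] gives [q(f) m0 = 0]. At [cs l0] only
   one summand of [q] survives, so [q] is nonzero and [f] has an eigenvector, against injectivity of
   every [f - c]. *)
pose P l := \prod_(l' | l' != l) ('X - (cs l')%:P).
pose q := \sum_l a l *: P l.
have FX c x : pact F ('X - c%:P) x = fc c x by rewrite pactXsubC.
have q0 : q != 0.
  apply/eqP => /(congr1 (horner^~ (cs l0))); rewrite horner0 horner_sum (bigD1 l0) //=.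
  rewrite big1 => [|l ll0]; last first.
    rewrite hornerZ horner_prod (bigD1 l0) 1?eq_sym //=.
    by rewrite hornerXsubC subrr mul0r mulr0.
  rewrite addr0 hornerZ => /eqP; rewrite mulf_eq0 (negPf al0) horner_prod /=.
  apply/negP/prodf_neq0 => l ll0; rewrite hornerXsubC subr_eq0.
  by rewrite (inj_eq cs_inj) eq_sym.
have qm0 : pact F q (m0 : Mk) = 0.
  pose R := \prod_l ('X - (cs l)%:P).
  transitivity (pact F R (\sum_l a l *: (u (cs l) : Mk))); last by rewrite a0 linear0.
  rewrite linear_sum /q /=.
  transitivity (\sum_l pact F (a l *: P l) (m0 : Mk)).
    apply: (big_morph (fun p => pact F p (m0 : Mk))) => [p p'|]; first exact: pactD.
    exact: pact0.
  apply: eq_bigr => l _; rewrite pactZ linearZ /=; congr (_ *: _).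
  by rewrite /R (bigD1 l) //= mulrC pactM FX uP.
have [q' [c [v0 vE]]] := pact_eigenvector q0 qm0 m0_neq0.
case/eqP: v0; apply: (fc_inj c); rewrite /fc.
by apply/eqP; rewrite subr_eq0; apply/eqP.
Qed.

End PrimitiveCentroid.

(** Words in the generators are coded by natural numbers, a number that codes no word being sent to
    0; the span of the words is a subalgebra by concatenation. *)
Lemma countable_spanning (k : fieldType) (A : algType k) : fin_gen_algebra A ->
  exists W : nat -> A, forall a, exists N (c : 'I_N -> k), a = \sum_l c l *: W l.
Proof.
move=> [X XA]; pose word (s : seq 'I_(size X)) := \prod_(l <- s) X`_l.
pose W n := oapp word 0 (choice.unpickle n).
have WE s : W (choice.pickle s) = word s by rewrite /W choice.pickleK.
have WP n : W n = 0 \/ exists s, W n = word s.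
  by rewrite /W; case: choice.unpickle => [s|]; [right; exists s|left].
exists W => a.
suff [N [c ->]] : exists N (c : nat -> k), a = \sum_(l < N) c l *: W l.
  by exists N, (c : 'I_N -> k).
have SS : lspan (range W) a.
  have : generated_algebra (GRing.in_alg A) [set` X] a by rewrite XA.
  apply; have [S0 SD SZ] := lspan_submodule (range W).
  split; last first.
    move=> x /(nthP 0)[l lt_l <-]; apply: sub_lspan.
    exists (choice.pickle [:: Ordinal lt_l]) => //.
    by rewrite WE /word big_seq1.
  split=> [c|x y|x y Sx Sy]; [|exact: SD|].
    apply: SZ; apply: sub_lspan; exists (choice.pickle ([::] : seq 'I_(size X))) => //.
    by rewrite WE /word big_nil.
  apply: (Sx [set x | lspan (range W) (x * y)]); split.
    split=> [|u v Su Sv|r u Su] /=; first by rewrite mul0r.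
      by rewrite mulrDl; exact: SD.
    by rewrite -scalerAl; exact: SZ.
  move=> _ [m _ <-] /=; apply: (Sy [set y | lspan (range W) (W m * y)]); split.
    split=> [|u v Su Sv|r u Su] /=; first by rewrite mulr0.
      by rewrite mulrDr; exact: SD.
    by rewrite -scalerAr; exact: SZ.
  move=> _ [n _ <-] /=.
  have [->|[s ->]] := WP m; first by rewrite mul0r.
  have [->|[s' ->]] := WP n; first by rewrite mulr0.
  apply: sub_lspan; exists (choice.pickle (s ++ s')) => //.
  by rewrite WE /word big_cat.
apply: (SS [set b | exists N (c : nat -> k), b = \sum_(l < N) c l *: W l]); split; last first.
  move=> _ [m _ <-]; exists m.+1, (fun l => (l == m)%:R).
  rewrite big_ord_recr /= eqxx scale1r big1 ?add0r // => l _.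
  by rewrite ltn_eqF ?scale0r.
have widen N N' (c : nat -> k) : (N <= N')%N -> \sum_(l < N) c l *: W l =
    \sum_(l < N') (if (l < N)%N then c l else 0) *: W l.
  move=> le_N; rewrite (big_ord_widen _ (fun l => c l *: W l) le_N) big_mkcond.
  by apply: eq_bigr => l _; case: ifP; rewrite ?scale0r.
split=> [|_ _ [N [c ->]] [N' [c' ->]]|r _ [N [c ->]]].
- by exists 0%N, (fun=> 0); rewrite big_ord0.
- rewrite (widen _ (maxn N N')) ?leq_maxl // (widen N' (maxn N N')) ?leq_maxr //.
  exists (maxn N N'), (fun l => (if (l < N)%N then c l else 0) +
    (if (l < N')%N then c' l else 0)).
  by rewrite -big_split; apply: eq_bigr => l _; rewrite scalerDl.
- exists N, (fun l => r * c l); rewrite scaler_sumr.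
  by apply: eq_bigr => l _; rewrite scalerA.
Qed.

(** This makes the opposite ring an algebra over k, so that right primitivity is handled as left
    primitivity. *)
Lemma converse_in_alg (k : fieldType) (A : algType k) :
  exists g : {rmorphism k -> A^c}, forall c, g c = c%:A.
Proof.
pose f (c : k) : A^c := (c%:A : A).
have f_add : zmod_morphism f by move=> x y; rewrite /f scalerBl.
have f_mul : monoid_morphism f.
  split=> [|x y]; first by rewrite /f scale1r.
  by rewrite -[RHS]/((y%:A : A) * x%:A) mulr_algl scalerA mulrC.
pose g : {rmorphism k -> A^c} := HB.pack f
  (GRing.isZmodMorphism.Build k A^c f f_add)
  (GRing.isMonoidMorphism.Build k A^c f f_mul).
by exists g.
Qed.

(** * Generalized eigenspaces of a field automorphism *)

Section GeneratedSets.
Variables (k K : fieldType) (iota : {rmorphism k -> K}).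

Lemma generated_algebra_subalgebra (S : set K) :
  is_subalgebra iota (generated_algebra iota S).
Proof.
split=> [c|x y Sx Sy|x y Sx Sy] M [MM SM]; case: (MM) => Mc MD MM'; first exact: Mc.
  by apply: MD; [apply: Sx|apply: Sy].
by apply: MM'; [apply: Sx|apply: Sy].
Qed.

Lemma generated_field_intermediate (S : set K) :
  is_intermediate_field iota (generated_field iota S).
Proof.
split=> [|x Sx M [MM SM]]; last by case: (MM) => _; apply; apply: Sx.
split=> [c|x y Sx Sy|x y Sx Sy] M [MM SM]; case: (MM) => -[Mc MD MM'] _; first exact: Mc.
  by apply: MD; [apply: Sx|apply: Sy].
by apply: MM'; [apply: Sx|apply: Sy].
Qed.

Lemma sub_generated_algebra (S : set K) : S `<=` generated_algebra iota S.
Proof. by move=> x Sx M [_]; exact. Qed.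

Lemma sub_generated_field (S : set K) : S `<=` generated_field iota S.
Proof. by move=> x Sx M [_]; exact. Qed.

Lemma generated_algebra_min (S M : set K) : is_subalgebra iota M -> S `<=` M ->
  generated_algebra iota S `<=` M.
Proof. by move=> MM SM x; apply; split. Qed.

Lemma generated_field_min (S M : set K) : is_intermediate_field iota M ->
  S `<=` M -> generated_field iota S `<=` M.
Proof. by move=> MM SM x; apply; split. Qed.

Lemma subalgebra0 (M : set K) : is_subalgebra iota M -> M 0.
Proof. by move=> [Mc _ _]; rewrite -(rmorph0 iota). Qed.

Lemma subalgebra1 (M : set K) : is_subalgebra iota M -> M 1.
Proof. by move=> [Mc _ _]; rewrite -(rmorph1 iota). Qed.

Lemma subalgebra_prod (M : set K) (I : Type) (r : seq I) (P : pred I) (x : I -> K) :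
  is_subalgebra iota M -> (forall l, P l -> M (x l)) -> M (\prod_(l <- r | P l) x l).
Proof.
move=> MM Mx; apply: (big_ind M) => //; first exact: subalgebra1.
by case: MM.
Qed.

Lemma subalgebra_sum (M : set K) (I : Type) (r : seq I) (P : pred I) (x : I -> K) :
  is_subalgebra iota M -> (forall l, P l -> M (x l)) -> M (\sum_(l <- r | P l) x l).
Proof.
move=> MM Mx; apply: (big_ind M) => //; first exact: subalgebra0.
by case: MM.
Qed.

Lemma subalgebra_exprz (M : set K) x (n : int) : is_subalgebra iota M ->
  M x -> M x^-1 -> M (x ^ n).
Proof.
move=> MM Mx MV; have MX y m : M y -> M (y ^+ m).
  move=> My; rewrite -[m]card_ord -prodr_const.
  exact: subalgebra_prod.
by case: n => n; [exact: MX|rewrite NegzE -exprnN -exprVn; exact: MX].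
Qed.

End GeneratedSets.

Section GeneralizedEigenspaces.
Variables (k K : fieldType) (iota : {rmorphism k -> K}) (sigma : {rmorphism K -> K}).
Hypothesis sigma_k : forall c, sigma (iota c) = iota c.
Local Notation GE := (generalized_eigenspace iota sigma).
Local Notation T := (sum_generalized_eigenspaces iota sigma).

Lemma sigma_linear_exists :
  exists f : {linear fmod iota -> fmod iota}, (f : K -> K) = sigma.
Proof.
have f_lin : linear (sigma : fmod iota -> fmod iota).
  move=> a x y; rewrite rmorphD; congr (_ + _).
  by rewrite -[a *: x]/(iota a * x) rmorphM sigma_k.
pose f : {linear fmod iota -> fmod iota} :=
  HB.pack (sigma : fmod iota -> fmod iota)
    (GRing.isLinear.Build k (fmod iota) (fmod iota) *:%R sigma f_lin).
by exists f.
Qed.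

Lemma gen_eigen_GE (f : {linear fmod iota -> fmod iota}) lam a :
  (f : K -> K) = sigma -> gen_eigen f lam a <-> GE lam a.
Proof.
move=> fE; split=> -[n an]; exists n; move: an; rewrite pactXsubC_exp -fE //.
Qed.

Lemma GE_independent (I : finType) (v : I -> K) (lam : I -> k) :
  (forall l, GE (lam l) (v l)) -> \sum_l v l = 0 ->
  forall mu, \sum_(l | lam l == mu) v l = 0.
Proof.
have [f fE] := sigma_linear_exists => vGE.
apply: (@gen_eigen_independent k (fmod iota) f I v lam) => l.
exact/(gen_eigen_GE _ _ fE).
Qed.

Local Notation del lam := (fun b => sigma b - iota lam * b).

Lemma iter_delD lam n a b : iter n (del lam) (a + b) =
  iter n (del lam) a + iter n (del lam) b.
Proof.
elim: n a b => // n IHn a b.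
by rewrite !iterSr -IHn rmorphD mulrDr opprD addrACA.
Qed.

Lemma iter_delZ lam n c a : iter n (del lam) (iota c * a) = iota c * iter n (del lam) a.
Proof.
elim: n a => // n IHn a.
by rewrite !iterSr -IHn rmorphM sigma_k mulrBr mulrCA.
Qed.

Lemma iter_del0 lam n : iter n (del lam) 0 = 0.
Proof. by elim: n => // n IHn; rewrite iterSr rmorph0 mulr0 subrr. Qed.

Lemma iter_del_sigma lam n a : iter n (del lam) (sigma a) = sigma (iter n (del lam) a).
Proof.
by elim: n a => // n IHn a; rewrite !iterSr -IHn rmorphB rmorphM sigma_k.
Qed.

Lemma GE_sigma lam a : GE lam a -> GE lam (sigma a).
Proof. by move=> [n an]; exists n; rewrite iter_del_sigma an rmorph0. Qed.

Lemma GE_D lam a b : GE lam a -> GE lam b -> GE lam (a + b).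
Proof.
move=> [n an] [m bm]; exists (n + m)%N; rewrite iter_delD [in X in X + _]addnC !iterD.
by rewrite an bm !iter_del0 addr0.
Qed.

Lemma GE_Z lam c a : GE lam a -> GE lam (iota c * a).
Proof. by move=> [n an]; exists n; rewrite iter_delZ an mulr0. Qed.

(** Twisted Leibniz rule: [(sigma - lam mu)(a b)] is [(sigma - lam) a] times [sigma b], plus [lam a]
    times [(sigma - mu) b]. Both terms have smaller total nilpotency order. *)
Lemma GE_M lam mu a b : GE lam a -> GE mu b -> GE (lam * mu) (a * b).
Proof.
move=> [n an] [m bm]; exists (n + m)%N.
have [s sE] : exists s, s = (n + m)%N by exists (n + m)%N.
rewrite -sE; elim: s n m a b an bm sE => [|s IHs] [|n] [|m] a b an bm // sE;
  rewrite ?(an : a = 0) ?(bm : b = 0) ?mul0r ?mulr0 ?iter_del0 //.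
rewrite iterSr.
have -> : sigma (a * b) - iota (lam * mu) * (a * b) =
    (sigma a - iota lam * a) * sigma b + iota lam * (a * (sigma b - iota mu * b)).
  by rewrite !rmorphM; ring.
rewrite iter_delD iter_delZ (IHs n m.+1) ?add0r; last 3 first.
- by rewrite -iterSr.
- by rewrite iter_del_sigma bm rmorph0.
- by case: sE.
rewrite (IHs n.+1 m) ?mulr0 //; first by rewrite -iterSr.
by case: sE; rewrite addnS.
Qed.

Lemma eigen_GE lam a : sigma a = iota lam * a -> GE lam a.
Proof. by move=> E; exists 1%N; rewrite /= E subrr. Qed.

Lemma iota_GE c : GE 1 (iota c).
Proof. by apply: eigen_GE; rewrite sigma_k rmorph1 mul1r. Qed.

(** The last nonzero iterate of [sigma - lam] on [a] is an eigenvector. *)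
Lemma GE_eigenvector lam a : GE lam a -> a != 0 ->
  exists2 w, w != 0 & sigma w = iota lam * w.
Proof.
move=> [n]; elim: n a => [|n IHn] a; first by move=> /= -> /eqP.
rewrite iterSr => an a0; have [/eqP|] := eqVneq (sigma a - iota lam * a) 0.
  by rewrite subr_eq0 => /eqP E; exists a.
exact: IHn an.
Qed.

Lemma eigenvalue_neq0 lam a : a != 0 -> sigma a = iota lam * a -> lam != 0.
Proof.
move=> a0 E; apply: contraNneq a0 => l0; move/eqP: E.
by rewrite l0 rmorph0 mul0r fmorph_eq0.
Qed.

Lemma eigenV lam a : sigma a = iota lam * a -> sigma a^-1 = iota lam^-1 * a^-1.
Proof. by move=> E; rewrite !fmorphV E invfM. Qed.

Lemma sub_GE_T lam : GE lam `<=` T.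
Proof.
move=> a aGE; exists [:: a]; rewrite big_seq1; split=> // b.
by rewrite inE => /eqP ->; exists lam.
Qed.

Lemma T_subalgebra : is_subalgebra iota T.
Proof.
split=> [c|_ _ [s [-> sP]] [s' [-> sP']]|_ _ [s [-> sP]] [s' [-> sP']]].
- exact: (sub_GE_T (iota_GE c)).
- exists (s ++ s'); rewrite big_cat; split=> // b; rewrite mem_cat.
  by case/orP; [exact: sP|exact: sP'].
- exists [seq b * b' | b <- s, b' <- s']; rewrite big_allpairs_dep mulr_suml; split.
    by apply: eq_bigr => b _; rewrite mulr_sumr.
  move=> _ /allpairsP[[b b'] /= [/sP[lam bG] /sP'[mu bG'] ->]].
  by exists (lam * mu); exact: GE_M.
Qed.

Lemma T_annihilated (f : {linear fmod iota -> fmod iota}) a :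
  (f : K -> K) = sigma -> T a -> exists2 p, p != 0 & pact f p a = 0.
Proof.
move=> fE [s [-> sP]]; elim: s sP => [|b s IHs] sP.
  by exists 1; rewrite ?oner_neq0 // big_nil linear0.
have [p p0 pE] : exists2 p, p != 0 & pact f p (\sum_(w <- s) w) = 0.
  by apply: IHs => w ws; apply: sP; rewrite inE ws orbT.
have [lam /(gen_eigen_GE _ _ fE)[n bn]] := sP b (mem_head _ _).
exists (p * ('X - lam%:P) ^+ n).
  by rewrite mulf_neq0 // expf_neq0 // polyXsubC_eq0.
rewrite big_cons linearD /=; apply/eqP; rewrite addrC addr_eq0; apply/eqP.
by rewrite [X in pact _ X _]mulrC !pactM pE bn !linear0.
Qed.

End GeneralizedEigenspaces.

(** * The structure of K and T when the fixed field of sigma is k *)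

Section SigmaStructure.
Variables (k : closedFieldType) (K : fieldType).
Variables (iota : {rmorphism k -> K}) (sigma : {rmorphism K -> K}).
Hypotheses (sigma_k : forall c, sigma (iota c) = iota c)
  (sigma_fixed : forall a, sigma a = a -> exists c, a = iota c).
Local Notation GE := (generalized_eigenspace iota sigma).
Local Notation T := (sum_generalized_eigenspaces iota sigma).

Lemma algebraic_over_closed x (p : {poly k}) : p != 0 ->
  root (map_poly iota p) x -> exists c, x = iota c.
Proof.
move=> p0; have [r pE] := closed_field_poly_normal p.
rewrite pE map_polyZ rootZ ?fmorph_eq0 ?lead_coef_eq0 // rmorph_prod /=.
under eq_bigr do rewrite map_polyXsubC.
rewrite -(big_map iota xpredT (fun c => 'X - c%:P)) root_prod_XsubC.
by move=> /mapP[c _ ->]; exists c.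
Qed.

(** If [sigma a = a + c] with a nonzero constant [c], then [a / c] is translated by 1. If this never
    happens, induction on the nilpotency order puts all of [GE 1] in the fixed field. *)
Lemma unipotent_dichotomy :
  (exists x, sigma x = x + 1) \/ GE 1 `<=` range iota.
Proof.
have [|no] := pselect (exists x, sigma x = x + 1); first by left.
right=> a [n]; elim: n a => [|n IHn] a; first by move=> /= ->; exists 0; rewrite ?rmorph0.
rewrite iterSr => /IHn[c _]; rewrite rmorph1 mul1r => cE.
have [c0|c0] := eqVneq c 0.
  have [|c' ->] := sigma_fixed (a := a); last by exists c'.
  by apply/eqP; rewrite -subr_eq0 -cE c0 rmorph0.
case: no; exists (a / iota c); rewrite fmorph_div sigma_k.
have -> : sigma a = iota c + a by rewrite cE subrK.
by rewrite mulrDl divff ?fmorph_eq0 // addrC.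
Qed.

(** In characteristic p the element [x ^+ p - x] would be fixed, hence constant, so [x] would be
    algebraic over k, hence in k and fixed. *)
Lemma translation_char0 x : sigma x = x + 1 -> [pchar k] =i pred0.
Proof.
move=> xE p; apply/negP => p_char.
have [p_pr _] := andP p_char; have p1 := prime_gt1 p_pr.
have pK : p \in [pchar K] by rewrite (fmorph_pchar iota).
have [|c cE] := sigma_fixed (a := x ^+ p - x).
  rewrite rmorphB rmorphXn xE -!(pFrobenius_autE pK) pFrobenius_autD_comm.
    by rewrite pFrobenius_aut1 opprD addrACA subrr addr0.
  exact: mulrC.
have sp : size ('X^p - 'X - c%:P : {poly k}) = p.+1.
  rewrite -addrA size_polyDl ?size_polyXn // ltnS -opprD size_polyN.
  by rewrite size_addl ?size_polyX // size_polyC; case: (c != 0).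
have [||c' xc'] := @algebraic_over_closed x ('X^p - 'X - c%:P).
- by rewrite -size_poly_eq0 sp.
- rewrite /root !rmorphB /= map_polyXn map_polyX map_polyC !hornerE cE.
  by rewrite subrr.
by move/eqP: xE; rewrite xc' sigma_k -subr_eq0 opprD addNKr oppr_eq0 oner_eq0.
Qed.

Lemma translation_transc x : sigma x = x + 1 -> transc iota x.
Proof.
move=> xE p px; apply/eqP; apply: contrapT => /negP p0.
have [|c xc] := algebraic_over_closed p0 (x := x); first by rewrite /root px.
by move/eqP: xE; rewrite xc sigma_k -subr_eq0 opprD addNKr oppr_eq0 oner_eq0.
Qed.

(* The falling factorials [b n] of x satisfy [sigma (b n) - b n = n b (n-1)]. *)
Lemma translation_generates x : sigma x = x + 1 ->
  GE 1 = generated_algebra iota [set x].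
Proof.
move=> xE; have char0 := translation_char0 xE.
have MM := generated_algebra_subalgebra iota [set x].
have Mx : generated_algebra iota [set x] x by exact: sub_generated_algebra.
apply/seteqP; split; last first.
  apply: generated_algebra_min; last first.
    move=> _ ->; exists 2%N; rewrite /= rmorph1 !mul1r xE [x + 1]addrC addrK.
    by rewrite rmorph1 subrr.
  split=> [c|a b|a b aGE bGE]; [exact: iota_GE|exact: GE_D|].
  by rewrite -[1]mulr1; exact: GE_M.
pose b n := \prod_(l < n) (x - l%:R).
have bS n : sigma (b n.+1) - b n.+1 = n.+1%:R * b n.
  rewrite /b rmorph_prod [X in X - _]big_ord_recl [X in _ - X = _]big_ord_recr /=.
  rewrite rmorphB xE rmorph0 subr0.
  have E (l : 'I_n) : sigma (x - (bump 0 l)%:R) = x - l%:R.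
    by rewrite rmorphB xE rmorph_nat -[(bump 0 l)%:R]/(l.+1%:R) -natr1; ring.
  rewrite (eq_bigr _ (fun l _ => E l)).
  by rewrite -nat1r; ring.
have Mb n : generated_algebra iota [set x] (b n).
  apply: (@subalgebra_prod _ _ iota) => // l _; case: (MM) => Mc MD _; apply: MD => //.
  by rewrite -(rmorph_nat iota) -rmorphN.
suff key n a : iter n (fun c => sigma c - iota 1 * c) a = 0 ->
    exists c : nat -> k, a = \sum_(l < n) iota (c l) * b l.
  move=> a [n /key[c ->]]; apply: (@subalgebra_sum _ _ iota) => // l _.
  by case: (MM) => Mc _ MM'; apply: MM'.
elim: n a => [|n IHn] a; first by move=> /= ->; exists (fun=> 0); rewrite big_ord0.
rewrite iterSr => /IHn[c]; rewrite rmorph1 mul1r => cE.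
(* A discrete antiderivative of [sigma a - a]; the division by [l + 1] uses characteristic 0. The
   difference [a - a'] is fixed, hence constant. *)
pose a' := \sum_(l < n) iota (c l / l.+1%:R) * b l.+1.
have a'E : sigma a' = sigma a - a + a'.
  rewrite cE /a' rmorph_sum -big_split; apply: eq_bigr => l _.
  rewrite rmorphM sigma_k -[LHS](subrK (iota (c l / l.+1%:R) * b l.+1)) -mulrBr bS.
  by rewrite mulrA -[X in _ * X * _](rmorph_nat iota) -rmorphM divfK // (pcharf0P _).1.
have [|c0 c0E] := sigma_fixed (a := a - a'); first by rewrite rmorphB a'E; ring.
exists (fun l => if l is l'.+1 then c l' / l'.+1%:R else c0).
rewrite big_ord_recl /= {1}/b big_ord0 mulr1 -c0E.
by rewrite subrK.
Qed.

Definition eigen_family N (z : 'I_N -> K) (p : 'I_N -> k) : Prop :=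
  forall l, z l != 0 /\ sigma (z l) = iota (p l) * z l.

Definition eigen_generated N (z : 'I_N -> K) : Prop :=
  generated_field iota (GE 1 `|` range z) = setT.

Lemma eigen_generatedS N N' (z : 'I_N -> K) (z' : 'I_N' -> K) :
  eigen_generated z ->
  (forall l, generated_field iota (GE 1 `|` range z') (z l)) ->
  eigen_generated z'.
Proof.
move=> zT zz'; apply/seteqP; split=> // x _.
have : generated_field iota (GE 1 `|` range z) x by rewrite zT.
apply: generated_field_min; first exact: generated_field_intermediate.
move=> y [yGE|[l _ <-] //]; apply: sub_generated_field; by left.
Qed.

(* Euclid's algorithm on the exponents: trading [z b] for
   [z b * z a ^ e] replaces [n a] by [n a - e * n b]. *)
Lemma eigen_family_reduce N (z : 'I_N -> K) (p : 'I_N -> k) (n : 'I_N -> int) :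
  eigen_family z p -> eigen_generated z -> \prod_l p l ^ n l = 1 ->
  (exists l, n l != 0) ->
  exists N' (z' : 'I_N' -> K) (p' : 'I_N' -> k),
    [/\ (N' < N)%N, eigen_family z' p' & eigen_generated z'].
Proof.
have [s] := ubnP (\sum_l `|n l|%N); elim: s z p n => // s IHs z p n.
rewrite ltnS => le_s zp zT pn [a na].
have p0 l : p l != 0 by have [z0 /eigenvalue_neq0->] := zp l.
have [[b [c [bc nb nc]]]|no] :=
  pselect (exists b c, [/\ b != c, n b != 0 & n c != 0]).
  wlog le_cb : b c bc nb nc / (`|n c| <= `|n b|)%N.
    move=> H; have [le|/ltnW le] := leqP `|n c| `|n b|; first exact: H le.
    by apply: H le; rewrite // eq_sym.
  (* [e] is the integer quotient of [n b] by [n c]. Letting [z c] and [p c] absorb the [e]-th powers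
     of [z b] and [p b] keeps the product equal to 1 while [n b] becomes the remainder. *)
  have [e lt_e] : exists e : int, (absz (n b - e * n c)%R < absz (n b))%N.
    exists (n b %/ n c)%Z; apply: leq_trans le_cb; rewrite -ltz_nat !abszE.
    rewrite {1}(divz_eq (n b) (n c)) addrAC subrr add0r ger0_norm ?modz_ge0 //.
    by rewrite ltz_mod.
  pose z' l := if l == c then z c * z b ^ e else z l.
  pose p' l := if l == c then p c * p b ^ e else p l.
  pose n' l := if l == b then n b - e * n c else n l.
  apply: (IHs z' p' n').
  - apply: leq_trans le_s; rewrite (bigD1 b) //= [X in (_ < X)%N](bigD1 b) //=.
    rewrite {1}/n' eqxx -addSn leq_add // leq_sum // => l /negPf lb.
    by rewrite /n' lb.
  - move=> l; rewrite /z' /p'; case: (eqVneq l c) => [_|_]; last by move: (zp l).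
    have [[zb0 zbE] [zc0 zcE]] := (zp b, zp c).
    split; first by rewrite mulf_neq0 ?expfz_neq0.
    by rewrite rmorphM fmorphXz zbE zcE rmorphM fmorphXz expfzMl mulrACA.
  - apply: (eigen_generatedS zT) => l.
    have [MM MV] := generated_field_intermediate iota (GE 1 `|` range z').
    have Mz' l' : generated_field iota (GE 1 `|` range z') (z' l').
      by apply: sub_generated_field; right; exists l'.
    have z'b : z' b = z b by rewrite /z' (negPf bc).
    have [lc|lc] := eqVneq l c; last by have := Mz' l; rewrite /z' (negPf lc).
    have -> : z l = z' c * z' b ^ (- e).
      have [zb0 _] := zp b.
      by rewrite z'b /z' eqxx lc -mulrA -expfzDr // subrr mulr1.
    have [_ _ MM'] := MM; apply: MM' => //.
    by apply: (subalgebra_exprz _ MM) => //; exact: MV.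
  - rewrite -[RHS]pn (bigD1 c) //= [RHS](bigD1 c) //= (bigD1 b) //= [X in _ = _ * X](bigD1 b) //=.
    rewrite /p' /n' !eqxx (negPf bc) eq_sym (negPf bc) expfzMl exprz_exp.
    rewrite -mulrA [p b ^ _ * (_ * _)]mulrA -expfzDr // addrCA subrr addr0.
    congr (_ * (_ * _)); apply: eq_bigr => l /andP[/negPf -> /negPf ->] //.
  - by exists c; rewrite /n' ifN // eq_sym.
have n0 l : l != a -> n l = 0.
  by move=> la; apply/eqP; apply: contrapT => /negP nl; apply: no; exists l, a.
have [za0 zaE] := zp a.
have pa : p a ^ n a = 1.
  by rewrite -[RHS]pn (bigD1 a) //= big1 ?mulr1 // => l /n0 ->.
have [|c cE] := sigma_fixed (a := z a ^ n a).
  by rewrite fmorphXz zaE expfzMl -fmorphXz pa rmorph1 mul1r.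
have [c' c'E] : exists c', z a ^+ `|n a| = iota c'.
  case: (n a) cE => m /= E; first by exists c.
  by exists c^-1; rewrite fmorphV -E NegzE -exprnN invrK.
have [||r zr] := @algebraic_over_closed (z a) ('X^`|n a| - c'%:P).
- by rewrite -size_poly_eq0 size_XnsubC // lt0n absz_eq0.
- by rewrite /root rmorphB /= map_polyXn map_polyC !hornerE c'E subrr.
exists N.-1, (z \o lift a), (p \o lift a); split.
- by case: (N) a {z p n le_s zp zT pn na p0 no n0 za0 zaE pa cE c'E zr} => // -[].
- by move=> l; exact: zp.
- apply: (eigen_generatedS zT) => l.
  have [[Mc _ _] _] := generated_field_intermediate iota (GE 1 `|` range (z \o lift a)).
  case: (unliftP a l) => [l' ->|->]; last by rewrite zr.
  by apply: sub_generated_field; right; exists l'.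
Qed.

Lemma eigen_family_free N (z : 'I_N -> K) (p : 'I_N -> k) :
  eigen_family z p -> eigen_generated z ->
  exists N' (z' : 'I_N' -> K) (p' : 'I_N' -> k),
    [/\ eigen_family z' p', eigen_generated z' & freely_generate p'].
Proof.
have [s] := ubnP N; elim: s N z p => // s IHs N z p lt_s zp zT.
have [p_free|no] := pselect (forall n : 'I_N -> int,
  \prod_l p l ^ n l = 1 -> forall l, n l = 0).
  exists N, z, p; split=> //; split=> // l.
  by have [z0 /eigenvalue_neq0->] := zp l.
move: no => /existsNP[n /not_implyP[pn /existsNP[l /eqP nl]]].
have [|N' [z' [p' [lt_N zp' zT']]]] := eigen_family_reduce zp zT pn.
  by exists l.
by apply: IHs zp' zT'; apply: leq_trans lt_N _; rewrite -ltnS.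
Qed.

(** * Monomials in eigenvectors, and the Laurent algebra they generate *)

Section EigenFamily.
Variables (N : nat) (z : 'I_N -> K) (p : 'I_N -> k).
Hypothesis zp : eigen_family z p.

Let z0 l : z l != 0. Proof. by case: (zp l). Qed.
Let zE l : sigma (z l) = iota (p l) * z l. Proof. by case: (zp l). Qed.
Let p0 l : p l != 0. Proof. exact: eigenvalue_neq0 (z0 l) (zE l). Qed.

Lemma mon_eigen m : sigma (mon z m) = iota (mon p m) * mon z m.
Proof.
rewrite /mon !rmorph_prod -big_split; apply: eq_bigr => l _.
by rewrite !rmorphXn zE exprMn.
Qed.

Lemma mon_inj : freely_generate p -> injective (mon p).
Proof.
move=> [_ p_free] m m' mm'; apply/ffunP => l.
suff /eqP : Posz (m l) - Posz (m' l) = 0 by rewrite subr_eq0 => /eqP[].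
apply: (p_free (fun l => Posz (m l) - Posz (m' l))).
under eq_bigr do rewrite expfzDr // -exprnN.
rewrite big_split /= prodfV -/(mon p m') -[X in _ / X]mm' divff //.
by apply/prodf_neq0 => h _; rewrite expf_neq0.
Qed.

(** Distinct monomials have distinct eigenvalues by [mon_inj], so terms with different exponents lie
    in different generalized eigenspaces. Coefficients in [GE 1] allow polynomials in a translated
    variable. *)
Lemma mon_independent (I : finType) (m : I -> {ffun 'I_N -> nat}) (w : I -> K) :
  freely_generate p -> (forall l, GE 1 (w l)) ->
  \sum_l w l * mon z (m l) = 0 -> forall e, \sum_(l | m l == e) w l = 0.
Proof.
move=> p_free wGE sum0 e.
have e0 : mon z e != 0 by apply/prodf_neq0 => h _; rewrite expf_neq0.
apply: (mulIf e0); rewrite mul0r mulr_suml.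
rewrite -[RHS](GE_independent sigma_k (lam := fun l => mon p (m l)) _ sum0 (mon p e)).
  rewrite [RHS](eq_bigl (fun l => m l == e)) => [|l]; last exact/inj_eq/mon_inj.
  by apply: eq_bigr => l /eqP ->.
move=> l; rewrite -[mon p _]mul1r; apply: GE_M => //; apply: eigen_GE.
exact: mon_eigen.
Qed.

Lemma eigen_mono_free : freely_generate p -> mono_free iota z.
Proof.
move=> p_free I m m_inj c sum0 l.
have := mon_independent p_free (fun l => iota_GE sigma_k (c l)) sum0 (m l).
rewrite (big_pred1 l) => [/eqP|h]; first by rewrite fmorph_eq0 => /eqP.
exact: inj_eq.
Qed.

(** Terms are grouped by their exponents in [z]; each group is a polynomial relation for the
    transcendental [x]. *)
Lemma translation_mono_free x : sigma x = x + 1 -> freely_generate p ->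
  mono_free iota (fun l : 'I_N.+1 => oapp z x (unlift ord0 l)).
Proof.
move=> xE p_free I m m_inj c sum0 l0.
pose m' l : {ffun 'I_N -> nat} := [ffun h => m l (lift ord0 h)].
have mE l : m l = minsert ord0 (m l ord0) (m' l).
  apply/ffunP => h; rewrite ffunE; case: unliftP => [h' ->|-> //] /=.
  by rewrite ffunE.
have xGE n : GE 1 (x ^+ n).
  have [_ _ MM'] := generated_algebra_subalgebra iota [set x].
  rewrite (translation_generates xE) -[n]card_ord -prodr_const.
  apply: (@subalgebra_prod _ _ iota); first exact: generated_algebra_subalgebra.
  by move=> _ _; apply: sub_generated_algebra.
have sum_e : \sum_(l | m' l == m' l0) iota (c l) * x ^+ m l ord0 = 0.
  apply: mon_independent p_free _ _ _ => [l|]; first exact: GE_Z.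
  rewrite -[RHS]sum0; apply: eq_bigr => l _; rewrite -mulrA; congr (_ * _).
  rewrite [m l in RHS]mE mon_insert unlift_none; congr (_ * _).
  by apply: eq_bigr => h _; rewrite /= liftK.
have : \sum_(l | m' l == m' l0) c l *: 'X^(m l ord0) = 0.
  apply: (translation_transc xE); rewrite rmorph_sum horner_sum -[RHS]sum_e.
  by apply: eq_bigr => l _; rewrite /= map_polyZ map_polyXn hornerZ hornerXn.
move/polyP/(_ (m l0 ord0)); rewrite coef0 coef_sum (bigD1 l0) //=.
rewrite coefZ coefXn eqxx mulr1 big1 ?addr0 // => l /andP[/eqP ll' ll].
rewrite coefZ coefXn [_ == _](negPf _) ?mulr0 //; apply: contraNneq ll => E.
by apply/eqP/m_inj; rewrite (mE l) (mE l0) ll' E.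
Qed.

Definition zpow (L : fieldType) (y : 'I_N -> L) (n : {ffun 'I_N -> int}) : L :=
  \prod_l y l ^ n l.

Lemma zpowD (L : fieldType) (y : 'I_N -> L) n n' : (forall l, y l != 0) ->
  zpow y (n + n') = zpow y n * zpow y n'.
Proof.
move=> y0; rewrite /zpow -big_split; apply: eq_bigr => l _.
by rewrite ffunE expfzDr.
Qed.

Lemma zpow0 (L : fieldType) (y : 'I_N -> L) : zpow y 0 = 1.
Proof. by rewrite /zpow big1 // => l _; rewrite ffunE. Qed.

Lemma zpow_delta (L : fieldType) (y : 'I_N -> L) l (e : int) :
  zpow y [ffun h => if h == l then e else 0] = y l ^ e.
Proof.
rewrite /zpow (bigD1 l) //= ffunE eqxx big1 ?mulr1 // => h /negPf hl.
by rewrite ffunE hl expr0z.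
Qed.

Lemma zpow_eigen n : sigma (zpow z n) = iota (zpow p n) * zpow z n.
Proof.
rewrite /zpow !rmorph_prod -big_split; apply: eq_bigr => l _.
by rewrite !fmorphXz zE expfzMl.
Qed.

(** The singleton of a translated variable in case (A), the empty set in case (B); both cases are
    treated at once. *)
Variable X1 : set K.
Hypothesis X1_gen : GE 1 = generated_algebra iota X1.

Local Notation gens := ((X1 `|` range z) `|` range (fun l => (z l)^-1)).
Local Notation R := (generated_algebra iota gens).

Let RR : is_subalgebra iota R. Proof. exact: generated_algebra_subalgebra. Qed.

Let GE1_sub : GE 1 `<=` R.
Proof.
rewrite X1_gen; apply: generated_algebra_min => // x X1x.
by apply: sub_generated_algebra; left; left.
Qed.

Let Rz l : R (z l).
Proof. by apply: sub_generated_algebra; left; right; exists l. Qed.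

Let RzV l : R (z l)^-1.
Proof. by apply: sub_generated_algebra; right; exists l. Qed.

Let Rzpow n : R (zpow z n).
Proof. by apply: (subalgebra_prod _ RR) => l _; apply: (subalgebra_exprz _ RR). Qed.

Lemma laurent_expansion a : R a -> exists s : seq (K * {ffun 'I_N -> int}),
  (forall u, u \in s -> GE 1 u.1) /\ a = \sum_(u <- s) u.1 * zpow z u.2.
Proof.
have one w n : GE 1 w -> exists s : seq (K * {ffun 'I_N -> int}),
    (forall u, u \in s -> GE 1 u.1) /\ w * zpow z n = \sum_(u <- s) u.1 * zpow z u.2.
  by move=> wGE; exists [:: (w, n)]; rewrite big_seq1; split=> // u; rewrite inE => /eqP ->.
apply: (@generated_algebra_min _ _ _ _ [set a | exists s : seq (K * {ffun 'I_N -> int}),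
  (forall u, u \in s -> GE 1 u.1) /\ a = \sum_(u <- s) u.1 * zpow z u.2]) => [|x].
  split=> [c|_ _ [s [sP ->]] [s' [sP' ->]]|_ _ [s [sP ->]] [s' [sP' ->]]] /=.
  - by have := one _ 0 (iota_GE sigma_k c); rewrite zpow0 mulr1.
  - exists (s ++ s'); rewrite big_cat; split=> // u; rewrite mem_cat.
    by case/orP; [exact: sP|exact: sP'].
  - exists [seq (u.1 * v.1, u.2 + v.2) | u <- s, v <- s']; split.
      move=> _ /allpairsP[[u v] /= [/sP uG /sP' vG ->]] /=.
      by rewrite -[1]mulr1; exact: GE_M.
    rewrite big_allpairs_dep mulr_suml; apply: eq_bigr => u _.
    rewrite mulr_sumr; apply: eq_bigr => v _ /=.
    by rewrite zpowD // mulrACA.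
have GE1 : GE 1 1 by rewrite -(rmorph1 iota); exact: iota_GE.
move=> [[X1x|[l _ <-]]|[l _ <-]] /=.
- have := one x 0; rewrite zpow0 mulr1; apply; rewrite X1_gen.
  exact: sub_generated_algebra.
- by have := one _ [ffun h => if h == l then 1 else 0] GE1; rewrite zpow_delta mul1r.
- by have := one _ [ffun h => if h == l then -1 else 0] GE1; rewrite zpow_delta mul1r.
Qed.

(** Comparing [q] with its Laurent expansion, [mu] must be the eigenvalue of some Laurent monomial;
    the quotient of [q] by that monomial is fixed, so [q] is a scalar times a monomial. *)
Lemma eigenvector_unit q mu : R q -> q != 0 -> sigma q = iota mu * q -> R q^-1.
Proof.
move=> /laurent_expansion[s [sP qs]] q0 qE.
pose u (l : 'I_(size s)) := nth (0, 0) s l.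
(* Index 0 carries [- q] and the others the Laurent terms, so the family sums to 0 and
   [GE_independent] applies. *)
pose v l := oapp (fun l => (u l).1 * zpow z (u l).2) (- q) (unlift ord0 l).
pose lam l := oapp (fun l => zpow p (u l).2) mu (unlift ord0 l).
have vGE l : GE (lam l) (v l).
  rewrite /lam /v; case: unliftP => [l' _|_] /=; last first.
    by apply: eigen_GE; rewrite rmorphN qE mulrN.
  rewrite -[zpow p _]mul1r; apply: GE_M => //; first by apply: sP; rewrite mem_nth.
  exact/eigen_GE/zpow_eigen.
have v0 : \sum_l v l = 0.
  rewrite big_ord_recl {1}/v unlift_none /= {1}qs (big_nth (0, 0)) big_mkord.
  by rewrite addrC -sumrB big1 // => l _; rewrite /v liftK subrr.
have [[n nE]|no] := pselect (exists n, zpow p n = mu); last first.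
  have := GE_independent sigma_k vGE v0 mu.
  rewrite (big_pred1 ord0) => [|l] /=; last first.
    rewrite /lam; case: unliftP => [l' ->|->] /=; last by rewrite !eqxx.
    by rewrite [RHS]eq_sym (negPf (neq_lift _ _)); apply/eqP => E; apply: no; exists (u l').2.
  by rewrite /v unlift_none /= => /eqP; rewrite oppr_eq0 (negPf q0).
have [|c cE] := sigma_fixed (a := q / zpow z n).
  rewrite rmorphM fmorphV zpow_eigen qE nE invfM mulrACA divff ?mul1r //.
  by rewrite fmorph_eq0 (eigenvalue_neq0 q0 qE).
have -> : q^-1 = iota c^-1 * zpow z (- n).
  have /eqP := zpowD n (- n) z0; rewrite subrr zpow0 eq_sym => /eqP zn.
  rewrite fmorphV -cE invf_div -mulrA mulrCA zn mulr1 //.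
by case: RR => Rc _ RM; apply: RM.
Qed.

Lemma generated_sigma a : R a -> R (sigma a).
Proof.
have [Rc RD RM] := RR.
apply: (@generated_algebra_min _ _ _ _ [set a | R (sigma a)]) => [|x].
  split=> [c|x y Rx Ry|x y Rx Ry] /=; first by rewrite sigma_k.
    by rewrite rmorphD; exact: RD.
  by rewrite rmorphM; exact: RM.
move=> [[X1x|[l _ <-]]|[l _ <-]] /=.
- apply: GE1_sub; apply: (GE_sigma sigma_k); rewrite X1_gen.
  exact: sub_generated_algebra.
- by rewrite zE; apply: RM.
- by rewrite (eigenV (zE l)); apply: RM.
Qed.

Hypothesis zT : eigen_generated z.

Lemma generated_frac x : exists a b, [/\ R a, R b, b != 0 & x = a / b].
Proof.
have [Rc RD RM] := RR; have R1 := subalgebra1 RR.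
have : generated_field iota (GE 1 `|` range z) x by rewrite zT.
apply: (@generated_field_min _ _ _ _
  [set x | exists a b, [/\ R a, R b, b != 0 & x = a / b]]) => [|y].
  split; last first.
    move=> _ [a [b [Ra Rb b0 ->]]]; have [->|a0] := eqVneq a 0.
      by exists 0, 1; split; rewrite ?oner_neq0 ?mul0r ?invr0 //; exact: subalgebra0 RR.
    by exists b, a; split; rewrite ?invf_div.
  split=> [c|_ _ [a [b [Ra Rb b0 ->]]] [a' [b' [Ra' Rb' b'0 ->]]]|
    _ _ [a [b [Ra Rb b0 ->]]] [a' [b' [Ra' Rb' b'0 ->]]]].
  - by exists (iota c), 1; split; rewrite ?oner_neq0 ?divr1.
  - exists (a * b' + a' * b), (b * b'); split; rewrite ?mulf_neq0 ?addf_div //.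
      by apply: RD; apply: RM.
    exact: RM.
  - by exists (a * a'), (b * b'); split; rewrite ?mulf_neq0 ?mulf_div //; apply: RM.
move=> [/GE1_sub Ry|[l _ <-]].
  by exists y, 1; split; rewrite ?oner_neq0 ?divr1.
by exists (z l), 1; split; rewrite ?oner_neq0 ?divr1.
Qed.

Lemma generated_sub_T : R `<=` T.
Proof.
apply: generated_algebra_min; first exact: T_subalgebra.
move=> x [[X1x|[l _ <-]]|[l _ <-]].
- by apply: (@sub_GE_T _ _ _ _ 1); rewrite X1_gen; exact: sub_generated_algebra X1x.
- exact/sub_GE_T/eigen_GE.
- exact/sub_GE_T/eigen_GE/eigenV.
Qed.

(* The denominators of an eigenvector [w] form a sigma-stable nonzero ideal of
   R, so they contain an eigenvector, which is a unit of R. *)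
Lemma eigenvector_generated w lam : w != 0 -> sigma w = iota lam * w -> R w.
Proof.
move=> w0 wE; have [a [b [Ra Rb b0 wab]]] := generated_frac w.
have [Rc RD RM] := RR.
have [f fE] := sigma_linear_exists sigma_k.
have [q q0 qb] := T_annihilated fE (generated_sub_T Rb).
have [q' [mu [q'b q'E]]] := pact_eigenvector q0 qb b0.
have lam0 := eigenvalue_neq0 w0 wE.
(* [D] contains [b], and it is stable under sigma because [w] is an eigenvector; so it contains the
   eigenvector [pact f q' b]. *)
have den h : R (pact f h b) /\ R (w * pact f h b).
  pose D : set K := [set x | R x /\ R (w * x)].
  have DD : @is_submodule k (fmod iota) D.
    split=> [|x y [Rx Rwx] [Ry Rwy]|c x [Rx Rwx]]; split.
    - exact: subalgebra0 RR.
    - by rewrite mulr0; exact: subalgebra0 RR.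
    - exact: RD.
    - by rewrite mulrDr; exact: RD.
    - exact: RM.
    - by rewrite -[c *: x]/(iota c * x) mulrCA; exact: RM.
  apply: (@submodule_sum k (fmod iota) D) => // l _.
  elim: (l : nat) => [|n [Rn Rwn]]; first by rewrite /= /D /= wab divfK.
  rewrite iterS [f _](congr1 (@^~ _) fE); split; first exact: generated_sigma.
  have -> : w * sigma (iter n f b) = iota lam^-1 * sigma (w * iter n f b).
    by rewrite rmorphM wE !mulrA -rmorphM mulVf // rmorph1 mul1r.
  by apply: RM => //; exact: generated_sigma.
have [Rq' Rwq'] := den q'.
rewrite -[w](mulfK (q'b : (pact f q' b : K) != 0)); apply: RM => //.
by apply: eigenvector_unit Rq' q'b _; rewrite -fE; exact: q'E.
Qed.

(** A generalized eigenvector [y] for [lam] is [y / w] times an eigenvector [w] for [lam]; here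
    [y / w] lies in [GE 1] and [w] is in [R] by [eigenvector_generated]. *)
Lemma T_generated : T = R.
Proof.
apply/seteqP; split; last exact: generated_sub_T.
have [Rc RD RM] := RR.
move=> _ [s [-> sP]]; rewrite big_seq; apply: (subalgebra_sum _ RR) => y /sP[lam yG].
have [->|y0] := eqVneq y 0; first exact: subalgebra0 RR.
have [w w0 wE] := GE_eigenvector yG y0.
rewrite -[y](divfK w0); apply: RM; last exact: eigenvector_generated wE.
apply: GE1_sub; rewrite -(divff (eigenvalue_neq0 w0 wE)).
by apply: GE_M => //; exact/eigen_GE/eigenV.
Qed.

End EigenFamily.

Theorem sigma_structure N (z : 'I_N -> K) (p : 'I_N -> k) :
  eigen_family z p -> eigen_generated z ->
  (exists (m : nat) (x : 'I_m.+1 -> K) (p : 'I_m -> k),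
    [/\ is_rational_function_field iota x,
        sigma (x ord0) = x ord0 + 1
          /\ (forall l : 'I_m,
                sigma (x (lift ord0 l)) = iota (p l) * x (lift ord0 l)),
        T = generated_algebra iota
              (range x `|` range (fun l : 'I_m => (x (lift ord0 l))^-1)),
        freely_generate p
      & [pchar k] =i pred0])
  \/
  (exists (m : nat) (x : 'I_m -> K) (p : 'I_m -> k),
    [/\ is_rational_function_field iota x,
        (forall l : 'I_m, sigma (x l) = iota (p l) * x l),
        T = generated_algebra iota
              (range x `|` range (fun l : 'I_m => (x l)^-1))
      & freely_generate p]).
Proof.
move=> zp0 zT0; have [m [y [q [yq yT q_free]]]] := eigen_family_free zp0 zT0.
have [[x xE]|GE1] := unipotent_dichotomy.
  have GE1 := translation_generates xE.
  pose x' (l : 'I_m.+1) := oapp y x (unlift ord0 l).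
  have x'0 : x' ord0 = x by rewrite /x' unlift_none.
  have x'S l : x' (lift ord0 l) = y l by rewrite /x' liftK.
  left; exists m, x', q; split=> //; last exact: translation_char0 xE.
  - split; first exact/mono_free_alg_indep/(translation_mono_free yq xE q_free).
    apply/seteqP; split=> // a _.
    have MM := generated_field_intermediate iota (range x').
    have : generated_field iota (GE 1 `|` range y) a by rewrite yT.
    apply: generated_field_min => // b [|[l _ <-]]; last first.
      by apply: sub_generated_field; exists (lift ord0 l).
    rewrite GE1; apply: generated_algebra_min; first by case: MM.
    by move=> _ ->; apply: sub_generated_field; exists ord0.
  - by rewrite x'0; split=> // l; rewrite x'S; case: (yq l).
  - rewrite (T_generated yq GE1 yT); congr (generated_algebra _ (_ `|` _)).
      apply/seteqP; split=> [_ [->|[l _ <-]]|_ [l _ <-]].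
      + by exists ord0.
      + by exists (lift ord0 l).
      + by case: (unliftP ord0 l) => [l' ->|->]; [right; exists l'|left].
    by apply: eq_imagel => l _; rewrite x'S.
right; exists m, y, q.
have GE1E : GE 1 = generated_algebra iota set0.
  apply/seteqP; split=> [a /GE1[c _ <-]|].
    by case: (generated_algebra_subalgebra iota set0).
  apply: generated_algebra_min => //.
  split=> [c|a b|a b aG bG]; [exact: iota_GE|exact: GE_D|].
  by rewrite -[1]mulr1; exact: GE_M.
split=> //.
- split; first exact/mono_free_alg_indep/(eigen_mono_free yq q_free).
  apply/seteqP; split=> // a _.
  have MM := generated_field_intermediate iota (range y).
  have : generated_field iota (GE 1 `|` range y) a by rewrite yT.
  apply: generated_field_min => // b [/GE1[c _ <-]|]; last exact: sub_generated_field.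
  by case: MM => -[].
- by move=> l; case: (yq l).
- by rewrite (T_generated yq GE1E yT) set0U.
Qed.

End SigmaStructure.

(** * Birationally commutative algebras *)

Section BirationallyCommutative.
Variables (k : closedFieldType) (A : algType k) (gr : int -> set A).
Variables (K : fieldType) (iota : {rmorphism k -> K}) (sigma : {rmorphism K -> K}).
Variables (Q : unitAlgType k) (i : {lrmorphism A -> Q}) (j : {rmorphism K -> Q}).
Variable (t : Q).
Hypotheses (A_graded : is_grading gr) (A_n_neq0 : forall n : int, gr n <> [set 0])
  (A_dom : domain A) (sigma_bij : bijective sigma)
  (sigma_k : forall c : k, sigma (iota c) = iota c)
  (A_bircomm : is_birationally_commutative gr iota sigma i j t).

Let i_inj : injective i.
Proof. by case: A_bircomm => -[]. Qed.

Let t_unit : t \is a GRing.unit.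
Proof. by case: A_bircomm => _ []. Qed.

Let tj a : t * j a = j (sigma a) * t.
Proof. by case: A_bircomm => _ []. Qed.

Let j_iota c : j (iota c) = c%:A.
Proof. by case: A_bircomm. Qed.

Let gr_submod n : is_submodule (gr n).
Proof. by case: A_graded => -[]. Qed.

Let gr_mul m n a b : gr m a -> gr n b -> gr (m + n) (a * b).
Proof. by case: A_graded => _ + _ _; apply. Qed.

Let gr01 : gr 0 1.
Proof. by case: A_graded => -[]. Qed.

Lemma gr_coef n a : gr n a -> exists b, i a = j b * t ^ n.
Proof.
move=> gra; have [_ _ _ /(_ n) E] := A_bircomm.
have : localization_degree gr i n (i a).
  exists 0, a, 1; rewrite addr0 oner_neq0; split=> //.
  by rewrite rmorph1 invr1 mulr1.
by rewrite E => -[b _ <-]; exists b.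
Qed.

Lemma gr_neq0 n : exists2 a, gr n a & a != 0.
Proof.
apply: contrapT => no; apply: (A_n_neq0 (n := n)).
have [g0 _ _] := gr_submod n.
apply/seteqP; split=> [a gra|_ ->] //.
by apply/eqP; apply: contrapT => /negP a0; apply: no; exists a.
Qed.

Definition degree0 : set K := [set b | exists2 a, gr 0 a & i a = j b].

Lemma degree0_1 : degree0 1.
Proof. by exists 1; rewrite ?rmorph1. Qed.

Lemma degree0M x y : degree0 x -> degree0 y -> degree0 (x * y).
Proof.
move=> [a gra ia] [b grb ib]; exists (a * b); last by rewrite !rmorphM /= ia ib.
by rewrite -[0]addr0; exact: gr_mul.
Qed.

Lemma degree0_gr a : gr 0 a -> exists2 x, degree0 x & i a = j x.
Proof.
by move=> gra; have [b] := gr_coef gra; rewrite expr0z mulr1 => ia; exists b => //;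
  exists a.
Qed.

(** An element of K is a fraction of elements of A of one degree [m]. Multiplying both by a nonzero
    element of degree [- m], available since no [gr n] is zero, moves them to degree 0. *)
Lemma degree0_frac x : exists a b, [/\ degree0 a, degree0 b, b != 0 & x * b = a].
Proof.
have [_ _ _ /(_ 0) E] := A_bircomm.
have : localization_degree gr i 0 (j x) by rewrite E; exists x; rewrite ?mulr1.
move=> [m [a [s [gra grs s0 jx]]]]; rewrite add0r in gra.
have [u gru u0] := gr_neq0 (- m).
have [|a' A0a' ia'] := @degree0_gr (a * u).
  by rewrite -(subrr m); exact: gr_mul.
have [|b A0b ib] := @degree0_gr (s * u).
  by rewrite -(subrr m); exact: gr_mul.
have su : i s \is a GRing.unit.
  by have [[_ iu _ _] _ _ _] := A_bircomm; apply: iu; split=> //; exists m.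
exists a', b; split=> //.
  apply/negP => /eqP b0; have := ib; rewrite b0 rmorph0 -(rmorph0 i) => /i_inj.
  by move/A_dom => [/eqP|/eqP]; rewrite ?(negPf s0) ?(negPf u0).
apply: (fmorph_inj j); rewrite rmorphM -ib -ia' jx !rmorphM /= !mulrA.
by rewrite divrK.
Qed.

Lemma degree0_common_denominator d (x : 'I_d -> K) :
  exists2 s, degree0 s & s != 0 /\ forall l, degree0 (s * x l).
Proof.
have /(_ _)/cid-/all_sig[a /(_ _)/cid-/all_sig[b ab]] :=
  fun l => degree0_frac (x l).
have A0prod (P : pred 'I_d) : degree0 (\prod_(l | P l) b l).
  elim/big_rec: _ => [|l y _ A0y]; first exact: degree0_1.
  by apply: degree0M => //; case: (ab l).
exists (\prod_l b l) => //; split.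
  by apply/prodf_neq0 => l _; case: (ab l).
move=> l; rewrite (bigD1 l) //= mulrAC; apply: degree0M => //.
by case: (ab l) => A0a _ _ E; rewrite mulrC E.
Qed.

Lemma tXj n a : t ^+ n * j a = j (iter n sigma a) * t ^+ n.
Proof.
elim: n => [|n IHn]; first by rewrite mul1r mulr1.
by rewrite exprS -mulrA IHn mulrA tj -mulrA -exprS.
Qed.

Lemma laurent_coef (I : finType) (f : I -> K) (n : I -> int) :
  \sum_l j (f l) * t ^ n l = 0 -> forall m, \sum_(l | n l == m) f l = 0.
Proof.
move=> sum0; pose s := undup [seq n l | l <- enum I].
have [_ [_ _ _ uniqE] _ _] := A_bircomm.
have s_uniq : uniq s by exact: undup_uniq.
have ns l : n l \in s by rewrite mem_undup map_f // mem_enum.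
have key := uniqE s (fun m => \sum_(l | n l == m) f l) s_uniq _.
move=> m; have [ms|ms] := boolP (m \in s); last first.
  by rewrite big_pred0 // => l; apply: contraNF ms => /eqP <-.
apply: key => //; rewrite -[RHS]sum0.
under eq_bigr do rewrite rmorph_sum mulr_suml.
rewrite (exchange_big_dep xpredT) //=; apply: eq_bigr => l _.
rewrite big_mkcond (bigD1_seq (n l)) //= eqxx big1 ?addr0 // => m' /negPf m'l.
by rewrite eq_sym m'l.
Qed.

(** * Long products of conjugates as short words in A *)

Section Growth.
Variables (V : seq K) (X : seq A) (u : A) (b : K).
Hypotheses (Xu : u \in X) (b0 : b != 0) (iu : i u = j b * t)
  (VX : forall v, v \in V -> exists2 a, a \in X & i a = j v).

Lemma iuj a : i u * j a = j (sigma a) * i u.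
Proof.
by rewrite iu -mulrA tj mulrA -rmorphM mulrC rmorphM -mulrA.
Qed.

Lemma iuX n : exists2 c, c != 0 & i u ^+ n = j c * t ^ n.
Proof.
elim: n => [|n [c c0 IHn]]; first by exists 1; rewrite ?oner_neq0 ?rmorph1 ?mul1r.
exists (c * iter n sigma b).
  rewrite mulf_neq0 //; elim: n {c c0 IHn} => [|n IHn] //=.
  by rewrite fmorph_eq0.
rewrite exprSr IHn iu mulrA -[j c * _ * _]mulrA -exprnP tXj mulrA -rmorphM.
by rewrite -mulrA -exprSr.
Qed.

Lemma prods_word N x : prods [set` V] N x ->
  exists w : seq A, [/\ {subset w <= X}, size w = N & i (\prod_(a <- w) a) = j x].
Proof.
elim: N x => [|N IHN] x /=.
  by move=> ->; exists [::]; rewrite big_nil !rmorph1.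
move=> [y /IHN[w [wX sw iw]] [v /VX[a Xa ia] <-]]; exists (rcons w a); split.
- by move=> c; rewrite mem_rcons inE => /predU1P[->|/wX].
- by rewrite size_rcons sw.
- by rewrite -cats1 big_cat big_seq1 [LHS](rmorphM i) /= iw ia rmorphM.
Qed.

(* The products of N conjugates [sigma^r v] with [r <= l], sorted by r. *)
Fixpoint sorted_prods (l N : nat) : set K :=
  if l is l'.+1 then [set x | exists N1 N2 y z,
    [/\ (N1 + N2)%N = N, sorted_prods l' N1 y, prods [set` V] N2 z
      & x = y * iter l sigma z]]
  else prods [set` V] N.

Lemma iter_sigmaM n x y : iter n sigma (x * y) = iter n sigma x * iter n sigma y.
Proof. by elim: n => //= n ->; rewrite rmorphM. Qed.

Lemma iter_sigma1 n : iter n sigma 1 = 1.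
Proof. by elim: n => //= n ->; rewrite rmorph1. Qed.

(** Commutativity of K lets the new factor join the block of index [r]. *)
Lemma sorted_prodsM l N x r v : sorted_prods l N x -> (r <= l)%N -> v \in V ->
  sorted_prods l N.+1 (x * iter r sigma v).
Proof.
elim: l N x => [|l IHl] N x /=.
  by move=> Vx; rewrite leqn0 => /eqP -> Vv; exists x => //; exists v.
move=> [N1 [N2 [y [z [<- Ly Vz ->]]]]]; rewrite leq_eqVlt => /predU1P[->|lt_rl] Vv.
  exists N1, N2.+1, y, (z * v); split=> //; first by rewrite addnS.
    by exists z => //; exists v.
  by rewrite -mulrA; congr (_ * _); exact/esym/(iter_sigmaM l.+1).
exists N1.+1, N2, (y * iter r sigma v), z; split=> //; first exact: IHl.
by rewrite mulrAC.
Qed.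

Lemma sorted_prods_prods l N :
  prods [set x | exists r v, [/\ (r <= l)%N, v \in V & x = iter r sigma v]] N
    `<=` sorted_prods l N.
Proof.
elim: N => [|N IHN] x /=; last first.
  move=> [y /IHN Ly [_ [r [v [le_r Vv ->]]] <-]]; exact: sorted_prodsM.
move=> ->; elim: l => [|l IHl] //=.
by exists 0%N, 0%N, 1, 1; split=> //; rewrite mul1r iter_sigma1 rmorph1.
Qed.

(** Since [u ^+ r] followed by [v] is [sigma^r v] followed by [u ^+ r], a single letter [u] between
    consecutive blocks conjugates everything after it once more. The cost is [l] letters in all, not
    [r] per factor. *)
Lemma sorted_prods_word l N x : sorted_prods l N x ->
  exists w : seq A, [/\ {subset w <= X}, size w = (N + l)%N
    & i (\prod_(a <- w) a) = j x * i u ^+ l].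
Proof.
elim: l N x => [|l IHl] N x /=.
  by move=> /prods_word[w [wX sw iw]]; exists w; rewrite addn0 mulr1.
move=> [N1 [N2 [y [z [<- /IHl[w [wX sw iw]] /prods_word[w' [wX' sw' iw']] ->]]]]].
exists (w ++ u :: w'); split.
- move=> c; rewrite mem_cat inE => /or3P[/wX|/eqP ->|/wX'] //.
- by rewrite size_cat /= sw sw' !addnS addnAC.
- rewrite big_cat /= big_cons !rmorphM /= iw iw' -!mulrA; congr (_ * _).
  rewrite mulrA -exprSr -[sigma (iter l sigma z)]/(iter l.+1 sigma z).
  move: (l.+1) => n.
  elim: n => [|n IHn]; first by rewrite mul1r mulr1.
  by rewrite exprS -mulrA IHn mulrA iuj -mulrA -exprS.
Qed.

(** Finiteness is what keeps [dimension] from its default value in [growth_ge]. *)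
Lemma words_finite n : exists L : seq A, forall w : seq A,
  (size w <= n)%N -> {subset w <= X} -> \prod_(a <- w) a \in L.
Proof.
elim: n => [|n [L LP]].
  by exists [:: 1] => -[|//] _ _; rewrite big_nil inE.
exists (1 :: [seq a * c | a <- X, c <- L]) => -[|a w] sw wX.
  by rewrite big_nil inE eqxx.
rewrite big_cons inE; apply/orP; right; apply/allpairsP.
exists (a, \prod_(c <- w) c); split=> //=; first by apply: wX; rewrite inE eqxx.
by apply: LP => // c cw; apply: wX; rewrite inE cw orbT.
Qed.

Lemma growth_ge (I : finType) n (w : I -> seq A) :
  (forall c : I -> k, \sum_l c l *: i (\prod_(a <- w l) a) = 0 ->
     forall l, c l = 0) ->
  (forall l, size (w l) <= n)%N -> (forall l, {subset w l <= X}) ->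
  (#|I| <= growth X n)%N.
Proof.
move=> w_free sw wX; have [L LP] := words_finite n.
apply: (@dimension_ge _ _ _ (size L).+1).
  move=> rkL; apply: (@rank_seq _ _ L); apply: rank_ge_sub rkL.
  by move=> _ [s [ss sX] <-]; exact: LP.
apply: (rank_ge_sub (@sub_lspan _ _ _)).
apply: (@rank_ge_fin _ _ _ _ (fun l => \prod_(a <- w l) a)).
  move=> c c0; apply: w_free.
  transitivity (i (\sum_l c l *: \prod_(a <- w l) a)); last by rewrite c0 raddf0.
  by rewrite raddf_sum /=; apply: eq_bigr => l _; rewrite linearZ.
by move=> l; exists (w l).
Qed.

(** Each word is followed by fewer than [n] extra letters [u]. Different numbers of them give
    different degrees in t, so the [n] copies of the independent family are jointly independent. *)
Lemma growth_prods l n N M q (e : 'I_q -> K) : (N + l + n <= M)%N ->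
  (forall c : 'I_q -> k, \sum_r iota (c r) * e r = 0 -> forall r, c r = 0) ->
  (forall r, prods
     [set x | exists r v, [/\ (r <= l)%N, v \in V & x = iter r sigma v]] N (e r)) ->
  (n * q <= growth X M)%N.
Proof.
move=> le_M e_free Be.
have /(_ _)/cid-/all_sig[w wP] := fun r => sorted_prods_word (sorted_prods_prods (Be r)).
have /(_ _)/cid2-/all_sig2[b' b'0 b'P] := iuX.
have <- : #|{: 'I_n * 'I_q}| = (n * q)%N by rewrite card_prod !card_ord.
apply: (@growth_ge _ _ (fun cr : 'I_n * 'I_q => w cr.2 ++ nseq cr.1 u)); last 2 first.
- move=> [c r]; rewrite size_cat size_nseq; case: (wP r) => _ -> _ /=.
  by apply: leq_trans le_M; rewrite leq_add2l ltnW.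
- move=> [c r] a; rewrite mem_cat mem_nseq => /orP[|/andP[_ /eqP ->]] //.
  by case: (wP r) => wX _ _ /wX.
move=> c c0.
have iw (cr : 'I_n * 'I_q) : i (\prod_(a <- w cr.2 ++ nseq cr.1 u) a) =
    j (e cr.2 * b' (l + cr.1)%N) * t ^ (l + cr.1)%N.
  rewrite big_cat [LHS](rmorphM i) /=; case: (wP cr.2) => _ _ ->.
  by rewrite big_nseq -Monoid.iteropE rmorphXn -mulrA -exprD b'P mulrA -rmorphM.
have key := @laurent_coef _ (fun cr => iota (c cr) * (e cr.2 * b' (l + cr.1)%N))
  (fun cr : 'I_n * 'I_q => (l + cr.1)%N : int) _.
move=> [a r]; move: r; apply: e_free; apply: (mulIf (b'0 (l + a)%N)).
rewrite mul0r mulr_suml -[RHS](key _ (l + a)%N); last first.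
  rewrite -[RHS]c0; apply: eq_bigr => cr _.
  by rewrite /= iw [X in X * _]rmorphM j_iota -mulrA mulr_algl.
rewrite [RHS](eq_bigl (fun cr => (cr.1 == a) && true)); last first.
  by move=> cr; rewrite andbT eqz_nat eqn_add2l.
rewrite [RHS](eq_bigr (fun cr => (fun a r =>
  iota (c (a, r)) * (e r * b' (l + a)%N)) cr.1 cr.2)); last by case.
rewrite -(pair_big_dep (fun a' => a' == a) (fun _ _ => true)
  (fun a r => iota (c (a, r)) * (e r * b' (l + a)%N))) /=.
by rewrite big_pred1_eq; apply: eq_bigr => r _; rewrite mulrA.
Qed.

End Growth.

(** * Local finiteness of sigma on A_0 *)

Section LocallyFinite.
Variables (R : realType) (d : nat).
Hypotheses (K_trdeg : has_trdeg iota d) (A_GKdim : GKdim A R = (d%:R + 1)%:E).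

Lemma degree0_locally_finite a : degree0 a ->
  exists l (c : 'I_l -> k),
    (exists r, c r != 0) /\ \sum_r iota (c r) * iter r sigma a = 0.
Proof.
move=> A0a; apply: contrapT => no.
have a_free l (c : 'I_l -> k) :
    \sum_r iota (c r) * iter r sigma a = 0 -> forall r, c r = 0.
  move=> c0 r; apply/eqP; apply: contrapT => /negP cr; apply: no.
  by exists l, c; split=> //; exists r.
have [x [/alg_indep_mono_free x_free _]] := K_trdeg.
have [s A0s [s0 A0sx]] := degree0_common_denominator x.
have [u gru u0] := gr_neq0 1.
have [b iu] := gr_coef gru; rewrite expr1z in iu.
have b0 : b != 0.
  apply: contraNneq u0 => b0; apply/eqP/i_inj.
  by rewrite iu b0 rmorph0 mul0r raddf0.
(* [V] has to lie in A_0, whence the factor [s]; dividing by [s] below yields 1 from [s], and the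
   transcendence basis from the [s * x l]. *)
pose V := [:: 1, s, a & [seq s * x l | l <- enum 'I_d]].
have A0V v : v \in V -> degree0 v.
  rewrite !inE => /or4P[/eqP ->|/eqP ->|/eqP ->|/mapP[l _ ->]] //.
  exact: degree0_1.
have [X Xu VX] : exists2 X : seq A, u \in X &
    forall v, v \in V -> exists2 a, a \in X & i a = j v.
  suff [X XP] : exists X : seq A, forall v, v \in V -> exists2 a, a \in X & i a = j v.
    exists (u :: X); first by rewrite inE eqxx.
    by move=> v /XP[c Xc ic]; exists c => //; rewrite inE Xc orbT.
  elim: V A0V => [|v V IHV] A0V; first by exists [::].
  have [|X XP] := IHV; first by move=> w Vw; apply: A0V; rewrite inE Vw orbT.
  have [|c _ ic] := A0V v; first by rewrite inE eqxx.
  exists (c :: X) => w; rewrite inE => /predU1P[->|/XP[e Xe ie]].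
    by exists c; rewrite ?inE ?eqxx.
  by exists e; rewrite // inE Xe orbT.
apply: (@growth_exponent R (growth X) d (2 ^ d)); first by rewrite expn_gt0.
  move=> m m0; set n := (m ^ 2 ^ d)%N.
  have n0 : (0 < n)%N by rewrite expn_gt0 m0.
  pose B := [seq s^-1 * iter r sigma v | r : 'I_n <- enum 'I_n, v <- V].
  have Bin r v : (r < n)%N -> v \in V -> s^-1 * iter r sigma v \in B.
    move=> lt_r Vv; apply/allpairsP; exists (Ordinal lt_r, v).
    by rewrite mem_enum.
  have B1 : 1 \in B.
    by have := Bin 0%N s n0; rewrite /= mulVf // !inE eqxx orbT; apply.
  have Bx l : x l \in B.
    have := Bin 0%N (s * x l) n0; rewrite /= mulKf //; apply.
    rewrite !inE; apply/or4P; apply: Or44.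
    by apply/mapP; exists l; rewrite ?mem_enum.
  have Bn : rk iota [set` B] (m ^ 2 ^ d)%N.
    exists (fun r : 'I_n => s^-1 * iter r sigma a); split.
      move=> c c0; apply: a_free; apply: (mulfI (invr_neq0 s0)).
      rewrite mulr0 -[RHS]c0 mulr_sumr; apply: eq_bigr => r _.
      by rewrite -[_ *: _]/(iota (c r) * _) mulrCA.
    by move=> r; apply: Bin => //; rewrite !inE eqxx !orbT.
  have [e [e_free Be]] := rk_prods x_free B1 Bx m0 n0 Bn.
  (* Word length: [(d + 1) n] letters from [V], [n - 1] letters [u] for the conjugations and fewer
     than [n] more, within [(d + 3) n]. The power of [s] clears denominators and preserves
     independence. *)
  apply: (@growth_prods V X u b Xu b0 iu VX n.-1 n (d.+1 * n)%N _ _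
    (fun r => s ^+ (d.+1 * n) * e r)).
  - apply: (@leq_trans (d.+1 * n + n + n)).
      by rewrite leq_add2r leq_add2l leq_pred.
    by rewrite -addnA addnn -mul2n -mulnDl addn2.
  - move=> c c0; apply: e_free; apply: (mulfI (expf_neq0 (d.+1 * n) s0)).
    rewrite mulr0 -[RHS]c0 mulr_sumr; apply: eq_bigr => r _.
    by rewrite -[_ *: _]/(iota (c r) * _) mulrCA.
  - move=> r; apply: prods_scale (Be r) => _ /allpairsP[[q v] [_ Vv ->]] /=.
    by rewrite mulVKf //; exists q, v; split=> //; rewrite -ltnS prednK.
have : (limn_esup (fun n => (ln ((growth X n)%:R : R) / ln n%:R)%:E) <= GKdim A R)%E.
  by apply: ereal_sup_ubound; exists X.
by rewrite A_GKdim.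
Qed.

End LocallyFinite.

(** The [b] in A with [b z] in A form a nonzero ideal, as it contains a denominator of [z].
    Multiplication by [z] on it is the [phi] of [primitive_centroid_scalar]. *)
Lemma primitive_centerless : fin_gen_algebra A -> primitive A ->
  ~ countable [set: k] -> centerless Q.
Proof.
move=> A_fg A_prim k_unc; have [W A_span] := countable_spanning A_fg.
have [[_ i_unit i_frac _] _ _ _] := A_bircomm.
apply/seteqP; split=> [z z_central|_ [c _ <-] y]; last by rewrite mulr_algl mulr_algr.
have [a [s [Ss zE]]] := i_frac z; have s0 : s != 0 by case: Ss.
have su := i_unit _ Ss.
pose I : set A := [set b | exists b', i b * z = i b'].
pose phi b := xget 0 [set b' | i b * z = i b'].
have phiE b : I b -> i b * z = i (phi b).
  by rewrite /phi; case: xgetP => [b' -> //|no] [b' E]; case: (no b').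
have Is : I s by exists a; rewrite -z_central zE divrK.
have phiMl b' b : I b -> phi (b' * b) = b' * phi b.
  move=> Ib; apply: i_inj; rewrite -phiE ?rmorphM -?mulrA ?phiE //.
  by exists (b' * phi b); rewrite !rmorphM -mulrA phiE.
have phiMr b' b : I b -> phi (b * b') = phi b * b'.
  move=> Ib; have E : i (b * b') * z = i (phi b * b').
    by rewrite !rmorphM -mulrA -z_central mulrA phiE.
  by apply: i_inj; rewrite -phiE //; exists (phi b * b').
have I_ideal : is_ideal I.
  split; last by move=> b b' Ib; exists (phi b * b');
    rewrite -phiMr // -phiE //; exists (phi b * b');
    rewrite !rmorphM -mulrA -z_central mulrA phiE.
  split=> [|x y [x' xE] [y' yE]|b b' Ib].
  - by exists 0; rewrite !rmorph0 mul0r.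
  - by exists (x' + y'); rewrite !rmorphD mulrDl xE yE.
  - by exists (b * phi b'); rewrite !rmorphM -mulrA phiE.
suff [c cP] : exists c : k, phi s = c *: s.
  exists c => //; apply: (mulrI su); rewrite phiE // cP linearZ.
  by rewrite mulr_algr.
case: A_prim => -[M [M_simple M_faithful]].
  have [||c cP] := @primitive_centroid_scalar k A (GRing.in_alg A) M _ M_simple
    M_faithful I phi s I_ideal Is s0 phiMl phiMr W _ k_unc.
  - by move=> c b; rewrite /= mulr_algl mulr_algr.
  - move=> b; have [N [c bE]] := A_span b; exists N, c; rewrite bE.
    by apply: eq_bigr => l _; rewrite /= mulr_algl.
  - by exists c; rewrite cP //= mulr_algl.
(* On the other side the same argument runs in the opposite ring, with [phiMl] and [phiMr]
   exchanged. *)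
have [g gE] := converse_in_alg A.
have [|||c cP] := @primitive_centroid_scalar k A^c g M _ M_simple
  M_faithful I phi s _ Is s0 phiMr phiMl W _ k_unc.
- by move=> c b; rewrite gE; exact: (etrans (mulr_algr _ _) (esym (mulr_algl _ _))).
- have [[I0 ID IMl] IMr] := I_ideal; split; first split=> //.
    by move=> b x Ix; exact: IMr.
  by move=> x b Ix; exact: IMl.
- move=> b; have [N [c bE]] := A_span b; exists N, c; rewrite bE.
  by apply: eq_bigr => l _; rewrite gE; exact/esym/mulr_algr.
- by exists c; rewrite cP // gE; exact: mulr_algr.
Qed.

(** * Eigenvectors generating K, and the case of simple A *)

Section DegreeZeroInT.
Local Notation GE := (generalized_eigenspace iota sigma).
Local Notation T := (sum_generalized_eigenspaces iota sigma).

(** A fixed [a] commutes with t and with K, so [j a] is central. *)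
Lemma fixed_field_scalars : centerless Q -> forall a, sigma a = a -> exists c, a = iota c.
Proof.
move=> Q_central a aE; have [_ [_ _ laurent _] _ _] := A_bircomm.
have : range (GRing.in_alg Q) (j a).
  rewrite -Q_central => q; have [s [f [_ ->]]] := laurent q.
  rewrite mulr_suml mulr_sumr; apply: eq_bigr => n _.
  rewrite mulrA -rmorphM mulrC rmorphM -!mulrA; congr (_ * _).
  by apply: commrXz; rewrite /GRing.comm tj aE.
by move=> [c _ cE]; exists c; apply: (fmorph_inj j); rewrite j_iota -cE.
Qed.

(** For negative [n], [s] is a power of the inverse of sigma, known only as a function; so what is
    recorded is that sets stable under sigma in both directions are preserved. *)
Lemma tzj (n : int) : exists s : K -> K,
  (forall a, t ^ n * j a = j (s a) * t ^ n) /\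
  forall M : set K, (forall a, M a -> M (sigma a)) ->
    (forall a, M (sigma a) -> M a) -> forall a, M a -> M (s a).
Proof.
have [tau tauK sigmaK] := sigma_bij.
case: n => n.
  exists (iter n sigma); split=> [a|M Ms _ a Ma]; first exact: tXj.
  by elim: n => //= n IHn; exact: Ms.
exists (iter n.+1 tau); split=> [a|M _ Ms a Ma].
  rewrite NegzE -exprnN; apply: (mulrI (unitrX n.+1 t_unit)).
  rewrite mulrA mulrV ?unitrX // mul1r mulrA tXj -mulrA mulrV ?unitrX // mulr1.
  congr (j _); elim: (n.+1) a => [//|m IHm] a.
  by rewrite iterSr [iter m.+1 tau a]iterS sigmaK -IHm.
by elim: (n.+1) => //= m IHm; apply: Ms; rewrite sigmaK.
Qed.

Lemma laurent_coef0 (s : seq (K * int)) b :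
  j b = \sum_(u <- s) j u.1 * t ^ u.2 -> b = \sum_(u <- s | u.2 == 0) u.1.
Proof.
move=> sE; pose u (l : 'I_(size s)) := nth (0, 0) s l.
pose f l := oapp (fun l => (u l).1) (- b) (unlift ord0 l).
pose n l := oapp (fun l => (u l).2) 0 (unlift ord0 l).
have /eqP : \sum_(l | n l == 0) f l = 0.
  apply: laurent_coef; rewrite big_ord_recl /f /n unlift_none /= expr0z mulr1.
  rewrite rmorphN sE (big_nth (0, 0)) big_mkord addrC -sumrB big1 // => l _.
  by rewrite liftK subrr.
rewrite big_mkcond big_ord_recl /f /n unlift_none /= addrC subr_eq0 => /eqP <-.
rewrite [RHS]big_mkcond (big_nth (0, 0)) big_mkord.
by apply: eq_bigr => l _; rewrite liftK.
Qed.

(** The elements of A whose Laurent coefficients lie in [M] form a subalgebra, stability under sigma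
    and its inverse being needed for products; it contains the generators. *)
Lemma coefficients_closed (X : set A) (M : set K) :
  generated_algebra (GRing.in_alg A) X = setT ->
  is_subalgebra iota M -> (forall a, M a -> M (sigma a)) ->
  (forall a, M (sigma a) -> M a) ->
  (forall a, X a -> exists s : seq (K * int), (forall u, u \in s -> M u.1) /\
     i a = \sum_(u <- s) j u.1 * t ^ u.2) ->
  degree0 `<=` M.
Proof.
move=> XT [Mc MD MM] Ms Ms' XM.
pose S : set A := [set a | exists s : seq (K * int), (forall u, u \in s -> M u.1) /\
     i a = \sum_(u <- s) j u.1 * t ^ u.2].
have ST a : S a.
  have : generated_algebra (GRing.in_alg A) X a by rewrite XT.
  apply; split=> //.
  split=> [c|x y [s [sM sE]] [s' [sM' sE']]|x y [s [sM sE]] [s' [sM' sE']]].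
  - exists [:: (iota c, 0)]; rewrite big_seq1 /= expr0z mulr1 j_iota linearZ /= rmorph1.
    by split=> [u|//]; rewrite inE => /eqP ->; exact: Mc.
  - exists (s ++ s'); rewrite big_cat raddfD -sE -sE'; split=> // u; rewrite mem_cat.
    by case/orP; [exact: sM|exact: sM'].
  - have /(_ _)/cid-/all_sig[sg sgP] := tzj.
    exists [seq (u.1 * sg u.2 v.1, u.2 + v.2) | u <- s, v <- s']; split.
      move=> _ /allpairsP[[u v] /= [/sM uM /sM' vM ->]] /=.
      by apply: MM => //; apply: (sgP u.2).2.
    rewrite big_allpairs_dep [LHS](rmorphM i) /= sE sE' mulr_suml; apply: eq_bigr => u _.
    rewrite mulr_sumr; apply: eq_bigr => v _ /=.
    rewrite exprzDr // rmorphM -!mulrA; congr (_ * _).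
    by rewrite !mulrA (sgP u.2).1.
move=> b [a gra ab]; have [s [sM sE]] := ST a.
rewrite ab in sE; rewrite (laurent_coef0 sE) big_seq_cond.
by apply: (@subalgebra_sum _ _ iota) => // u /andP[/sM].
Qed.

Definition eigenvector (w : K) : Prop := w != 0 /\ exists lam, sigma w = iota lam * w.

Lemma eigenvector_cover : degree0 `<=` T -> forall L : seq K,
  exists Z : seq K, (forall w, w \in Z -> eigenvector w) /\
    forall b, b \in L -> generated_field iota (GE 1 `|` [set` Z]) b.
Proof.
move=> A0T.
have mono (Z Z' : seq K) : {subset Z <= Z'} ->
    generated_field iota (GE 1 `|` [set` Z]) `<=` generated_field iota (GE 1 `|` [set` Z']).
  move=> ZZ'; apply: generated_field_min; first exact: generated_field_intermediate.
  move=> w [wG|/ZZ' wZ]; apply: sub_generated_field; first by left.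
  by right.
have coverT a : T a -> exists Z : seq K, (forall w, w \in Z -> eigenvector w) /\
    generated_field iota (GE 1 `|` [set` Z]) a.
  move=> [s [-> sP]]; elim: s sP => [|b s IHs] sP.
    exists [::]; split=> //; rewrite big_nil.
    by apply: (@subalgebra0 _ _ iota); case: (generated_field_intermediate iota (GE 1 `|` [set` [::]])).
  have [|Z [ZE Zs]] := IHs; first by move=> w ws; apply: sP; rewrite inE ws orbT.
  have [lam bG] := sP b (mem_head _ _).
  have [b0|b0] := eqVneq b 0; first by exists Z; rewrite big_cons b0 add0r.
  have [w w0 wE] := GE_eigenvector bG b0.
  exists (w :: Z); split=> [v|].
    by rewrite inE => /predU1P[->|/ZE //]; split=> //; exists lam.
  have [[_ MD MM] _] := generated_field_intermediate iota (GE 1 `|` [set` w :: Z]).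
  rewrite big_cons; apply: MD; last by apply: mono Zs => v vZ; rewrite inE vZ orbT.
  rewrite -[b](divfK w0); apply: MM; apply: sub_generated_field.
    left; rewrite -(divff (eigenvalue_neq0 w0 wE)).
    by apply: (GE_M sigma_k) => //; exact/eigen_GE/eigenV.
  by right; rewrite /= inE eqxx.
elim=> [|x L [Z [ZE ZL]]]; first by exists [::].
have [a [b [A0a A0b b0 xb]]] := degree0_frac x.
have [Z1 [Z1E Z1a]] := coverT a (A0T _ A0a).
have [Z2 [Z2E Z2b]] := coverT b (A0T _ A0b).
exists (Z ++ Z1 ++ Z2); split=> [w|y].
  by rewrite !mem_cat => /or3P[/ZE|/Z1E|/Z2E].
rewrite inE => /predU1P[->|/ZL]; last by apply: mono => w wZ; rewrite mem_cat wZ.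
have [[_ _ MM] MV] := generated_field_intermediate iota (GE 1 `|` [set` Z ++ Z1 ++ Z2]).
rewrite -[x](mulfK b0) xb; apply: MM.
  by apply: mono Z1a => w wZ; rewrite !mem_cat wZ orbT.
by apply: MV; apply: mono Z2b => w wZ; rewrite !mem_cat wZ !orbT.
Qed.

(** Finite generation of A does not pass directly to A_0, so eigenvectors are chosen to cover the
    Laurent coefficients of the generators of A. The field they generate over [GE 1] is stable under
    sigma and its inverse, hence contains A_0 and its fractions. *)
Lemma finite_eigen_family : fin_gen_algebra A -> degree0 `<=` T ->
  exists N (z : 'I_N -> K) (p : 'I_N -> k),
    eigen_family iota sigma z p /\ eigen_generated iota sigma z.
Proof.
move=> [X XT] A0T; have [_ [_ _ laurent _] _ _] := A_bircomm.
have [L LP] : exists L : seq K, forall a, a \in X -> exists s : seq (K * int),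
    (forall u, u \in s -> u.1 \in L) /\ i a = \sum_(u <- s) j u.1 * t ^ u.2.
  elim: X {XT} => [|a X [L LP]]; first by exists [::].
  have [s [f [_ sE]]] := laurent (i a).
  exists ([seq f n | n <- s] ++ L) => b; rewrite inE => /predU1P[->|/LP[s' [s'L ->]]].
    exists [seq (f n, n) | n <- s]; rewrite big_map; split=> // _ /mapP[n ns ->].
    by rewrite mem_cat /= map_f.
  by exists s'; split=> // u us; rewrite mem_cat s'L ?orbT.
have [Z [ZE ZL]] := eigenvector_cover A0T L.
pose M := generated_field iota (GE 1 `|` [set` Z]).
have [MM MV] : is_intermediate_field iota M := generated_field_intermediate iota _.
have [Mc MD MMul] := MM.
have ME w lam : w \in Z -> M (iota lam * w).
  by move=> wZ; apply: MMul => //; apply: sub_generated_field; right.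
have Ms a : M a -> M (sigma a).
  apply: (@generated_field_min _ _ _ _ [set a | M (sigma a)]) => [|w].
    split=> [|x Mx] /=; last by rewrite fmorphV; exact: MV.
    split=> [c|x y Mx My|x y Mx My] /=; first by rewrite sigma_k.
      by rewrite rmorphD; exact: MD.
    by rewrite rmorphM; exact: MMul.
  move=> [wG|wZ] /=; first by apply: sub_generated_field; left; exact: GE_sigma.
  by have [_ [lam ->]] := ZE _ wZ; exact: ME.
have Ms' a : M (sigma a) -> M a.
  suff : M `<=` [set sigma b | b in M].
    by move=> sub /sub[b Mb /(fmorph_inj sigma) <-].
  apply: generated_field_min => [|w].
    split=> [|_ [x Mx <-]]; last by exists x^-1; rewrite ?fmorphV //; exact: MV.
    split=> [c|_ _ [x Mx <-] [y My <-]|_ _ [x Mx <-] [y My <-]].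
    - by exists (iota c).
    - by exists (x + y); rewrite ?rmorphD //; exact: MD.
    - by exists (x * y); rewrite ?rmorphM //; exact: MMul.
  have [tau _ sigmaK] := sigma_bij.
  move=> [[n wn]|wZ]; last first.
    have [w0 [lam wE]] := ZE _ wZ; exists (iota lam^-1 * w); first exact: ME.
    rewrite rmorphM sigma_k wE mulrA -rmorphM mulVf ?rmorph1 ?mul1r //.
    exact: eigenvalue_neq0 w0 wE.
  exists (tau w); last exact: sigmaK.
  apply: sub_generated_field; left; exists n; apply: (fmorph_inj sigma).
  by rewrite -(iter_del_sigma sigma_k) sigmaK wn rmorph0.
have A0M : degree0 `<=` M.
  apply: (coefficients_closed XT MM Ms Ms') => a /LP[s [sL ->]]; exists s.
  by split=> // u /sL /ZL.
have pP (l : 'I_(size Z)) : exists lam, sigma Z`_l = iota lam * Z`_l.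
  by have [|_ //] := ZE Z`_l; rewrite mem_nth.
have /(_ _)/cid-/all_sig[p pE] := pP.
exists (size Z), (fun l => Z`_l), p; split=> [l|].
  by split=> //; have [|] := ZE Z`_l; rewrite ?mem_nth.
apply/seteqP; split=> // x _; have [a [b [A0a A0b b0 xb]]] := degree0_frac x.
have : M x.
  by rewrite -[x](mulfK b0) xb; apply: MMul; [exact: A0M A0a|apply: MV; exact: A0M A0b].
congr (generated_field _ (_ `|` _) _); apply/seteqP; split=> [w wZ|_ [l _ <-]].
  have lt_w : (index w Z < size Z)%N by rewrite index_mem.
  by exists (Ordinal lt_w) => //=; rewrite nth_index.
by rewrite /= mem_nth.
Qed.

Lemma degree0_subalgebra : is_subalgebra iota degree0.
Proof.
have [g0 gD gZ] := gr_submod 0.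
split=> [c|x y [a gra ia] [b grb ib]|x y]; last exact: degree0M.
  exists (c *: 1); first exact: gZ.
  by rewrite linearZ /= rmorph1 j_iota.
by exists (a + b); [exact: gD|rewrite raddfD /= ia ib rmorphD].
Qed.

Lemma degree0_preimage y a : i a = j y -> degree0 y.
Proof.
move=> ay; have [_ _ /(_ a)[s [f [_ grf aE]]] _] := A_graded.
have /(_ _)/cid-/all_sig[h hP] := fun n => gr_coef (grf n).
have : j y = \sum_(u <- [seq (h n, n) | n <- s]) j u.1 * t ^ u.2.
  rewrite big_map -ay aE raddf_sum.
  by apply: eq_bigr => n _; exact: hP.
move=> /laurent_coef0 ->; rewrite big_map /=.
have D0 := degree0_subalgebra.
apply: (subalgebra_sum _ D0) => n /eqP n0; exists (f n); first by rewrite -n0.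
by rewrite hP n0 expr0z mulr1.
Qed.

(* [a | a y in A] is a left ideal, and a right ideal because the conjugates of
   [y] by powers of t are affine in [y]. *)
Lemma simple_degree0 p c y : simple_ring A -> p != 0 ->
  sigma y = iota p * y + iota c -> degree0 y.
Proof.
move=> A_simple p0 yE.
pose I : set A := [set a | exists a', i a * j y = i a'].
have affine n : exists p' c', forall h, j h * t ^ n * j y =
    (p'%:A * j y + c'%:A) * (j h * t ^ n).
  have [s [sP sM]] := tzj n.
  have [|||p' [c' E]] := sM [set x | exists p' c', x = iota p' * y + iota c'] _ _ y.
  - move=> _ [p' [c' ->]]; exists (p' * p), (p' * c + c').
    by rewrite rmorphD !rmorphM !sigma_k yE /=; ring.
  - move=> a [p' [c' E]]; exists (p' / p), (c' - p' / p * c).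
    apply: (fmorph_inj sigma); rewrite E (rmorphD sigma) (rmorphM sigma) !sigma_k yE.
    rewrite rmorphB (rmorphM iota (p' / p) c) mulrDr mulrA -rmorphM divfK //=.
    by ring.
  - by exists 1, 0; rewrite rmorph1 rmorph0 mul1r addr0.
  - exists p', c' => h; rewrite -mulrA sP mulrA -rmorphM mulrC rmorphM -mulrA.
    by rewrite E rmorphD rmorphM /= !j_iota.
have gr_I a b n : I a -> gr n b -> exists a', i (a * b) * j y = i a'.
  move=> [a' aE] grb; have [h bE] := gr_coef grb; have [p' [c' E]] := affine n.
  exists ((p' *: a' + c' *: a) * b).
  rewrite [in LHS](rmorphM i) [RHS](rmorphM i) /= -mulrA {1}bE E -bE mulrA; congr (_ * _).
  rewrite [RHS]raddfD /= !linearZ /= -aE.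
  by rewrite mulrDr mulr_algl -scalerAr mulr_algr.
have I_ideal : is_ideal I.
  split; last first.
    move=> a b Ia; have [_ _ /(_ b)[s [f [_ grf ->]]] _] := A_graded.
    rewrite mulr_sumr /I /= raddf_sum /= mulr_suml.
    elim/big_ind: _ => [|_ _ [a1 ->] [a2 ->]|n _]; first by exists 0; rewrite raddf0.
      by exists (a1 + a2); rewrite raddfD.
    exact: gr_I.
  split=> [|x x' [a xE] [a' x'E]|b x [a xE]].
  - by exists 0; rewrite raddf0 mul0r.
  - by exists (a + a'); rewrite !raddfD /= mulrDl xE x'E.
  - by exists (b * a); rewrite !rmorphM -mulrA xE.
(* The ideal contains a denominator of [y], so it is nonzero. By simplicity it contains 1, that is,
   [y] comes from A. *)
have [a [b [[a0 _ a0E] [b1 _ b1E] b0 yb]]] := degree0_frac y.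
have Ib : I b1 by exists a0; rewrite b1E a0E -yb mulrC rmorphM.
have [I0|IT] := A_simple _ I_ideal.
  move: Ib b1E; rewrite I0 => ->; rewrite raddf0 => /esym/eqP.
  by rewrite fmorph_eq0 (negPf b0).
have : I 1 by rewrite IT.
by move=> [a']; rewrite rmorph1 mul1r => /esym; exact: degree0_preimage.
Qed.

End DegreeZeroInT.

Lemma degree0_sub_T (R : realType) d : has_trdeg iota d -> GKdim A R = (d%:R + 1)%:E ->
  degree0 `<=` sum_generalized_eigenspaces iota sigma.
Proof.
move=> K_trdeg A_GKdim a A0a.
have [l [c [[r cr] c0]]] := degree0_locally_finite K_trdeg A_GKdim A0a.
have [f fE] := sigma_linear_exists sigma_k.
pose p := \poly_(n < l) oapp c 0 (insub n).
have pc (n : 'I_l) : p`_n = c n by rewrite coef_poly ltn_ord valK.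
have p0 : p != 0 by apply: contraNneq cr => p0; rewrite -pc p0 coef0.
have pa : @pact k (fmod iota) f p a = 0.
  rewrite (@pact_wide _ _ _ l) ?size_poly // -[RHS]c0.
  by apply: eq_bigr => n _; rewrite pc fE.
have [s [aE sP]] := pact_split p0 pa.
exists s; split=> // b /sP[lam bG]; exists lam; exact/(gen_eigen_GE _ _ fE).
Qed.

End BirationallyCommutative.

(** * Assembly of the three statements *)

Theorem theorem5p5 (R : realType) (k : closedFieldType)
  (A : algType k) (gr : int -> set A)
  (K : fieldType) (iota : {rmorphism k -> K}) (sigma : {rmorphism K -> K})
  (Q : unitAlgType k) (i : {lrmorphism A -> Q}) (j : {rmorphism K -> Q}) (t : Q)
  (d : nat)
  (A_graded : is_grading gr)
  (A_fin_gen : fin_gen_algebra A)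
  (A_n_neq0 : forall n : int, gr n <> [set 0])
  (A_ore : ore_domain A)
  (sigma_bij : bijective sigma)
  (sigma_k : forall c : k, sigma (iota c) = iota c)
  (A_bircomm : is_birationally_commutative gr iota sigma i j t)
  (K_trdeg : has_trdeg iota d)
  (A_GKdim : GKdim A R = (d%:R + 1)%:E) :
  let T := sum_generalized_eigenspaces iota sigma in
  [/\ centerless Q ->
        ((exists (m : nat) (x : 'I_m.+1 -> K) (p : 'I_m -> k),
            [/\ is_rational_function_field iota x,
                sigma (x ord0) = x ord0 + 1
                  /\ (forall l : 'I_m,
                        sigma (x (lift ord0 l)) = iota (p l) * x (lift ord0 l)),
                T = generated_algebra iota
                      (range x `|` range (fun l : 'I_m => (x (lift ord0 l))^-1)),
                freely_generate p
              & [pchar k] =i pred0])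
         \/
         (exists (m : nat) (x : 'I_m -> K) (p : 'I_m -> k),
            [/\ is_rational_function_field iota x,
                (forall l : 'I_m, sigma (x l) = iota (p l) * x l),
                T = generated_algebra iota
                      (range x `|` range (fun l : 'I_m => (x l)^-1))
              & freely_generate p]))
        /\ i @` gr 0 `<=` j @` T,
      centerless Q -> simple_ring A -> i @` gr 0 = j @` T
    & primitive A -> noetherian A -> ~ countable [set: k] -> centerless Q].
Proof.
have A_dom : domain A by case: A_ore.
move=> T; have A0T : degree0 gr i j `<=` T.
  exact: (degree0_sub_T A_graded A_n_neq0 A_dom sigma_k A_bircomm K_trdeg A_GKdim).
have image_sub : i @` gr 0 `<=` j @` T.
  move=> _ [a gra <-]; have [x A0x ->] := degree0_gr A_graded A_bircomm gra.
  by exists x => //; exact: A0T.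
have [N [z [r [zp zT]]]] := finite_eigen_family A_graded A_n_neq0 A_dom sigma_bij
  sigma_k A_bircomm A_fin_gen A0T.
have structure Q_central := sigma_structure sigma_k
  (fixed_field_scalars A_bircomm Q_central) zp zT.
split=> [Q_central|Q_central A_simple|A_prim _ k_unc].
- by split; first exact: structure.
- apply/seteqP; split=> // _ [y Ty <-].
  suff [a gra ia] : degree0 gr i j y by exists a.
  move: y Ty.
  (* Every generator of T has this affine form: the translated variable with [q = c = 1], the other
     variables and their inverses with [c = 0]. *)
  have affine q c y : q != 0 -> sigma y = iota q * y + iota c -> degree0 gr i j y.
    exact: (simple_degree0 A_graded A_n_neq0 A_dom sigma_bij sigma_k A_bircomm).
  have eigen p y : p != 0 -> sigma y = iota p * y ->
      degree0 gr i j y /\ degree0 gr i j y^-1.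
    move=> p0 yE; split; first by apply: (affine p 0) => //; rewrite yE rmorph0 addr0.
    apply: (affine p^-1 0); first by rewrite invr_eq0.
    by rewrite fmorphV yE invfM fmorphV rmorph0 addr0.
  have D0 : is_subalgebra iota (degree0 gr i j) by exact: degree0_subalgebra A_bircomm.
  have [] := structure Q_central.
    move=> [m [x [p [_ [x0E xE] TE [p0 _] _]]]]; rewrite /T TE.
    apply: generated_algebra_min => // _ [[l _ <-]|[l _ <-]]; last first.
      by case: (eigen _ _ (p0 l) (xE l)).
    case: (unliftP ord0 l) => [l' ->|->]; first by case: (eigen _ _ (p0 l') (xE l')).
    by apply: (affine 1 1); rewrite ?oner_neq0 // rmorph1 mul1r.
  move=> [m [x [p [_ xE TE [p0 _]]]]]; rewrite /T TE.
  apply: generated_algebra_min => // _ [[l _ <-]|[l _ <-]].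
    by case: (eigen _ _ (p0 l) (xE l)).
  by case: (eigen _ _ (p0 l) (xE l)).
- exact: primitive_centerless A_bircomm A_fin_gen A_prim k_unc.
Qed.
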